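(* Let $\phi:\mathbb{R}\to\mathbb{R}$ be continuous and $1$-periodic with amplitude $A_\phi=\max\phi-\min\phi$; let $T,R>0$, $v_{\min}>0$, $\epsilon>0$, and let $k$ be a kernel satisfying (K1)--(K4) of the context. Let $W=(W_t)_{t\in[0,T]}$ be a stochastic process with continuous paths such that, for some $q>0$, almost surely $\|W\|_\infty\le (A_\phi-\epsilon-q)/2$, and such that, for some $0<r_1<r_2$, there is a constant $K_{r_2,r_1}$ with $$\mathbb{E}\big[|W_t-W_s|^{r_2}\big]\le K_{r_2,r_1}|t-s|^{1+r_1}\qquad\text{for all } s,t\in[0,T].$$ Let $\mu_1,\mu_2$ be two probability measures on $\Gamma_{T,R,v_{\min}}$ and let $\gamma_j\sim\mu_j$, $j=1,2$, be independent of $W$. If $p\ge 1+\max\left(r_2,\frac{r_2}{r_1-1}\right)$, and the functional $\overline{\rho}$ defining the signature $F$ is built with $\epsilon,p,k$, then $$\left\|F(\phi\circ\gamma_1+W)-F(\phi\circ\gamma_2+W)\right\|_\infty\le\frac{\tilde C(K_{r_2,r_1})}{v_{\min}^{\alpha}}\,W_{1,\|\cdot\|_\infty}(\mu_1,\mu_2)^{\alpha},$$ where $\tilde C(x)=\mathcal{O}\big(x^{1/r_2}(1+x^{1/(r_1-1)})\big)$ depends on $\phi,\epsilon,p,q$ and $k$, and where $\alpha$ is the Hölder exponent of the sample paths of $W$ given in the context.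
   Context: **Hölder exponent.** The moment condition on $W$ implies that $W$ has a version with Hölder continuous sample paths of any exponent in $(0,r_1/r_2)$; the exponent used is $\alpha=\min(1,r_1-1)/r_2$. **Reparametrisations.** $\Gamma_{T,R,v_{\min}}=\{\gamma\in C([0,T],[0,R]):\gamma(0)=0,\ \gamma(T)=R,\ 0\le v_{\min}(t-s)\le\gamma(t)-\gamma(s)\text{ for all }s\le t\}$, with the sup norm and its Borel $\sigma$-algebra; $W_{1,\|\cdot\|_\infty}$ is the $1$-Wasserstein distance between probability measures on this metric space. **Persistence diagram.** For a continuous function $h:\mathbb{X}\to\mathbb{R}$ on a compact interval $\mathbb{X}$, let $\mathbb{X}_t=h^{-1}((-\infty,t])$ and define a persistence module by $V_t=H_0(\mathbb{X}_t)$ (singular homology with coefficients in a fixed field) if $t<\max h$ and $V_t=0$ if $t\ge\max h$; for $s\le t<\max h$ the map $V_s\to V_t$ is induced by inclusion, and for $t\ge \max h$ it is zero. All ranks $r(s,t)=\mathrm{rank}(V_s\to V_t)$, $s<t$, are finite. The persistence diagram $D(h)$ is the multiset consisting of every diagonal point $(r,r)$ with infinite multiplicity together with the unique locally finite multiset of points in $\{(b,d):b<d\}$ such that for all $a<b<c<d$ for which no point lies on the boundary of $[a,b]\times[c,d]$, the number of points (with multiplicity) in $[a,b]\times[c,d]$ equals $r(b,c)-r(a,c)-r(b,d)+r(a,d)$. **Kernel and functionals.** Let $(\mathbb{T},d)$ be a Euclidean space. A kernel is a map $k$ which associates to each $x\in\mathbb{R}^2$ a function $k(x):\mathbb{T}\to\mathbb{R}$;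 $\|\cdot\|_\infty$ is the sup norm for functions and the max norm on $\mathbb{R}^2$. Assumptions: (K1) there is a compact $K_0\subset\mathbb{T}$ with $k(x)=0$ on $\mathbb{T}\setminus K_0$ for all $x$; (K2) there is $L>0$ with $|k(x)(t)-k(x)(s)|\le L\,d(s,t)$ for all $x\in\mathbb{R}^2$, $s,t\in\mathbb{T}$; (K3) there is $L_k>0$ with $\|k(x)-k(x')\|_\infty\le L_k\|x-x'\|_\infty$ for all $x,x'$; (K4) there is $C\ge0$ with $\|k(x)\|_\infty\le C$ for all $x$ on the diagonal $\{(r,r):r\in\mathbb{R}\}$. With $w_\epsilon(b,d)=\max(d-b-\epsilon,0)$, for a continuous function $S$ on $[0,T]$, $$\overline{\rho}(S)(t)=\frac{\sum_{x\in D(S)}w_\epsilon(x)^p\,k(x)(t)}{\sum_{x\in D(S)}w_\epsilon(x)^p}$$ if the denominator is positive and $\overline{\rho}(S)=0$ otherwise. For a random continuous function $S$, the signature is $F(S)(t)=\mathbb{E}[\overline{\rho}(S)(t)]$, $t\in\mathbb{T}$.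
   Formalization: It is added that φ takes all its values on [0,R] (automatic if R ≥ 1; otherwise the claim can fail) and that α > 0, i.e. r1 > 1; the constant C̃ may also depend on T, r1, r2 (independence of T fails under a linear change of time). *)

(* Defs.v *)
From HB Require Import structures.
From mathcomp Require Import all_boot all_order all_algebra.
From mathcomp Require Import all_classical all_reals all_analysis.
From mathcomp Require Export freeg.

Set Implicit Arguments.
Unset Strict Implicit.
Unset Printing Implicit Defensive.

Import Order.TTheory GRing.Theory Num.Theory.
Import numFieldNormedType.Exports.

Local Open Scope classical_set_scope.
Local Open Scope ring_scope.

(* Extended-real valued, so that unbounded functions have norm +oo. *)
Definition sup_norm {R : realType} {X : Type} (f : X -> R) : \bar R :=
  ereal_sup (range (fun x => `|f x|%:E)).

Definition amplitude {R : realType} (phi : R -> R) : R :=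
  sup (range phi) - inf (range phi).

(* phi takes all its values on [0, L], so that phi \o gamma has the full     *)
(* amplitude of phi for every reparametrisation gamma of range [0, L].      *)
Definition full_range {R : realType} (phi : R -> R) (L : R) : Prop :=
  forall x, exists2 y, 0 <= y <= L & phi y = phi x.

Lemma full_range_periodic {R : realType} (phi : R -> R) (L : R) :
  (forall x, phi (x + 1) = phi x) -> 1 <= L -> full_range phi L.
Proof.
move=> per L1 x.
have perN (m : nat) y : phi (y + m%:R) = phi y.
  by elim: m y => [|m IH] y; rewrite ?addr0// -natr1 addrA per IH.
have perZ (m : int) y : phi (y + m%:~R) = phi y.
  case: m => m; first exact: perN.
  by rewrite NegzE -(perN m.+1) mulrNz subrK.
have /andP[fx xf] := floor_itv x.
exists (x - (Num.floor x)%:~R); last by rewrite -mulrNz perZ.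
rewrite subr_ge0 fx/=; apply: le_trans L1.
by rewrite lerBlDl -[X in _ + X]/(1%:~R) -intrD ltW.
Qed.

Definition holder_exponent {R : realType} (r1 r2 : R) : R :=
  Num.min 1 (r1 - 1) / r2.

(* The space [0, T], with the subspace topology of R. *)
Definition time {R : realType} (T : R) := set_type (`[0, T]%classic : set R).

Section homology.
Context {R : realType} (F : fieldType) {X : topologicalType}.
Implicit Types (A B : set X) (c : {freeg X / F}).

Definition chain0 A : set {freeg X / F} := [set c | [set` dom c] `<=` A].

(* Singular 1-simplices of A; the values of sigma off [0, 1] are irrelevant. *)
Definition simplex1 A : set (R -> X) :=
  [set sigma : R -> X |
    {within `[0, 1]%classic : set R, continuous sigma} /\
    sigma @` `[0, 1] `<=` A].

Definition boundary1 (sigma : R -> X) : {freeg X / F} :=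
  << sigma 1 >> - << sigma 0 >>.

Definition boundary0 A : set {freeg X / F} :=
  [set c | exists n (a : 'I_n -> F) (sigma : 'I_n -> R -> X),
     (forall i, simplex1 A (sigma i)) /\
     c = \sum_(i < n) a i *: boundary1 (sigma i)].

(* H_0(A) is chain0 A modulo boundary0 A, since every 0-chain is a cycle. *)
(* The classes of the chains u i of A are linearly independent in H_0(B).  *)
Definition H0_free A B n (u : 'I_n -> {freeg X / F}) : Prop :=
  (forall i, chain0 A (u i)) /\
  forall a : 'I_n -> F,
    boundary0 B (\sum_(i < n) a i *: u i) -> forall i, a i = 0.

(* Dimension of the image of H_0(A) -> H_0(B), for A included in B. *)
Definition H0_rank A B : R :=
  sup [set n%:R | n in [set n | exists u : 'I_n -> _, H0_free A B u]].

End homology.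

Section persistence.
Context {R : realType} (F : fieldType) {X : topologicalType}.
Implicit Types (h : X -> R) (x : R * R).

Definition sublevel h (t : R) : set X := [set x | h x <= t].

Definition persistence_rank h (s t : R) : R :=
  if t < sup (range h) then H0_rank F (sublevel h s) (sublevel h t) else 0.

Definition rectangle (a b c d : R) : set (R * R) := `[a, b] `*` `[c, d].

Definition rectangle_boundary (a b c d : R) : set (R * R) :=
  rectangle a b c d `\` (`]a, b[ `*` `]c, d[).

(* A multiset of points of the open half-plane b < d is given by its *)
(* multiplicity function.                                            *)
Definition offdiagonal_spec h : set (R * R -> nat) := [set m |
  [/\ forall x, ~~ (x.1 < x.2) -> m x = 0%N,
      forall x, x.1 < x.2 ->
        exists2 U, nbhs x U & finite_set (U `&` [set y | m y != 0%N]) &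
      forall a b c d, a < b -> b < c -> c < d ->
        (forall x, rectangle_boundary a b c d x -> m x = 0%N) ->
        (\esum_(x in rectangle a b c d) (m x)%:R%:E =
         (persistence_rank h b c - persistence_rank h a c
          - persistence_rank h b d + persistence_rank h a d)%:E)%E]].

(* Multiplicity of a point in the persistence diagram of h. *)
Definition diagram h x : \bar R :=
  if x.1 == x.2 then +oo%E
  else (xget (fun=> 0%N) (offdiagonal_spec h) x)%:R%:E.

(* Sum of f over the diagram of h, with multiplicities. The diagonal       *)
(* contributes 0 when f vanishes there (+oo * 0 = 0). The sum \sum_(_ \in _) *)
(* is that of a finite family: this is the case when f is supported in     *)
(* d - b > eps with eps > 0 and h is continuous on a compact interval.     *)
Definition diagram_sum h (f : R * R -> R) : R :=
  \sum_(x \in [set: R * R]) fine (diagram h x * (f x)%:E)%E.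

Definition weight (eps : R) x : R := Num.max (x.2 - x.1 - eps) 0.

Definition rho_bar {S : Type} (eps p : R) (k : R * R -> S -> R) h (t : S) : R :=
  let num := diagram_sum h (fun x => weight eps x `^ p * k x t) in
  let den := diagram_sum h (fun x => weight eps x `^ p) in
  if 0 < den then num / den else 0.

Definition signature {S : Type} (eps p : R) (k : R * R -> S -> R)
    {d} {Omega : measurableType d} (P : probability Omega R)
    (h : Omega -> X -> R) (t : S) : R :=
  fine ('E_P[fun w => rho_bar eps p k (h w) t])%E.

End persistence.

Definition euclidean_dist {R : realType} {n} (s t : 'rV[R]_n) : R :=
  Num.sqrt (\sum_(i < n) (s 0 i - t 0 i) ^+ 2).

(* `|x - x'| is the max norm of R * R. *)
Record kernel_assumptions {R : realType} {n}
    (k : R * R -> 'rV[R]_n -> R) : Prop := KernelAssumptions {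
  kernel_compact : exists2 K0 : set 'rV[R]_n, compact K0 &
    forall x t, ~ K0 t -> k x t = 0 ;
  kernel_lipschitz : exists2 L : R, 0 < L &
    forall x s t, `|k x t - k x s| <= L * euclidean_dist s t ;
  kernel_lipschitz_point : exists2 Lk : R, 0 < Lk &
    forall x x' : R * R, (sup_norm (k x \- k x')%R <= (Lk * `|x - x'|)%:E)%E ;
  kernel_diagonal : exists2 C : R, 0 <= C &
    forall r : R, (sup_norm (k (r, r)) <= C%:E)%E }.

(* The reparametrisations from [0, T] onto [0, L]. *)
Definition Gamma {R : realType} (T L vmin : R) : set (time T -> R) := [set g : time T -> R |
  [/\ continuous g,
      forall t, 0 <= g t <= L,
      forall t, \val t = 0 -> g t = 0,
      forall t, \val t = T -> g t = L &
      forall s t, \val s <= \val t ->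
        0 <= vmin * (\val t - \val s) <= g t - g s]].

Arguments Gamma {R} T L vmin _.

Section reparametrisations.
Context {R : realType} {T L vmin : R}.

(* A measurableType has a distinguished point, whence the argument ne. *)
Definition Gamma_space (ne : Gamma T L vmin !=set0) := set_type (Gamma T L vmin).

HB.instance Definition _ ne := Choice.on (Gamma_space ne).
HB.instance Definition _ ne := isPointed.Build (Gamma_space ne)
  (SigSub (mem_set (projT2 (cid ne)))).

Definition Gamma_dist ne (g g' : Gamma_space ne) : \bar R :=
  sup_norm (set_val g \- set_val g').

Definition Gamma_open {ne} : set_system (Gamma_space ne) := [set U |
  forall g, U g -> exists2 e : R, 0 < e &
    forall g', (Gamma_dist g g' < e%:E)%E -> U g'].

(* Gamma_space with its Borel sigma-algebra *)
Definition Gamma_borel ne := g_sigma_algebraType (@Gamma_open ne).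

End reparametrisations.
Arguments Gamma_dist {R T L vmin} ne g g'.

Section probability.
Context {R : realType}.

Definition coupling d (G : measurableType d) (mu nu : probability G R) :
    set (probability (G * G)%type R) :=
  [set pi | forall A, measurable A ->
     pi (A `*` setT) = mu A /\ pi (setT `*` A) = nu A].

Definition wasserstein1 d (G : measurableType d) (dist : G -> G -> \bar R)
    (mu nu : probability G R) : \bar R :=
  ereal_inf [set (\int[pi]_x dist x.1 x.2)%E | pi in coupling mu nu].

(* Independence of a random element and a process: sigma(g) and *)
(* sigma(W_t : t in I) are independent.                         *)
Definition independent_process d (Omega : measurableType d)
    (P : probability Omega R) d' (G : measurableType d') (g : {RV P >-> G})
    (I : Type) (W : I -> {RV P >-> R}) : Prop :=
  forall A B, measurable A ->
    <<s \bigcup_(t in [set: I]) preimage_set_system setT (W t) measurable >> B ->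
    P (g @^-1` A `&` B) = (P (g @^-1` A) * P B)%E.

End probability.

(* Main.v *)
Require Import Defs.
From HB Require Import structures.
From mathcomp Require Import all_boot all_order all_algebra.
From mathcomp Require Import all_classical all_reals all_analysis.
From mathcomp Require Import measurable_realfun.
From mathcomp Require Import ring lra zify.

Set Implicit Arguments.
Unset Strict Implicit.
Unset Printing Implicit Defensive.

Import Order.TTheory GRing.Theory Num.Theory.
Import numFieldNormedType.Exports.

Local Open Scope classical_set_scope.
Local Open Scope ring_scope.

(** Fix a path of the noise [W] and two reparametrisations [g1], [g2] at distance [dd].
The increasing time change [tau = g2^-1 \o g1] moves no time by more than [dd / vmin],
and the diagram of a function does not change when its time is changed. Hence
[phi \o g2 + W] has the same diagram as [phi \o g1 + W \o tau], which differs from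
[phi \o g1 + W] by at most [Delta], the oscillation of [W] over times [dd / vmin].

The weighted mean of the kernel over the diagram is a Lipschitz function of the signal.
It suffices to know this for small perturbations of a given signal and to integrate along
a segment of signals ([weighted_mean_path]); for small perturbations every point of the
diagram of persistence more than [eps / 2] splits into as many close points as its
multiplicity says ([local_stability]). The Lipschitz constant is of the order of the number of
bars longer than [eps / 2], divided by the total weight. The amplitude left by the noise provides each
period of [phi] with a bar of weight at least [(q / 2) `^ p] ([signal_rank_ge]); the number of bars
is at most of the order of the number of periods plus [H `^ (1 / beta)], when [W] is Hoelder
continuous of order [beta] with constant [H] ([signal_rank_le]). The two numbers of periods
cancel, and the pathwise bound is a multiple of [(1 + H `^ (1 / beta)) * Delta], uniformly in the
length of the range of the reparametrisations ([signal_stability]).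

The moment condition yields [H] with [E (H `^ r2)] of order [K], for every [beta < r1 / r2]
([dyadic_variation], [hoelder_of_dyadic]). With [alpha] the Hoelder exponent of the theorem
and [del = dd / vmin], [Delta] is bounded both by a multiple of [H * del `^ alpha] and,
since [W] is bounded, by a multiple of [H `^ (alpha / beta) * del `^ alpha]. The second
bound is used where [H] already occurs with the power [1 / beta]; a suitable [beta] keeps the
power of [K] in the mean within the required range ([mean_stability]).

Finally, independence writes the signature as the mean over [mu1] or [mu2] of a function
of the reparametrisation alone ([signature_disintegration]). This function is Hoelder
continuous of order [alpha <= 1] by the above, and Jensen's inequality under a coupling of [mu1] and
[mu2] gives the power [alpha] of the Wasserstein distance ([wasserstein1_hoelder]).

The diagram is reached through the ranks [comp_rank h s t], which count points of the
sublevel set at [s] separated at level [t]. They agree with the ranks in homology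
([persistence_rankE]), and their second differences over small squares are the
multiplicities of the diagram ([mult_offdiagonal_spec], [offdiagonal_spec_unique]). *)

(** * Finite sets of levels *)

Section finite_sets_of_reals.
Context {R : realType}.
Implicit Types (G : seq R) (f : R -> nat).

Definition avoids G (s s' : R) := forall g, g \in G -> ~~ (s <= g <= s').

Lemma avoids_cat G1 G2 s s' :
  avoids (G1 ++ G2) s s' <-> avoids G1 s s' /\ avoids G2 s s'.
Proof.
split=> [h|[h1 h2] g]; last by rewrite mem_cat => /orP[/h1|/h2].
by split=> g gG; apply: h; rewrite mem_cat gG ?orbT.
Qed.

Lemma avoids_sub G s s' u u' : s <= u -> u' <= s' -> avoids G s s' -> avoids G u u'.
Proof.
move=> su us h g /h; apply: contra => /andP[ug gu].
by rewrite (le_trans su)// (le_trans gu).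
Qed.

(** A bounded nondecreasing integer function jumps only at the points
[sup [set x | f x <= k]], one for each of its finitely many values [k]. *)
Lemma finite_jumps f (N : nat) :
  {homo f : x y / x <= y >-> (x <= y)%N} -> (forall x, (f x <= N)%N) ->
  exists G, forall s s', s <= s' -> avoids G s s' -> f s = f s'.
Proof.
move=> fh fN; exists [seq sup [set x | (f x <= k)%N] | k <- iota 0 N] => s s' ss' av.
apply/eqP; case: (ltngtP (f s) (f s')) => // [lt|]; last first.
  by rewrite ltnNge fh.
have ub : ubound [set x | (f x <= f s)%N] s'.
  move=> x /= fx; rewrite leNgt; apply/negP => /ltW /fh.
  by rewrite leqNgt (leq_ltn_trans fx lt).
have := av (sup [set x | (f x <= f s)%N]) _.
rewrite ub_le_sup//=; last by exists s'.
rewrite ge_sup//; last by exists s => /=.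
move=> /(_ _)/negP; case => //; apply/map_f.
by rewrite mem_iota /= add0n (leq_trans lt).
Qed.

Lemma separated_from G (x : R) :
  exists2 g, 0 < g & forall y, y \in G -> y != x -> g <= `|y - x|.
Proof.
elim: G => [|z G [g g0 h]]; first by exists 1.
have [->|zx] := eqVneq z x.
  by exists g => // y; rewrite inE => /orP[/eqP->|/h//]; rewrite eqxx.
exists (Num.min g `|z - x|); first by rewrite lt_min g0 normr_gt0 subr_eq0.
move=> y; rewrite inE => /orP[/eqP-> _|yG yx]; first by rewrite ge_min lexx orbT.
by rewrite ge_min h.
Qed.

Lemma separated G :
  exists2 g, 0 < g & forall x y, x \in G -> y \in G -> x < y -> x + g <= y.
Proof.
elim: G => [|z G [g g0 h]]; first by exists 1.
have [g' g'0 h'] := separated_from G z.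
exists (Num.min g g'); first by rewrite lt_min g0.
move=> x y; rewrite !inE => /orP[/eqP->|xG] /orP[/eqP->|yG]; rewrite ?ltxx// => xy.
- have := h' _ yG; rewrite gt_eqF// => /(_ isT); rewrite gtr0_norm ?subr_gt0//.
  by rewrite lerBrDl => /(le_trans _); apply; rewrite lerD2l ge_min lexx orbT.
- have := h' _ xG; rewrite lt_eqF// => /(_ isT); rewrite ltr0_norm ?subr_lt0//.
  rewrite opprB lerBrDl => /(le_trans _); apply.
  by rewrite lerD2l ge_min lexx orbT.
- by apply: le_trans (h _ _ xG yG xy); rewrite lerD2l ge_min lexx.
Qed.

Lemma avoid_point G (a b : R) : a < b -> exists2 c, a < c < b & c \notin G.
Proof.
move=> ab; have [g g0 h] := separated_from G a.
exists (a + Num.min g (b - a) / 2).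
  have : 0 < Num.min g (b - a) by rewrite lt_min g0 subr_gt0.
  have : Num.min g (b - a) <= b - a by rewrite ge_min lexx orbT.
  by move=> *; lra.
have p : 0 < Num.min g (b - a) by rewrite lt_min g0 subr_gt0.
have q : Num.min g (b - a) <= g by rewrite ge_min lexx.
apply/negP => /h; rewrite gt_eqF; last by lra.
move=> /(_ isT); rewrite gtr0_norm; lra.
Qed.

(** Telescoping: off a finite set [G] the function is locally constant, hence its
variation is the sum of its jumps. *)
Lemma sum_jumps G (f : R -> R) (kappa a b : R) :
  uniq G -> 0 < kappa ->
  (forall x y, x \in G -> y \in G -> x < y -> x + 3 * kappa <= y) ->
  a <= b ->
  (forall x, x \in G -> a <= x <= b -> a + kappa <= x <= b - kappa) ->
  (forall s s', a <= s -> s <= s' -> s' <= b -> avoids G s s' -> f s = f s') ->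
  \sum_(g <- G | a <= g <= b) (f (g + kappa) - f (g - kappa)) = f b - f a.
Proof.
move=> uG k0 sepG.
have [n] := ubnP (count (fun g => a <= g <= b) G).
elim: n a b => // n IH a b; rewrite ltnS => cnt ab sep const.
have [/hasP[g gG /andP[ag gb]]|/hasPn none] := boolP (has (fun g => a <= g <= b) G);
  last first.
  rewrite (const a b)// ?subrr; last first.
  rewrite big1_seq// => i /andP[abi /none]; by rewrite abi.
have := sep g gG; rewrite ag gb => /(_ isT)/andP[agk gbk].
have pre1 : forall s s', a <= s -> s <= s' -> s' <= g - kappa ->
    avoids G s s' -> f s = f s'.
  by move=> s s' ? ? ?; apply: const => //; lra.
have pre2 : forall s s', g + kappa <= s -> s <= s' -> s' <= b ->
    avoids G s s' -> f s = f s'.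
  by move=> s s' ? ? ?; apply: const => //; lra.
have lts (P : pred R) : (forall x, P x -> a <= x <= b) -> ~~ P g ->
    (count P G < n)%N.
  move=> sP Pg; apply: leq_trans cnt.
  rewrite -!size_filter.
  have -> : [seq x <- G | P x] = [seq x <- [seq x <- G | a <= x <= b] | P x].
    rewrite -filter_predI; apply: eq_filter => x /=.
    by case: (boolP (P x)) => //= /sP.
  rewrite size_filter -(count_predC P [seq x <- G | a <= x <= b]) -addn1 leq_add2l.
  rewrite -has_count; apply/hasP; exists g => //=.
  by rewrite mem_filter ag gb gG.
have sep1 : forall x, x \in G -> a <= x <= g - kappa ->
    a + kappa <= x <= g - kappa - kappa.
  move=> x xG /andP[ax xg]; have := sep x xG.
  have xg' : x < g by lra.
  by have := sepG _ _ xG gG xg' => ? /(_ ltac:(lra)); lra.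
have sep2 : forall x, x \in G -> g + kappa <= x <= b ->
    g + kappa + kappa <= x <= b - kappa.
  move=> x xG /andP[ax xg]; have := sep x xG.
  have xg' : g < x by lra.
  by have := sepG _ _ gG xG xg' => ? /(_ ltac:(lra)); lra.
have I1 : \sum_(x <- G | a <= x <= g - kappa) (f (x + kappa) - f (x - kappa)) =
    f (g - kappa) - f a.
  apply: IH => //; [apply: lts => [x|]; last rewrite negb_and -!ltNge|]; lra.
have I2 : \sum_(x <- G | g + kappa <= x <= b) (f (x + kappa) - f (x - kappa)) =
    f b - f (g + kappa).
  apply: IH => //; [apply: lts => [x|]; last rewrite negb_and -!ltNge|]; lra.
have -> : f b - f a = (f (g + kappa) - f (g - kappa)) +
   ((f (g - kappa) - f a) + (f b - f (g + kappa))) by lra.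
rewrite -I1 -I2 big_mkcond (bigD1_seq g gG uG)/= ag gb/=.
congr (_ + _).
rewrite [RHS](_ : _ = \sum_(x <- G) ((if a <= x <= g - kappa then f (x + kappa) - f (x - kappa) else 0)
   + (if g + kappa <= x <= b then f (x + kappa) - f (x - kappa) else 0))); last first.
  by rewrite [RHS]big_split/=; congr (_ + _); exact: big_mkcond.
rewrite big_mkcond/=; apply: eq_big_seq => x xG.
have [xg|gx|->] := ltgtP x g; last 2 first.
- have gx' := sepG _ _ gG xG gx.
  rewrite [a <= x <= g - kappa]andbC [_ <= g - kappa]leNgt (_ : g - kappa < x)/= ?add0r; last by lra.
  rewrite (_ : a <= x); last by lra.
  by rewrite (_ : g + kappa <= x)//; lra.
- rewrite [g <= g - kappa]leNgt (_ : g - kappa < g) ?andbF/=; last by lra.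
  by rewrite [g + _ <= g]leNgt (_ : g < g + kappa)/= ?addr0//; lra.
have gx' := sepG _ _ xG gG xg.
rewrite [g + kappa <= x]leNgt (_ : x < g + kappa)/= ?addr0; last by lra.
rewrite (_ : x <= b); last by lra.
by rewrite (_ : x <= g - kappa)//; lra.
Qed.
End finite_sets_of_reals.

(** * Rank functions and multiplicities *)

Section rank_functions.
Context {R : realType}.
Implicit Types (r : R -> R -> nat) (G : seq R).

(** The properties of the ranks [r s t] of the maps [V_s -> V_t], [s < t], from which
the diagram is built: box counts are nonnegative, and the module lives over
the levels [[lo, hi]]. *)
Record rank_function (lo hi : R) r : Prop := RankFunction {
  rank_submod : forall a b c d, a <= b -> b < c -> c <= d ->
    (r a c + r b d <= r b c + r a d)%N ;
  rank_low : forall s t, s < lo -> s < t -> r s t = 0%N ;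
  rank_high : forall s t, hi < t -> s < t -> r s t = 0%N }.

(** Monotonicity is the box inequality for a box with one side pushed out of
[[lo, hi]], where the ranks vanish. *)
Lemma rank_homol lo hi r s s' t : rank_function lo hi r ->
  s <= s' -> s' < t -> (r s t <= r s' t)%N.
Proof.
move=> h ss' st; have := rank_submod h ss' st (d := Num.max t hi + 1).
have tm : t < Num.max t hi + 1 by rewrite (le_lt_trans (y := Num.max t hi)) ?le_max ?lexx// ltrDl.
have hm : hi < Num.max t hi + 1 by rewrite (le_lt_trans (y := Num.max t hi)) ?le_max ?lexx ?orbT// ltrDl.
rewrite (ltW tm) !(rank_high h hm) ?addn0; [exact|lra|lra].
Qed.

Lemma rank_homor lo hi r s t t' : rank_function lo hi r ->
  s < t -> t <= t' -> (r s t' <= r s t)%N.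
Proof.
move=> h st tt'; have := rank_submod h (a := Num.min s lo - 1) _ st tt'.
have sm : Num.min s lo - 1 < s by rewrite (lt_le_trans (y := Num.min s lo)) ?ge_min ?lexx// ltrBlDr ltrDl.
have lm : Num.min s lo - 1 < lo by rewrite (lt_le_trans (y := Num.min s lo)) ?ge_min ?lexx ?orbT// ltrBlDr ltrDl.
rewrite (ltW sm) !(rank_low h lm) ?addn0 ?add0n; [exact|lra|lra].
Qed.

(** Reversing both axes exchanges births and deaths: statements on deaths follow from
those on births. *)
Lemma rank_function_opp lo hi r : rank_function lo hi r ->
  rank_function (- hi) (- lo) (fun s t => r (- t) (- s)).
Proof.
move=> h; split=> [a b c d ab bc cd|s t slo st|s t slo st].
- have := rank_submod h (a := - d) (b := - c) (c := - b) (d := - a).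
  by rewrite !lerN2 ltrN2 => /(_ cd bc ab); rewrite addnC (addnC (r _ _) (r _ (- b))) addnC.
- by apply: (rank_high h); rewrite ?ltrN2// ltrNr.
- by apply: (rank_low h); rewrite ?ltrN2// ltrNl.
Qed.

(** The levels [x i] are [e / 2] apart, hence between [s'] and [t] there is one of them
at distance at least [e / 2] from [t]. The bounded monotone function
[r ^~ (x i + e / 2)] has finitely many jumps, and the box inequality carries
its constancy over to every later level [t]. *)
Lemma grid_left lo hi r e : rank_function lo hi r -> 0 < e ->
  exists G, forall s s' t, s <= s' -> s' + e <= t -> avoids G s s' -> r s t = r s' t.
Proof.
move=> h e0; set x := fun i : nat => lo + i%:R * (e / 2).
have jump i : exists G, forall s s', s <= s' -> s' <= x i.+1 -> avoids G s s' ->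
    r s (x i.+1 + e / 2) = r s' (x i.+1 + e / 2).
  pose f s := r (Num.min s (x i.+1)) (x i.+1 + e / 2).
  have lt s : Num.min s (x i.+1) < x i.+1 + e / 2.
    by rewrite (le_lt_trans (y := x i.+1)) ?ge_min ?lexx ?orbT// ltrDl divr_gt0.
  have [|s|G Gf] := @finite_jumps _ f (r (x i.+1) (x i.+1 + e / 2)).
  - move=> s s' ss'; apply: (rank_homol h) => //; rewrite le_min !ge_min ss' lexx !orbT//.
  - by apply: (rank_homol h); rewrite ?ge_min ?lexx ?orbT// ltrDl divr_gt0.
  exists G => s s' ss' s'x av; have := Gf _ _ ss' av.
  by rewrite /f !min_l// (le_trans ss').
have [GG GGP] := choice jump.
have [n nhi] : exists n, hi < x n.
  exists (Num.truncn ((hi - lo) / (e / 2))).+1.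
  by rewrite /x -ltrBlDl -ltr_pdivrMr ?divr_gt0// truncnS_gt.
exists ([seq x i | i <- iota 0 n.+1] ++ flatten [seq GG i | i <- iota 0 n]).
move=> s s' t ss' s't; rewrite avoids_cat => -[av1 av2].
have st : s < t by lra.
have [s'lo|los'] := ltP s' lo.
  by rewrite !(rank_low h) ?(le_lt_trans ss')//; lra.
have [hit|thi] := ltP hi t.
  by rewrite !(rank_high h) ?(le_lt_trans ss')//; lra.
have los : lo < s.
  rewrite ltNge; apply/negP => slo; have : ~~ (s <= lo <= s').
    by apply: av1; apply/mapP; exists 0%N; rewrite ?mem_iota//= /x mul0r addr0.
  by rewrite slo los'.
have exi : exists i, s < x i.
  by exists n; rewrite (lt_trans _ nhi)//; lra.
case: (ex_minnP exi) => i si min.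
have iSn : (i <= n)%N by apply: min; rewrite (lt_trans _ nhi)//; lra.
case: i si min iSn => [|i] si min iSn.
  by move: si; rewrite /x mul0r addr0 ltNge (ltW los).
have xis : x i <= s by rewrite leNgt; apply/negP => /min; rewrite ltnn.
have s'x : s' <= x i.+1.
  rewrite leNgt; apply/negP => xs'; have : ~~ (s <= x i.+1 <= s').
    by apply: av1; apply/map_f; rewrite mem_iota.
  by rewrite !ltW.
have xS : x i.+1 = x i + e / 2.
  by rewrite /x -natr1; ring.
have E : r s (x i.+1 + e / 2) = r s' (x i.+1 + e / 2).
  apply: (GGP i) => // g gG; apply: av2; apply/flattenP; exists (GG i) => //.
  by apply/map_f; rewrite mem_iota.
have := rank_submod h ss' (c := x i.+1 + e / 2) (d := t).
rewrite E => /(_ ltac:(lra) ltac:(lra)); rewrite leq_add2l => le.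
by apply/eqP; rewrite eqn_leq le (rank_homol h) //; lra.
Qed.

(** Near the diagonal a rank function may jump infinitely often; at distance at least
[e] from the diagonal finitely many levels account for all the jumps. *)
Definition is_grid r e G :=
  uniq G /\
  (forall s s' t, s <= s' -> s' + e <= t -> avoids G s s' -> r s t = r s' t) /\
  (forall s t t', s + e <= t -> t <= t' -> avoids G t t' -> r s t = r s t').

Lemma grid_exists lo hi r e : rank_function lo hi r -> 0 < e ->
  exists G, is_grid r e G.
Proof.
move=> h e0; have [G1 G1P] := grid_left h e0.
have [G2 G2P] := grid_left (rank_function_opp h) e0.
have av G s s' : avoids (undup G) s s' -> avoids G s s'.
  by move=> a g gG; apply: a; rewrite mem_undup.
exists (undup (G1 ++ [seq - x | x <- G2])); split; first exact: undup_uniq.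
split=> [s s' t ss' s't /av|s t t' st tt' /av]; rewrite avoids_cat => -[a1 a2].
  exact: G1P.
have := G2P (- t') (- t) (- s); rewrite !opprK => -> //; [lra|lra|].
move=> g gG; have := a2 (- g); rewrite mem_map; last exact: oppr_inj.
by rewrite gG => /(_ isT); rewrite lerNl lerNr andbC.
Qed.

Definition box_rank r a b c d : R :=
  (r b c)%:R - (r a c)%:R - (r b d)%:R + (r a d)%:R.

Lemma box_rank_ge0 lo hi r a b c d : rank_function lo hi r ->
  a <= b -> b < c -> c <= d -> 0 <= box_rank r a b c d.
Proof.
move=> h ab bc cd; have := rank_submod h ab bc cd.
rewrite /box_rank -(ler_nat R) !natrD; lra.
Qed.

Lemma box_rank_mono lo hi r a b c d a' b' c' d' : rank_function lo hi r ->
  a' <= a -> a <= b -> b <= b' -> b' < c' -> c' <= c -> c <= d -> d <= d' ->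
  box_rank r a b c d <= box_rank r a' b' c' d'.
Proof.
move=> h ? ? ? ? ? ? ?.
have := @box_rank_ge0 _ _ _ a' a c' d' h; have := @box_rank_ge0 _ _ _ b b' c' d' h.
have := @box_rank_ge0 _ _ _ a b c' c h; have := @box_rank_ge0 _ _ _ a b d d' h.
rewrite /box_rank => /(_ ltac:(lra) ltac:(lra) ltac:(lra)).
move=> + /(_ ltac:(lra) ltac:(lra) ltac:(lra)).
move=> + + /(_ ltac:(lra) ltac:(lra) ltac:(lra)).
by move=> + + + /(_ ltac:(lra) ltac:(lra) ltac:(lra)); lra.
Qed.

Definition square_rank r (x : R * R) (k : R) :=
  box_rank r (x.1 - k) (x.1 + k) (x.2 - k) (x.2 + k).

(** The rank of all sufficiently small squares around [x], which is the number of
diagram points at [x]; there are none on or below the diagonal. *)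
Definition mult r (x : R * R) : nat := xget 0%N [set m | x.1 < x.2 /\
  exists2 k0, 0 < k0 & forall k, 0 < k -> k < k0 -> square_rank r x k = m%:R].

Definition isolates G (x : R * R) (k0 : R) := 0 < k0 /\
  forall y, y \in G -> (y != x.1 -> k0 <= `|y - x.1|) /\ (y != x.2 -> k0 <= `|y - x.2|).

Lemma isolates_exists G x : exists k0, isolates G x k0.
Proof.
have [k k0 kP] := separated_from G x.1; have [l l0 lP] := separated_from G x.2.
exists (Num.min k l); split; first by rewrite lt_min k0.
by move=> y yG; split=> yx; rewrite ge_min ?(kP y yG yx)// (lP y yG yx) orbT.
Qed.

Lemma grid_avoids G y k0 (s s' : R) : (forall z, z \in G -> z != y -> k0 <= `|z - y|) ->
  (y < s /\ s' < y + k0) \/ (y - k0 < s /\ s' < y) -> avoids G s s'.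
Proof.
move=> h H g gG; apply/negP => /andP[sg gs'].
have [gy|gy] := eqVneq g y; first by move: sg gs'; rewrite gy; case: H; lra.
have := h _ gG gy; case: H => H.
  by rewrite gtr0_norm; lra.
by rewrite ltr0_norm; lra.
Qed.

Lemma grid_eq r e G s s' t t' : is_grid r e G -> s <= s' -> t <= t' -> s' + e <= t ->
  avoids G s s' -> avoids G t t' ->
  [/\ r s t = r s' t', r s t = r s t', r s t = r s' t & r s' t = r s' t'].
Proof.
move=> [_ [h1 h2]] ss' tt' st av1 av2.
by split; rewrite ?(h1 s s')// ?(h2 _ t t')//; lra.
Qed.

Lemma square_rank_const r e G x k0 k k' : is_grid r e G -> isolates G x k0 ->
  0 < k -> k <= k' -> k' < k0 -> x.1 + k' + e <= x.2 - k' ->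
  square_rank r x k = square_rank r x k'.
Proof.
move=> g [k00 iso] kp kk' k'k0 xe.
have i1 z : z \in G -> z != x.1 -> k0 <= `|z - x.1| by move=> /iso[].
have i2 z : z \in G -> z != x.2 -> k0 <= `|z - x.2| by move=> /iso[].
have a1 : avoids G (x.1 - k') (x.1 - k) by apply: (grid_avoids i1); right; lra.
have a2 : avoids G (x.1 + k) (x.1 + k') by apply: (grid_avoids i1); left; lra.
have a3 : avoids G (x.2 - k') (x.2 - k) by apply: (grid_avoids i2); right; lra.
have a4 : avoids G (x.2 + k) (x.2 + k') by apply: (grid_avoids i2); left; lra.
rewrite /square_rank /box_rank.
have [_ e1 _ e1'] := grid_eq g (s := x.1 + k) (s' := x.1 + k') (t := x.2 - k')
  (t' := x.2 - k) ltac:(lra) ltac:(lra) ltac:(lra) a2 a3.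
have [_ _ e2 _] := grid_eq g (s := x.1 + k) (s' := x.1 + k') (t := x.2 - k')
  (t' := x.2 - k) ltac:(lra) ltac:(lra) ltac:(lra) a2 a3.
have [e3 _ _ _] := grid_eq g (s := x.1 - k') (s' := x.1 - k) (t := x.2 - k')
  (t' := x.2 - k) ltac:(lra) ltac:(lra) ltac:(lra) a1 a3.
have [e4 _ _ _] := grid_eq g (s := x.1 + k) (s' := x.1 + k') (t := x.2 + k)
  (t' := x.2 + k') ltac:(lra) ltac:(lra) ltac:(lra) a2 a4.
have [_ e5 _ _] := grid_eq g (s := x.1 - k') (s' := x.1 - k) (t := x.2 + k)
  (t' := x.2 + k') ltac:(lra) ltac:(lra) ltac:(lra) a1 a4.
have [_ _ e6 _] := grid_eq g (s := x.1 - k') (s' := x.1 - k) (t := x.2 + k)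
  (t' := x.2 + k') ltac:(lra) ltac:(lra) ltac:(lra) a1 a4.
by rewrite -e1 e2 e3 e4 -e5 e6.
Qed.

(** A single square computes the multiplicity, provided that the grid meets its
projections at most in the centre: the rank does not change while the square shrinks. *)
Lemma mult_spec r e G x k0 k lo hi : rank_function lo hi r ->
  is_grid r e G -> isolates G x k0 -> 0 < e ->
  0 < k -> k < k0 -> x.1 + k + e <= x.2 - k ->
  (mult r x)%:R = square_rank r x k.
Proof.
move=> h g iso e0 kp kk0 xe.
have [m mP] : exists m : nat, square_rank r x k = m%:R.
  have le := @rank_submod _ _ _ h (x.1 - k) (x.1 + k) (x.2 - k) (x.2 + k).
  exists (subn (addn (r (x.1 + k) (x.2 - k)) (r (x.1 - k) (x.2 + k)))
               (addn (r (x.1 - k) (x.2 - k)) (r (x.1 + k) (x.2 + k)))).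
  rewrite natrB ?natrD /square_rank /box_rank; first by lra.
  by apply: le; lra.
rewrite mP /mult; case: xgetP => [n -> [_ [k1 k10 k1P]]|/(_ m)[]].
  rewrite -mP -(k1P (Num.min k (k1 / 2))).
  - apply: (square_rank_const (G := G) (k0 := k0) (e := e)) => //.
      by rewrite lt_min kp divr_gt0.
    by rewrite ge_min lexx.
  - by rewrite lt_min kp divr_gt0.
  - by rewrite gt_min; apply/orP; right; lra.
split; first by lra.
exists k => // l l0 lk; rewrite -mP.
by apply: (square_rank_const (G := G) (k0 := k0) (e := e)) => //; lra.
Qed.

Lemma mult_diag r x : ~~ (x.1 < x.2) -> mult r x = 0%N.
Proof. by move=> /negP nx; rewrite /mult; case: xgetP => // n _ [] /nx. Qed.

End rank_functions.

(** * Multiplicities in boxes and quadrants *)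

Section support_sums.
Context {R : realType}.

Lemma eq_big_support (I : eqType) (E E' : seq I) (F : I -> R) :
  uniq E -> uniq E' -> (forall x, F x != 0 -> (x \in E) = (x \in E')) ->
  \sum_(x <- E) F x = \sum_(x <- E') F x.
Proof.
move=> uE uE' h.
have red (D : seq I) : \sum_(x <- D) F x = \sum_(x <- [seq x <- D | F x != 0]) F x.
  rewrite big_filter [RHS]big_mkcond/=; apply: eq_bigr => x _.
  by case: eqP.
rewrite (red E) (red E'); apply: perm_big; apply: uniq_perm; rewrite ?filter_uniq// => x.
by rewrite !mem_filter; case: (boolP (F x != 0)) => //= /h ->.
Qed.

End support_sums.

Section box_formula.
Context {R : realType}.
Implicit Types (r : R -> R -> nat) (G : seq R) (E : seq (R * R)).

Definition in_box (a b c d : R) (x : R * R) := (a <= x.1 <= b) && (c <= x.2 <= d).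

Definition grid_points G := [seq (g, h) | g <- G, h <- G].

Lemma grid_points_uniq G : uniq G -> uniq (grid_points G).
Proof. by move=> u; apply: allpairs_uniq => // -[? ?] [? ?]. Qed.

Lemma mem_grid_points G x : (x \in grid_points G) = (x.1 \in G) && (x.2 \in G).
Proof.
apply/allpairsP/andP => [[[a b] /= [aG bG ->]]//|[h1 h2]].
by exists x; split => //; case: (x).
Qed.

Variables (lo hi : R) (r : R -> R -> nat).
Hypothesis rk : rank_function lo hi r.

(** If a coordinate of [x] is not in the grid, then the two sides of a small square
in that direction carry the same ranks, which cancel. *)
Lemma mult_grid e G x : is_grid r e G -> 0 < e -> x.1 + e < x.2 -> mult r x != 0%N ->
  x \in grid_points G.
Proof.
move=> g e0 xe; have [k0 iso] := isolates_exists G x.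
have [k [kp kk0 xk]] : exists k, [/\ 0 < k, k < k0 & x.1 + k + e <= x.2 - k].
  have m0 : 0 < Num.min k0 (x.2 - x.1 - e) by rewrite lt_min iso.1/=; lra.
  have m1 : Num.min k0 (x.2 - x.1 - e) <= k0 by rewrite ge_min lexx.
  have m2 : Num.min k0 (x.2 - x.1 - e) <= x.2 - x.1 - e by rewrite ge_min lexx orbT.
  by exists (Num.min k0 (x.2 - x.1 - e) / 3); split; lra.
have := mult_spec rk g iso e0 kp kk0 xk.
rewrite mem_grid_points; case: (boolP (x.1 \in G)) => x1; last first.
  have a1 : avoids G (x.1 - k) (x.1 + k).
    move=> y yG; have yx : y != x.1 by apply: contra x1 => /eqP <-.
    have [+ _] := iso.2 _ yG; move=> /(_ yx) ky; apply/negP => xy.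
    by move: ky; rewrite leNgt (le_lt_trans (y := k))// ler_norml; lra.
  rewrite /square_rank /box_rank.
  rewrite (g.2.1 (x.1 - k) (x.1 + k) (x.2 - k))//; [|lra].
  rewrite (g.2.1 (x.1 - k) (x.1 + k) (x.2 + k))//; [|lra|lra].
  by rewrite subrr sub0r addNr => /eqP; rewrite pnatr_eq0 => /eqP->.
case: (boolP (x.2 \in G)) => x2 //.
have a2 : avoids G (x.2 - k) (x.2 + k).
  move=> y yG; have yx : y != x.2 by apply: contra x2 => /eqP <-.
  have [_] := iso.2 _ yG; move=> /(_ yx) ky; apply/negP => xy.
  by move: ky; rewrite leNgt (le_lt_trans (y := k))// ler_norml; lra.
rewrite /square_rank /box_rank.
rewrite (g.2.2 (x.1 - k) (x.2 - k) (x.2 + k))//; [|lra|lra].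
rewrite (g.2.2 (x.1 + k) (x.2 - k) (x.2 + k))//; [|lra].
rewrite (_ : _ + _ = 0); last by lra.
by move=> /eqP; rewrite pnatr_eq0 => /eqP->.
Qed.

(** The mixed second difference [box_rank] telescopes in each coordinate into the
mixed differences across the single grid points, which are multiplicities. *)
Lemma sum_mult_grid e G a b c d : is_grid r e G -> 0 < e ->
  a < b -> b + e <= c -> c < d ->
  a \notin G -> b \notin G -> c \notin G -> d \notin G ->
  \sum_(x <- grid_points G | in_box a b c d x) (mult r x)%:R = box_rank r a b c d.
Proof.
move=> g e0 ab bc cd aG bG cG dG.
have [k0 k00 sep] := separated [:: a, b, c, d & G].
set k := k0 / 3; have kp : 0 < k by rewrite divr_gt0.
have k3 : 3 * k = k0 by rewrite /k; lra.
have sepG x y : x \in G -> y \in G -> x < y -> x + 3 * k <= y.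
  by move=> xG yG; rewrite k3; apply: sep; rewrite !inE ?xG ?yG !orbT.
have uG := g.1.
have endpt u v : u \in [:: a; b; c; d] -> v \in [:: a; b; c; d] ->
    u \notin G -> v \notin G ->
    forall x, x \in G -> u <= x <= v -> u + k <= x <= v - k.
  move=> uI vI uG' vG' x xG /andP[ux xv].
  have ux' : u < x by rewrite lt_neqAle ux andbT; apply: contra uG' => /eqP->.
  have xv' : x < v by rewrite lt_neqAle xv andbT; apply: contra vG' => /eqP<-.
  have m u' : u' \in [:: a; b; c; d] -> u' \in [:: a, b, c, d & G].
    by rewrite -[X in _ -> _ \in X]/([:: a; b; c; d] ++ G) mem_cat => ->.
  have xM : x \in [:: a, b, c, d & G] by rewrite !inE xG !orbT.
  have := sep _ _ (m _ uI) xM ux'; have := sep _ _ xM (m _ vI) xv'; lra.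
have inner x : x \in G -> a <= x <= b ->
    \sum_(y <- G | c <= y <= d) (mult r (x, y))%:R =
    ((r (x + k) c)%:R - (r (x + k) d)%:R) - ((r (x - k) c)%:R - (r (x - k) d)%:R) :> R.
  move=> xG xab.
  have xk : a + k <= x <= b - k.
    by apply: endpt => //; rewrite !inE eqxx ?orbT.
  pose f (t : R) : R := (r (x - k) t)%:R - (r (x + k) t)%:R.
  have -> : ((r (x + k) c)%:R - (r (x + k) d)%:R) -
            ((r (x - k) c)%:R - (r (x - k) d)%:R) = f d - f c by rewrite /f; lra.
  rewrite -(sum_jumps (G := G) (kappa := k))//; last 3 first.
  - exact: ltW.
  - by apply: endpt; rewrite ?inE ?eqxx ?orbT.
  - move=> s s' cs ss' sd av; rewrite /f (g.2.2 (x - k) s s')//; last by lra.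
    by rewrite (g.2.2 (x + k) s s')//; lra.
  rewrite !(big_seq_cond (fun y => c <= y <= d)).
  apply: eq_bigr => y /andP[yG ycd].
  have yk : c + k <= y <= d - k.
    by apply: endpt => //; rewrite !inE eqxx ?orbT.
  rewrite (mult_spec (G := G) (k0 := 2 * k) (k := k) rk g)//=.
  - by rewrite /square_rank /box_rank /f/=; lra.
  - split; first by lra.
    move=> z zG/=; split=> zx; have := zx; rewrite neq_lt => /orP[lt|lt].
    + by have := sepG _ _ zG xG lt; rewrite ltr0_norm; lra.
    + by have := sepG _ _ xG zG lt; rewrite gtr0_norm; lra.
    + by have := sepG _ _ zG yG lt; rewrite ltr0_norm; lra.
    + by have := sepG _ _ yG zG lt; rewrite gtr0_norm; lra.
  - by lra.
  - by lra.
pose f (s : R) : R := (r s c)%:R - (r s d)%:R.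
have -> : box_rank r a b c d = f b - f a by rewrite /f /box_rank; lra.
rewrite -(sum_jumps (G := G) (kappa := k))//; last 3 first.
- exact: ltW.
- by apply: endpt; rewrite ?inE ?eqxx ?orbT.
- move=> s s' cs ss' sd av; rewrite /f (g.2.1 s s' c)//; last by lra.
  by rewrite (g.2.1 s s' d)//; lra.
rewrite big_mkcond big_allpairs/= [RHS]big_mkcond/=; apply: eq_big_seq => x xG.
case: ifP => xab; last by apply: big1 => y _; rewrite /in_box/= xab.
rewrite /f -inner// [RHS]big_mkcond/=; apply: eq_bigr => y _.
by rewrite /in_box/= xab.
Qed.

(** A finite list through which sums over the diagram can be computed, when the summand
vanishes at persistence at most [e]. It may contain points of multiplicity 0. *)
Definition covers e E := uniq E /\ forall x, x.1 + e < x.2 -> mult r x != 0%N -> x \in E.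

Lemma covers_exists e : 0 < e -> exists E, covers e E.
Proof.
move=> e0; have [G g] := grid_exists rk e0.
exists (grid_points G); split; first exact/grid_points_uniq/g.1.
by move=> x; exact: (mult_grid g).
Qed.

Lemma sum_mult_box e E : covers e E -> 0 < e -> exists G : seq R,
  forall a b c d, a < b -> b + e < c -> c < d ->
  a \notin G -> b \notin G -> c \notin G -> d \notin G ->
  \sum_(x <- E | in_box a b c d x) (mult r x)%:R = box_rank r a b c d.
Proof.
move=> [uE cov] e0; have [G g] := grid_exists rk e0.
exists G => a b c d ab bc cd aG bG cG dG.
rewrite -(sum_mult_grid g)//; last exact: ltW.
rewrite big_mkcond [RHS]big_mkcond/=; apply: eq_big_support => //.
  exact/grid_points_uniq/g.1.
move=> x; case: ifP; rewrite ?eqxx// pnatr_eq0 => /andP[? ?] mx.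
by rewrite cov ?(mult_grid g)//; lra.
Qed.

End box_formula.

Section masses.
Context {R : realType}.
Implicit Types (r : R -> R -> nat) (G : seq R) (E : seq (R * R)).

Lemma mult_range lo hi r x : rank_function lo hi r -> mult r x != 0%N ->
  lo <= x.1 /\ x.2 <= hi.
Proof.
move=> rk mx.
have x12 : x.1 < x.2 by apply/negPn; apply: contra mx => /mult_diag ->.
have [G g] := grid_exists rk (e := (x.2 - x.1) / 2) ltac:(lra).
have [k0 iso] := isolates_exists G x.
have H (u : R) : 0 < u -> exists k, [/\ 0 < k, k < k0, x.1 + k + (x.2 - x.1) / 2 <= x.2 - k & k < u].
  move=> u0; set v := Num.min (Num.min k0 u) (x.2 - x.1).
  have m0 : 0 < v by rewrite !lt_min iso.1 u0/=; lra.
  have m1 : v <= k0 by rewrite !ge_min lexx.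
  have m2 : v <= u by rewrite !ge_min lexx orbT.
  have m3 : v <= x.2 - x.1 by rewrite !ge_min lexx orbT.
  by exists (v / 5); split; lra.
split; rewrite leNgt; apply/negP => lt.
  have [k [kp kk0 xk ku]] := H (lo - x.1) ltac:(lra).
  have := mult_spec rk g iso ltac:(lra) kp kk0 xk.
  rewrite /square_rank /box_rank !(rank_low rk); try lra.
  by rewrite !subr0 addr0 => /eqP; rewrite pnatr_eq0 (negbTE mx).
have [k [kp kk0 xk ku]] := H (x.2 - hi) ltac:(lra).
have := mult_spec rk g iso ltac:(lra) kp kk0 xk.
rewrite /square_rank /box_rank !(rank_high rk); try lra.
by rewrite !subr0 addr0 => /eqP; rewrite pnatr_eq0 (negbTE mx).
Qed.

Variables (lo hi : R) (r : R -> R -> nat).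
Hypothesis rk : rank_function lo hi r.

(** Shrinking or enlarging the box slightly reaches generic positions; the two
sums differ by the boundary points only. *)
Lemma sum_mult_closed_box e E a b c d : covers r e E ->
  0 < e -> a < b -> b + e < c -> c < d ->
  (forall x, in_box a b c d x -> ~~ ((a < x.1 < b) && (c < x.2 < d)) -> mult r x = 0%N) ->
  \sum_(x <- E | in_box a b c d x) (mult r x)%:R = box_rank r a b c d.
Proof.
move=> cov e0 ab bc cd bd0; have [G GP] := sum_mult_box rk cov e0.
set D := G ++ map fst E ++ map snd E.
have [g g0 sep] := separated ([:: a; b; c; d] ++ D).
set k := Num.min g (Num.min (b - a) (Num.min (c - b - e) (d - c))) / 3.
have mp : 0 < Num.min g (Num.min (b - a) (Num.min (c - b - e) (d - c))).
  by rewrite !lt_min g0/=; apply/and3P; split; lra.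
have kp : 0 < k by rewrite divr_gt0.
have [kg kab kbc kcd] : [/\ 3 * k <= g, 3 * k <= b - a, 3 * k <= c - b - e & 3 * k <= d - c].
  have -> : 3 * k = Num.min g (Num.min (b - a) (Num.min (c - b - e) (d - c))) by rewrite /k; lra.
  by rewrite !ge_min !lexx !orbT.
clearbody k; clear mp.
have sep' u v : u \in [:: a; b; c; d] -> v \in D ->
    (u < v -> u + 3 * k <= v) /\ (v < u -> v + 3 * k <= u).
  move=> uI vI; split=> uv.
    by have := sep u v; rewrite !(mem_cat _ _ D) uI vI /= uv orbT => /(_ isT isT isT); lra.
  by have := sep v u; rewrite !(mem_cat _ _ D) uI vI /= uv orbT => /(_ isT isT isT); lra.
have notG u : u \in [:: a; b; c; d] -> u - k \notin G /\ u + k \notin G.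
  move=> uI; split; apply/negP => uG.
    have := sep' u (u - k) uI; rewrite /D mem_cat uG => /(_ isT)[_]; lra.
  have := sep' u (u + k) uI; rewrite /D mem_cat uG => /(_ isT)[]; lra.
have [aI bI cI dI] : [/\ a \in [:: a; b; c; d], b \in [:: a; b; c; d],
   c \in [:: a; b; c; d] & d \in [:: a; b; c; d]] by rewrite !inE !eqxx !orbT.
have [a1 a2] := notG a aI; have [b1 b2] := notG b bI.
have [c1 c2] := notG c cI; have [d1 d2] := notG d dI.
have outer := GP (a - k) (b + k) (c - k) (d + k) ltac:(lra) ltac:(lra) ltac:(lra) a1 b2 c1 d2.
have inner := GP (a + k) (b - k) (c + k) (d - k) ltac:(lra) ltac:(lra) ltac:(lra) a2 b1 c2 d1.
clear a1 a2 b1 b2 c1 c2 d1 d2 notG GP.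
have le1 : box_rank r a b c d <= box_rank r (a - k) (b + k) (c - k) (d + k).
  by clear outer inner; apply: (box_rank_mono rk); lra.
have le2 : box_rank r (a + k) (b - k) (c + k) (d - k) <= box_rank r a b c d.
  by clear outer inner le1; apply: (box_rank_mono rk); lra.
have E1 : \sum_(x <- E | in_box (a - k) (b + k) (c - k) (d + k) x) (mult r x)%:R =
    \sum_(x <- E | in_box a b c d x) (mult r x)%:R :> R.
  clear inner outer le1 le2.
  rewrite big_seq_cond [RHS]big_seq_cond; apply: eq_bigl => x.
  case: (boolP (x \in E)) => //= xE.
  have xm1 : x.1 \in D by rewrite /D !mem_cat map_f ?orbT.
  have xm2 : x.2 \in D by rewrite /D !mem_cat (map_f snd) ?orbT.
  have [_ s1] := sep' a x.1 aI xm1; have [s2 _] := sep' b x.1 bI xm1.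
  have [_ s3] := sep' c x.2 cI xm2; have [s4 _] := sep' d x.2 dI xm2.
  rewrite /in_box; apply/idP/idP => [/andP[/andP[h1 h2] /andP[h3 h4]]|]; last by lra.
  rewrite !leNgt -!negb_or; apply/negP => /orP[/orP[]|/orP[]] lt.
  - by move: (s1 lt); lra.
  - by move: (s2 lt); lra.
  - by move: (s3 lt); lra.
  - by move: (s4 lt); lra.
have E2 : \sum_(x <- E | in_box (a + k) (b - k) (c + k) (d - k) x) (mult r x)%:R =
    \sum_(x <- E | in_box a b c d x) (mult r x)%:R :> R.
  clear inner outer le1 le2 E1.
  rewrite big_mkcond [RHS]big_mkcond; apply: eq_big_seq => x xE.
  have xm1 : x.1 \in D by rewrite /D !mem_cat map_f ?orbT.
  have xm2 : x.2 \in D by rewrite /D !mem_cat (map_f snd) ?orbT.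
  have [s1 _] := sep' a x.1 aI xm1; have [_ s2] := sep' b x.1 bI xm1.
  have [s3 _] := sep' c x.2 cI xm2; have [_ s4] := sep' d x.2 dI xm2.
  case: (boolP (in_box a b c d x)) => inb; last first.
    by rewrite ifF//; apply/negbTE; apply: contra inb; rewrite /in_box; lra.
  case: (boolP ((a < x.1 < b) && (c < x.2 < d))) => strict; last first.
    by rewrite (bd0 x inb strict); case: ifP.
  rewrite ifT//; move/andP: strict => [/andP[/s1 ? /s2 ?] /andP[/s3 ? /s4 ?]].
  by rewrite /in_box; lra.
by move: outer inner; rewrite E1 E2 => o i; apply/le_anti; rewrite {1}i o le2 le1.
Qed.

(** A quadrant is a box whose outer sides lie beyond [[lo, hi]], where three of the
four ranks vanish. *)
Lemma quadrant_mass e E : covers r e E -> 0 < e -> exists G : seq R,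
  forall s t, s + e < t -> s \notin G -> t \notin G ->
  exists a d, [/\ a < lo, hi < d &
    \sum_(x <- E | in_box a s t d x) (mult r x)%:R = (r s t)%:R :> R].
Proof.
move=> cov e0; have [G GP] := sum_mult_box rk cov e0; exists G => s t st sG tG.
have [a aP aG] : exists2 a, Num.min lo s - 2 < a < Num.min lo s - 1 & a \notin G.
  by apply: avoid_point; lra.
have [d dP dG] : exists2 d, Num.max hi t + 1 < d < Num.max hi t + 2 & d \notin G.
  by apply: avoid_point; lra.
have [l1 l2] : Num.min lo s <= lo /\ Num.min lo s <= s by rewrite !ge_min !lexx orbT.
have [u1 u2] : hi <= Num.max hi t /\ t <= Num.max hi t by rewrite !le_max !lexx orbT.
exists a, d; split; [lra|lra|].
rewrite (GP a s t d ltac:(lra) st ltac:(lra) aG sG tG dG) /box_rank.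
rewrite !(rank_low rk (s := a)) ?(rank_high rk (s := s) (t := d)); try lra.
Qed.

Lemma quadrant_mass_le e E s t : covers r e E -> 0 < e -> s + e < t ->
  \sum_(x <- E | (x.1 < s) && (t < x.2)) (mult r x)%:R <= (r s t)%:R :> R.
Proof.
move=> cov e0 st; have [G GP] := quadrant_mass cov e0.
have [g g0 sep] := separated ([:: s; t] ++ map fst E ++ map snd E).
have [s' s'P s'G] : exists2 s', s - g < s' < s & s' \notin G by apply: avoid_point; lra.
have [t' t'P t'G] : exists2 t', t < t' < t + g & t' \notin G by apply: avoid_point; lra.
have [a [d [alo dhi E1]]] := GP s' t' ltac:(lra) s'G t'G.
have : (r s' t')%:R <= (r s t)%:R :> R.
  rewrite ler_nat; apply: leq_trans (rank_homor rk _ _) (rank_homol rk _ _); lra.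
apply: le_trans; rewrite -E1 big_mkcond [leRHS]big_mkcond/=.
rewrite big_seq [leRHS]big_seq; apply: ler_sum => x xE.
case: ifP => [/andP[x1 x2]|_]; last by case: ifP.
have [->|mx] := eqVneq (mult r x) 0%N; first by case: ifP.
have [lx xh] := mult_range rk mx.
have h1 := sep x.1 s; have h2 := sep t x.2.
move: h1 h2; rewrite !mem_cat !inE !eqxx !map_f ?orbT//= => /(_ isT isT x1) h1 /(_ isT isT x2) h2.
by rewrite ifT// /in_box; lra.
Qed.

Lemma quadrant_mass_ge e E s t eta : covers r e E -> 0 < e -> 0 < eta ->
  s + eta + e < t - eta ->
  (r s t)%:R <= \sum_(x <- E | (x.1 <= s + eta) && (t - eta <= x.2)) (mult r x)%:R :> R.
Proof.
move=> cov e0 eta0 st; have [G GP] := quadrant_mass cov e0.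
have [s' s'P s'G] : exists2 s', s < s' < s + eta & s' \notin G by apply: avoid_point; lra.
have [t' t'P t'G] : exists2 t', t - eta < t' < t & t' \notin G by apply: avoid_point; lra.
have [a [d [alo dhi E1]]] := GP s' t' ltac:(lra) s'G t'G.
have : (r s t)%:R <= (r s' t')%:R :> R.
  rewrite ler_nat; apply: leq_trans (rank_homol rk _ _) (rank_homor rk _ _); lra.
move=> /le_trans; apply; rewrite -E1 big_mkcond [leRHS]big_mkcond/=.
apply: ler_sum => x _; case: ifP => [/andP[x1 x2]|_]; last by case: ifP.
by rewrite ifT//; lra.
Qed.

End masses.

(** * Local stability of multiplicities *)

Section stability.
Context {R : realType}.
Implicit Types (r : R -> R -> nat) (G : seq R) (E : seq (R * R)).

Definition interleaved (delta : R) r r' := forall s t, s + delta < t - delta ->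
  (r' s t <= r (s + delta)%R (t - delta)%R)%N /\
  (r s t <= r' (s + delta)%R (t - delta)%R)%N.

(** Off the grid the interleaving inequalities confine [r' s t] between two equal
values of [r]. *)
Lemma interleaved_eq delta r r' e G s t : is_grid r e G -> 0 <= delta -> 0 < e ->
  interleaved delta r r' -> s + delta + e <= t - delta ->
  avoids G (s - delta) (s + delta) -> avoids G (t - delta) (t + delta) -> r' s t = r s t.
Proof.
move=> g d0 e0 I st a1 a2.
have [_ h1] := I (s - delta) (t + delta) ltac:(lra).
have [h2 _] := I s t ltac:(lra).
have a1l : avoids G (s - delta) s by apply: avoids_sub a1; lra.
have a1r : avoids G s (s + delta) by apply: avoids_sub a1; lra.
have a2l : avoids G (t - delta) t by apply: avoids_sub a2; lra.
have a2r : avoids G t (t + delta) by apply: avoids_sub a2; lra.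
have [e1 _ _ _] := grid_eq g (s := s - delta) (s' := s) (t := t) (t' := t + delta)
  ltac:(lra) ltac:(lra) ltac:(lra) a1l a2r.
have e2 : r (s - delta) (t + delta) = r s t.
  rewrite (g.2.1 (s - delta) s (t + delta))//; [|lra|lra].
  by rewrite (g.2.2 s t (t + delta))//; lra.
have e3 : r (s + delta) (t - delta) = r s t.
  rewrite -(g.2.1 s (s + delta) (t - delta))//; [|lra].
  by rewrite (g.2.2 s (t - delta) t)//; lra.
move: h1 h2; rewrite e2 e3 subrK addrK => h1 h2.
by apply/eqP; rewrite eqn_leq h1 h2.
Qed.

Section squares.
Variables (lo hi : R) (r : R -> R -> nat).
Hypothesis rk : rank_function lo hi r.
Variables (e : R) (G : seq R) (g0 : R).
Hypotheses (e0 : 0 < e) (g : is_grid r e G)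
  (sep : forall x y, x \in G -> y \in G -> x < y -> x + g0 <= y).

Lemma avoids_near (y s s' : R) : y \in G ->
  (y < s /\ s' < y + g0) \/ (y - g0 < s /\ s' < y) -> avoids G s s'.
Proof.
move=> yG; apply: grid_avoids => z zG zy; move: zy; rewrite neq_lt => /orP[lt|lt].
  by have := sep zG yG lt; rewrite ltr0_norm; lra.
by have := sep yG zG lt; rewrite gtr0_norm; lra.
Qed.

Lemma square_interleaved (delta : R) r' (x : R * R) k : 0 <= delta -> interleaved delta r r' ->
  x.1 \in G -> x.2 \in G -> delta < k -> k + delta < g0 ->
  x.1 + k + delta + e <= x.2 - k - delta ->
  square_rank r' x k = (mult r x)%:R.
Proof.
have e0' := e0.
move=> d0 I x1 x2 dk kg xe.
have a1 : avoids G (x.1 - k - delta) (x.1 - k + delta) by apply: (avoids_near x1); right; lra.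
have a2 : avoids G (x.1 + k - delta) (x.1 + k + delta) by apply: (avoids_near x1); left; lra.
have a3 : avoids G (x.2 - k - delta) (x.2 - k + delta) by apply: (avoids_near x2); right; lra.
have a4 : avoids G (x.2 + k - delta) (x.2 + k + delta) by apply: (avoids_near x2); left; lra.
rewrite (mult_spec (G := G) (k0 := g0) (k := k) rk g)//.
- rewrite /square_rank /box_rank.
  by rewrite !(interleaved_eq g d0 e0 I)//; lra.
- split; first by lra.
  move=> y yG; split=> yx; move: yx; rewrite neq_lt => /orP[lt|lt].
  + by have := sep yG x1 lt; rewrite ltr0_norm; lra.
  + by have := sep x1 yG lt; rewrite gtr0_norm; lra.
  + by have := sep yG x2 lt; rewrite ltr0_norm; lra.
  + by have := sep x2 yG lt; rewrite gtr0_norm; lra.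
- by lra.
- by lra.
- by lra.
Qed.

(** An interval around [y] whose end points stay off the grid after a perturbation by
[delta]. *)
Lemma safe_interval (y delta k : R) : 0 <= delta -> delta < k -> k < 2 * delta ->
    4 * delta < g0 ->
  (exists2 z, z \in G & `|y - z| <= k) \/
  exists u, [/\ 0 < u, u < delta, avoids G (y - u - delta) (y - u + delta),
     avoids G (y + u - delta) (y + u + delta) & avoids G (y - u) (y + u)].
Proof.
move=> d0 dk k2 gd.
case: (boolP (has (fun z => `|y - z| <= k) G)) => [/hasP[z zG zy]|/hasPn far].
  by left; exists z.
right; exists ((k - delta) / 2); split; try lra.
all: move=> z zG; have := far z zG; rewrite -ltNge => lt; apply/negP => zz.
all: by move: lt; rewrite ltNge ler_norml; lra.
Qed.

Lemma mult_le_box lo' hi' r' (y : R * R) (a b c d : R) : rank_function lo' hi' r' ->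
  y.1 < y.2 -> b < c -> a < y.1 < b -> c < y.2 < d -> (mult r' y)%:R <= box_rank r' a b c d.
Proof.
move=> rk' y12 bc ayb cyd.
have [G' g'] := grid_exists rk' (e := (y.2 - y.1) / 2) ltac:(lra).
have [k0 iso] := isolates_exists G' y.
set v := Num.min (Num.min k0 (y.2 - y.1)) (Num.min (Num.min (y.1 - a) (b - y.1)) (Num.min (y.2 - c) (d - y.2))).
have v0 : 0 < v by rewrite !lt_min iso.1/=; lra.
have : v <= v by []; rewrite {2}/v !le_min => /andP[/andP[v1 v2] /andP[/andP[v3 v4] /andP[v5 v6]]].
rewrite (mult_spec rk' g' iso (k := v / 5)); try lra.
by rewrite /square_rank; apply: (box_rank_mono rk'); lra.
Qed.

(** Otherwise [y] would lie in a box with sides off the grid and no [r]-rank, hence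
no [r']-rank. *)
Lemma mult_near_grid (delta k : R) lo' hi' r' (y : R * R) : rank_function lo' hi' r' ->
  0 <= delta -> delta < k -> k < 2 * delta -> 4 * delta < g0 ->
  interleaved delta r r' -> y.1 + e + 12 * delta < y.2 -> mult r' y != 0%N ->
  exists x, [/\ x.1 \in G, x.2 \in G, `|y.1 - x.1| <= k, `|y.2 - x.2| <= k & mult r x != 0%N].
Proof.
have e0' := e0.
move=> rk' d0 dk k2 gd I ye my.
have zero (a b c d : R) : b + e + 2 * delta <= c -> a < y.1 < b -> c < y.2 < d ->
  (avoids G (a - delta) (a + delta)) -> avoids G (b - delta) (b + delta) ->
  (avoids G (c - delta) (c + delta)) -> avoids G (d - delta) (d + delta) ->
  0 < box_rank r a b c d.
  move=> bc ayb cyd aa ab ac ad.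
  have : (mult r' y)%:R <= box_rank r' a b c d.
    have q1 : y.1 < y.2 by lra.
    have q2 : b < c by lra.
    exact: (mult_le_box rk').
  have -> : box_rank r' a b c d = box_rank r a b c d.
    by rewrite /box_rank !(interleaved_eq g d0 e0 I)//; lra.
  by apply: lt_le_trans; rewrite ltr0n lt0n.
have near z : z \in G -> [/\ avoids G (z - 2 * delta - delta) (z - 2 * delta + delta) &
    avoids G (z + 2 * delta - delta) (z + 2 * delta + delta)].
  by move=> zG; split; apply: (avoids_near zG); [right|left]; lra.
have [[z1 z1G z1y]|[u1 [u10 u1d a1 a1' a1'']]] := @safe_interval y.1 _ _ d0 dk k2 gd; last first.
  have [[z2 z2G z2y]|[u2 [u20 u2d a2 a2' _]]] := @safe_interval y.2 _ _ d0 dk k2 gd.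
    have [n1 n2] := near _ z2G; move: z2y; rewrite ler_norml => z2y.
    have := zero (y.1 - u1) (y.1 + u1) (z2 - 2 * delta) (z2 + 2 * delta) ltac:(lra) ltac:(lra) ltac:(lra) a1 a1' n1 n2.
    rewrite /box_rank !(g.2.1 (y.1 - u1) (y.1 + u1))//; lra.
  have := zero (y.1 - u1) (y.1 + u1) (y.2 - u2) (y.2 + u2) ltac:(lra) ltac:(lra) ltac:(lra) a1 a1' a2 a2'.
  rewrite /box_rank !(g.2.1 (y.1 - u1) (y.1 + u1))//; lra.
have [n1 n2] := near _ z1G; have := z1y; rewrite ler_norml => z1y'.
have [[z2 z2G z2y]|[u2 [u20 u2d a2 a2' a2'']]] := @safe_interval y.2 _ _ d0 dk k2 gd; last first.
  have := zero (z1 - 2 * delta) (z1 + 2 * delta) (y.2 - u2) (y.2 + u2) ltac:(lra) ltac:(lra) ltac:(lra) n1 n2 a2 a2'.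
  rewrite /box_rank (g.2.2 (z1 - 2 * delta) (y.2 - u2) (y.2 + u2))//; [|lra|lra].
  by rewrite (g.2.2 (z1 + 2 * delta) (y.2 - u2) (y.2 + u2))//; lra.
have [n3 n4] := near _ z2G; have := z2y; rewrite ler_norml => z2y'.
exists (z1, z2); split => //.
rewrite -lt0n -(@ltr0n R) -(@square_interleaved 0 r (z1, z2) (2 * delta))//=; try lra.
  by apply: (zero _ _ _ _ _ _ _ n1 n2 n3 n4); lra.
by move=> s t _; rewrite addr0 subr0.
Qed.

End squares.

Lemma avoid_points G (D : seq R) (a b : R) : a < b ->
  exists2 c, a < c < b & forall z, z \in D -> z + c \notin G /\ z - c \notin G.
Proof.
move=> ab; have [c acb cG] := @avoid_point _ ([seq y - z | y <- G, z <- D] ++ [seq z - y | y <- G, z <- D]) _ _ ab.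
exists c => // z zD; split; apply: contra cG => zG; rewrite mem_cat; apply/orP; [left|right].
  by apply/allpairsP; exists (z + c, z); split => //=; lra.
by apply/allpairsP; exists (z - c, z); split => //=; lra.
Qed.

(** After a perturbation of size [delta] that is small compared with the gaps
between the critical levels, each diagram point [x] of persistence more than
[e / 2] splits into exactly [mult r x] points in the square of radius
[2 * delta] around it, and all points of persistence more than [e] arise in
this way. *)
Lemma local_stability lo hi r e E : rank_function lo hi r -> 0 < e -> covers r (e / 2) E ->
  exists2 delta0, 0 < delta0 & forall lo' hi' r' delta E' (f : R * R -> R) omega,
    rank_function lo' hi' r' -> 0 < delta -> delta < delta0 -> interleaved delta r r' ->
    covers r' (e / 4) E' -> (forall x, x.2 <= x.1 + e -> f x = 0) ->
    (forall x y, x \in E -> mult r x != 0%N -> x.1 + e / 2 < x.2 ->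
      `|y.1 - x.1| <= 2 * delta -> `|y.2 - x.2| <= 2 * delta -> `|f y - f x| <= omega) ->
    `|\sum_(y <- E') (mult r' y)%:R * f y - \sum_(x <- E) (mult r x)%:R * f x| <=
      omega * \sum_(x <- E | x.1 + e / 2 < x.2) (mult r x)%:R.
Proof.
move=> rk e0 [uE cov]; have [G g] := grid_exists rk (e := e / 8) ltac:(lra).
have [g0 g00 sep] := separated G.
set delta0 := Num.min (g0 / 8) (e / 64).
have [d01 d02] : delta0 <= g0 / 8 /\ delta0 <= e / 64 by rewrite !ge_min !lexx orbT.
exists delta0; first by rewrite lt_min; lra.
move=> lo' hi' r' delta E' f omega rk' d0 dd0 I [uE' cov'] f0 fom.
have e8 : 0 < e / 8 by lra.
set X := [seq x <- E | (x.1 + e / 2 < x.2) && (mult r x != 0%N)].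
have XE x : x \in X -> [/\ x \in E, x.1 + e / 2 < x.2, mult r x != 0%N, x.1 \in G & x.2 \in G].
  rewrite mem_filter => /andP[/andP[xe mx] xEE]; split => //.
    by have := mult_grid rk g e8 _ mx; rewrite mem_grid_points => /(_ ltac:(lra))/andP[].
  by have := mult_grid rk g e8 _ mx; rewrite mem_grid_points => /(_ ltac:(lra))/andP[].
have [G' GP'] := sum_mult_box rk' (conj uE' cov') ltac:(lra).
have [k /andP[dk k2] kG'] := @avoid_points G' (map fst X ++ map snd X) delta (2 * delta) ltac:(lra).
pose sq (x : R * R) y := in_box (x.1 - k) (x.1 + k) (x.2 - k) (x.2 + k) y.
have square x : x \in X -> \sum_(y <- E' | sq x y) (mult r' y)%:R = (mult r x)%:R :> R.
  move=> xX; have [xEE xe mx x1G x2G] := XE x xX.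
  have [n1 n2] := kG' x.1 ltac:(by rewrite mem_cat map_f).
  have [n3 n4] := kG' x.2 ltac:(by rewrite mem_cat (map_f snd) ?orbT).
  rewrite GP'//; [|lra|lra|lra].
  by apply: (square_interleaved rk e8 g sep _ I) => //; lra.
have uX : uniq X by rewrite filter_uniq.
have sumX : \sum_(x <- E) (mult r x)%:R * f x = \sum_(x <- X) (mult r x)%:R * f x.
  apply: eq_big_support => // x; rewrite mulf_eq0 negb_or pnatr_eq0 => /andP[mx fx].
  rewrite mem_filter mx andbT (_ : _ < _)//.
  have : x.1 + e < x.2 by rewrite ltNge; apply: contra fx => /f0 ->.
  lra.
have sumE' : \sum_(y <- E') (mult r' y)%:R * f y =
   \sum_(x <- X) \sum_(y <- E' | sq x y) (mult r' y)%:R * f y.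
  under [RHS]eq_bigr do rewrite big_mkcond/=.
  rewrite exchange_big/=; apply: eq_big_seq => y yE'.
  rewrite -big_mkcond/=.
  have [m0|m0] := eqVneq ((mult r' y)%:R * f y) 0.
    by rewrite big1.
  move: (m0); rewrite mulf_eq0 negb_or pnatr_eq0 => /andP[my fy].
  have ye : y.1 + e < y.2 by rewrite ltNge; apply: contra fy => /f0 ->.
  have gd : 4 * delta < g0 by clear -dd0 d01 d0; lra.
  have ye' : y.1 + e / 8 + 12 * delta < y.2 by clear -dd0 d02 ye d0; lra.
  have [x [x1G x2G yx1 yx2 mx]] := mult_near_grid rk e8 g sep rk' (ltW d0) dk k2 gd I ye' my.
  have xX : x \in X.
    move: yx1 yx2; rewrite !ler_norml => yx1 yx2.
    have xe : x.1 + e / 2 < x.2 by clear -yx1 yx2 ye k2 dd0 d02; lra.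
    by rewrite mem_filter mx cov ?andbT.
  rewrite big_mkcond (bigD1_seq x)//= ifT; last first.
    by move: yx1 yx2; rewrite !ler_norml /sq /in_box; clear; lra.
  rewrite big1_seq ?addr0// => x' /andP[x'x x'X]; rewrite ifF//.
  apply/negbTE; apply: contra x'x => sqx'.
  have [_ _ _ x'1G x'2G] := XE _ x'X.
  have close u v w : u \in G -> v \in G -> `|w - u| <= k -> v - k <= w <= v + k -> v = u.
    rewrite ler_norml => uG vG wu vw; case: (ltgtP u v) => // lt.
      by have := sep _ _ uG vG lt; clear -wu vw dd0 d01 k2; lra.
    by have := sep _ _ vG uG lt; clear -wu vw dd0 d01 k2; lra.
  move/andP: sqx' => [s1 s2]; apply/eqP.
  by rewrite [LHS]surjective_pairing [RHS]surjective_pairing (close _ _ _ x1G x'1G yx1 s1) (close _ _ _ x2G x'2G yx2 s2).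
rewrite sumE' sumX -sumrB.
have -> : \sum_(x <- X) (\sum_(y <- E' | sq x y) (mult r' y)%:R * f y - (mult r x)%:R * f x) =
  \sum_(x <- X) \sum_(y <- E' | sq x y) (mult r' y)%:R * (f y - f x).
  apply: eq_big_seq => x xX; rewrite -square// mulr_suml -sumrB.
  by apply: eq_bigr => y _; rewrite mulrBr.
apply: le_trans (ler_norm_sum _ _ _) _.
have -> : \sum_(x <- E | x.1 + e / 2 < x.2) (mult r x)%:R = \sum_(x <- X) (mult r x)%:R :> R.
  rewrite big_filter big_mkcond [RHS]big_mkcond/=; apply: eq_bigr => x _.
  by case: (_ < _) => //=; case: eqP => // ->.
rewrite mulr_sumr big_seq [leRHS]big_seq; apply: ler_sum => x xX.
have [xEE xe mx x1G x2G] := XE x xX.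
apply: le_trans (ler_norm_sum _ _ _) _.
rewrite -square// mulr_sumr; apply: ler_sum => y /andP[y1 y2].
rewrite normrM normr_nat mulrC ler_wpM2r//; apply: fom => //; rewrite ler_norml; clear -y1 y2 k2; lra.
Qed.

End stability.

(** * Continuous functions on a compact interval *)

Section time_interval.
Context {R : realType} {T : R}.
Hypothesis T0 : 0 < T.
Implicit Types (x y : time T) (h : time T -> R).

Lemma time_itv x : 0 <= \val x <= T.
Proof. by case: x => x /= /set_mem/=; rewrite in_itv. Qed.

Lemma clip_subproof (r : R) : Num.max 0 (Num.min T r) \in (`[0, T]%classic : set R).
Proof.
apply/mem_set; rewrite /= in_itv/= le_max lexx/= ge_max ge_min lexx andbT.
exact: ltW.
Qed.

(** The retraction of the line onto the interval. *)
Definition clip (r : R) : time T := SigSub (clip_subproof r).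

Lemma val_clip (r : R) : 0 <= r <= T -> \val (clip r) = r.
Proof. by move=> /andP[r0 rT] /=; rewrite min_r// max_r. Qed.

Lemma clipK x : clip (\val x) = x.
Proof. by apply/val_inj; apply: val_clip; exact: time_itv. Qed.

Lemma continuous_clip : continuous clip.
Proof.
apply: continuous_comp_initial => r.
apply: (@continuous_max R R (cst 0) (fun r => Num.min T r)); first exact: cvg_cst.
by apply: (@continuous_min R R (cst T) id); [exact: cvg_cst | exact: cvg_id].
Qed.

Lemma time_continuousP h : continuous h <-> forall x e, 0 < e ->
  exists2 d, 0 < d & forall y, `|\val y - \val x| < d -> `|h y - h x| < e.
Proof.
split=> [ch x e e0|H x].
  have : {for \val x, continuous (h \o clip)}.
    apply: continuous_comp; [exact: continuous_clip|exact: ch].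
  move=> /cvgrPdist_lt /(_ e e0) [d /= d0 dP].
  exists d => // y yd; have := dP (\val y); rewrite /= !clipK => H.
  by rewrite distrC; apply: H; rewrite distrC.
have FF : Filter (nbhs x) by exact: nbhs_filter.
apply/(@cvgrPdist_lt _ _ _ (nbhs x) FF) => e e0; have [d d0 dP] := H x e e0.
have cv : (fun z : time T => \val z) @ x --> \val x by exact: initial_continuous.
move: cv => /(@cvgrPdist_lt _ _ _ (nbhs x) FF) /(_ d d0); apply: filterS => y yd.
by rewrite distrC; apply: dP; rewrite distrC.
Qed.

Lemma time_uniform_continuous h : continuous h -> forall e, 0 < e ->
  exists2 d, 0 < d & forall x y, `|\val y - \val x| < d -> `|h y - h x| < e.
Proof.
move=> /time_continuousP ch e e0.
have := @segment_compact R 0 T; rewrite compact_near_coveringP.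
move=> /(_ R (0 : R)^'+ (fun d r => forall x y, \val x = r ->
  `|\val y - \val x| < d -> `|h y - h x| < e)) /(_ _)[].
  move=> r; rewrite /= in_itv/= => r0T.
  have [d d0 dP] := ch (clip r) (e / 2) ltac:(by rewrite divr_gt0).
  exists (ball r (d / 2), [set d' | d' < d / 2]).
    split=> /=; first by apply: nbhsx_ballx; rewrite divr_gt0.
    by apply: nbhs_right_lt; rewrite divr_gt0.
  move=> [r' d'] [/= rr' d'd] x y /= xr' yd.
  have {}rr' : `|r - \val x| < d / 2 by rewrite [\val x]xr'.
  rewrite -(subrK (h (clip r)) (h y)) -addrA (splitr e).
  apply: le_lt_trans (ler_normD _ _) _; apply: ltrD.
    apply: dP; rewrite val_clip// (splitr d) -(subrK (\val x) (\val y)) -addrA.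
    apply: le_lt_trans (ler_normD _ _) _; apply: ltrD; first exact: lt_trans yd _.
    by rewrite distrC.
  rewrite distrC; apply: dP; rewrite val_clip// distrC.
  by apply: lt_trans rr' _; lra.
move=> d /= d0 dP; exists (d / 2); first by rewrite divr_gt0.
have b2 : ball (0 : R) d (d / 2) by rewrite -ball_normE /= sub0r normrN gtr0_norm; lra.
move=> x y; apply: (dP (d / 2) b2 _ (\val x)) => //; first by rewrite divr_gt0.
by rewrite /= in_itv/= time_itv.
Qed.

Lemma time_extrema h : continuous h ->
  exists a b, forall x, h a <= h x <= h b.
Proof.
move=> ch.
have cc : {within `[0, T], continuous (h \o clip)}.
  apply: continuous_subspaceT => r; apply: continuous_comp; last exact: ch.
  exact: continuous_clip.
have [a _ aP] := EVT_min (ltW T0) cc; have [b _ bP] := EVT_max (ltW T0) cc.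
exists (clip a), (clip b) => x; have xT : \val x \in `[0, T] by rewrite in_itv/= time_itv.
by have := aP _ xT; have := bP _ xT; rewrite /= clipK => -> ->.
Qed.

Lemma time_path (x y : time T) : exists sigma : R -> time T,
  [/\ {within `[0, 1]%classic : set R, continuous sigma}, sigma 0 = x, sigma 1 = y &
  forall r, 0 <= r <= 1 -> \val x <= \val (sigma r) <= \val y \/ \val y <= \val (sigma r) <= \val x].
Proof.
exists (fun r => clip ((1 - r) * \val x + r * \val y)); split.
- apply: continuous_subspaceT => r; apply: continuous_comp; last exact: continuous_clip.
  apply: cvgD; (apply: cvgM; last exact: cvg_cst); last exact: cvg_id.
  by apply: cvgB; [exact: cvg_cst|exact: cvg_id].
- by rewrite subr0 mul1r mul0r addr0 clipK.
- by rewrite subrr mul1r mul0r add0r clipK.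
- move=> r /andP[r0 r1]; have := time_itv x; have := time_itv y => yT xT.
  have := le_total (\val x) (\val y) => /orP[] xy; [left|right]; rewrite val_clip; nra.
Qed.

Lemma time_ivt (sigma : R -> time T) (z : time T) :
  {within `[0, 1]%classic : set R, continuous sigma} ->
  (\val (sigma 0) < \val z < \val (sigma 1)) || (\val (sigma 1) < \val z < \val (sigma 0)) ->
  exists2 r, 0 <= r <= 1 & sigma r = z.
Proof.
move=> cs btw.
have cv : {within `[0, 1]%classic, continuous (fun r => \val (sigma r))}.
  have cv : continuous (fun z : time T => \val z) by exact: initial_continuous.
  by move=> r; apply: continuous_comp; [exact: cs|exact: cv].
have [|r] := IVT (v := \val z) ler01 cv.
  by rewrite ge_min le_max; lra.
by rewrite in_itv/= => r01 /val_inj rz; exists r.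
Qed.

End time_interval.

(** * Components of sublevel sets *)

Section component_rank.
Context {R : realType} {T : R}.
Implicit Types (x y z : time T) (h : time T -> R) (s t : R) (u : seq (time T)).

Definition between x y z :=
  (\val x < \val z < \val y) || (\val y < \val z < \val x).

(** In an interval, two points of a sublevel set lie in different components exactly
when the function exceeds the level somewhere between them. *)
Definition apart h t x y := `[< exists2 z, between x y z & t < h z >].

Lemma apart_sym h t x y : apart h t x y = apart h t y x.
Proof. by apply/asboolP/asboolP => -[z b tz]; exists z => //; rewrite /between orbC. Qed.

Lemma apart_irr h t x : apart h t x x = false.
Proof. by apply/asboolP => -[z]; rewrite /between => b; exfalso; lra. Qed.

Lemma apart_trans h t x y z : h y <= t -> apart h t x z ->
  apart h t x y || apart h t y z.
Proof.
move=> yt /asboolP[w xwz tw].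
have wy : \val w <> \val y by move=> /val_inj E; move: tw; rewrite E ltNge yt.
have : between x y w \/ between y z w.
  move: xwz; rewrite /between => /orP[] xwz.
    case: (ltgtP (\val w) (\val y)) => // cmp; [left|right]; lra.
  case: (ltgtP (\val w) (\val y)) => // cmp; [right|left]; lra.
by move=> [b|b]; apply/orP; [left|right]; apply/asboolP; exists w.
Qed.

Lemma apart_mono h t t' x y : t <= t' -> apart h t' x y -> apart h t x y.
Proof.
by move=> tt' /asboolP[z b tz]; apply/asboolP; exists z => //; exact: le_lt_trans tz.
Qed.

(** Points of the sublevel set at [s] in different components of the sublevel set at
[t]. The last clause encodes that the persistence module vanishes from the
maximum of [h] on. *)
Definition independent h s t u :=
  [/\ pairwise (apart h t) u, all (fun x => h x <= s) u &
      u != [::] -> exists z, t < h z].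

(** The largest number of independent points, which is the rank of
[H_0(X_s) -> H_0(X_t)]; the value 0 stands for the absence of a maximum. *)
Definition comp_rank h s t : nat := xget 0%N [set n |
  (exists2 u, independent h s t u & size u = n) /\
  forall u, independent h s t u -> (size u <= n)%N].

Definition bounded_rank h s t (N : nat) :=
  forall u, independent h s t u -> (size u <= N)%N.

Lemma independent_nil h s t : independent h s t [::].
Proof. by split. Qed.

Lemma comp_rankP h s t N : bounded_rank h s t N ->
  (exists2 u, independent h s t u & size u = comp_rank h s t) /\
  bounded_rank h s t (comp_rank h s t).
Proof.
move=> bN; pose P n := `[< exists2 u, independent h s t u & size u = n >].
have exP : exists n, P n by exists 0%N; apply/asboolP; exists [::] => //; exact: independent_nil.
have bP n : P n -> (n <= N)%N by move=> /asboolP[u /bN + <-].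
have [m /asboolP Pm mP] := ex_maxnP exP bP.
rewrite /comp_rank; case: xgetP => [n -> []//|/(_ m)[]]; split => // u iu.
by apply: mP; apply/asboolP; exists u.
Qed.

(** The potentials of independent points have distinct integer parts, all of them at
most [B]. *)
Lemma potential_bound h s t (Psi : time T -> R) (B : R) :
  (forall x, 0 <= Psi x <= B) ->
  (forall x y z, \val x < \val z -> \val z < \val y -> h x <= s -> t < h z ->
     Psi x + 1 <= Psi y) ->
  bounded_rank h s t (Num.truncn B).+1.
Proof.
move=> PsiB incr u [pu su _].
set f := fun x => Num.truncn (Psi x).
have B0 x : 0 <= Psi x by have /andP[] := PsiB x.
have inj x y : x \in u -> y \in u -> apart h t x y -> f x <> f y.
  move=> xu yu /asboolP[z b tz] fxy.
  have main x' y' : x' \in u -> \val x' < \val z -> \val z < \val y' -> f x' = f y' -> False.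
    move=> x'u xz zy fe; have := incr x' y' z xz zy (allP su _ x'u) tz.
    apply/negP; rewrite -ltNge.
    have /andP[f1 _] := truncn_itv (B0 x'); have /andP[_ f2] := truncn_itv (B0 y').
    by apply: lt_le_trans f2 _; rewrite -/(f y') -fe -natr1 lerD2r.
  by move: b => /orP[]/andP[b1 b2]; [apply: (main x y)|apply: (main y x)].
have uu : uniq (map f u).
  rewrite uniq_pairwise pairwise_map; apply: (@sub_in_pairwise _ (fun x => x \in u) (apart h t)) pu.
    by move=> x y xu yu a; apply/eqP; apply: inj.
  by apply/allP.
have : {subset map f u <= iota 0 (Num.truncn B).+1}.
  move=> k /mapP[x xu ->]; rewrite mem_iota/= add0n ltnS.
  have /andP[Px PB] := PsiB x; rewrite /f truncn_le_nat.
  by apply: le_lt_trans PB _; exact: truncnS_gt.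
by move=> /(uniq_leq_size uu); rewrite size_map size_iota.
Qed.

(** Given optimal families [v] for [(a, c)] and [w] for [(b, d)], the points of [w]
whose component at level [d] meets the sublevel set at [a] can be moved
into that set, which gives a family for [(a, d)]; the other points of [w]
form together with [v] a family for [(b, c)]. *)
Lemma comp_rank_submod h (a b c d : R) : (forall s t, s < t -> exists N, bounded_rank h s t N) ->
  a <= b -> b < c -> c <= d ->
  (comp_rank h a c + comp_rank h b d <= comp_rank h b c + comp_rank h a d)%N.
Proof.
move=> bd ab bc cd.
have P s t : s < t -> (exists2 u, independent h s t u & size u = comp_rank h s t) /\
    bounded_rank h s t (comp_rank h s t).
  by move=> /bd[N /comp_rankP].
have [[v [pv sv nv] vE] _] := P a c (le_lt_trans ab bc).
have [[w [pw sw nw] wE] _] := P b d (lt_le_trans bc cd).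
have [_ bbc] := P b c bc.
have [_ bad] := P a d (le_lt_trans ab (lt_le_trans bc cd)).
(* The points whose component at level [d] was born before [a]. *)
pose near x := `[< exists2 y, h y <= a & ~~ apart h d x y >].
set w1 := [seq x <- w | predC near x]; set w2 := [seq x <- w | near x].
have ww : (size w2 + size w1 = size w)%N by rewrite !size_filter count_predC.
have hw x : x \in w -> h x <= d.
  by move=> xw; rewrite (le_trans (allP sw _ xw))// ltW// (lt_le_trans bc).
have le1 : (size v + size w1 <= comp_rank h b c)%N.
  rewrite -size_cat; apply: bbc; split.
  - rewrite pairwise_cat pv /=; apply/andP; split; last first.
      apply: pairwise_filter; apply: sub_pairwise pw => x y; exact: apart_mono.
    apply/allrelP => x y xv; rewrite mem_filter/= => /andP[/asboolPn ny yw].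
    apply: (apart_mono cd); rewrite apart_sym; apply/negPn/negP => nxy.
    by apply: ny; exists x => //; exact: (allP sv).
  - rewrite all_cat; apply/andP; split.
      by apply: sub_all sv => x hx; exact: le_trans ab.
    by apply/allP => x; rewrite mem_filter => /andP[_ /(allP sw)].
  - case: (v =P [::]) => [->/= w10|/eqP/nv//].
    have : w != [::] by apply: contra w10; rewrite /w1 => /eqP ->.
    by move=> /nw [z dz]; exists z; exact: le_lt_trans dz.
have le2 : (size w2 <= comp_rank h a d)%N.
  have [f fP] : exists f : time T -> time T, forall x, x \in w2 -> h (f x) <= a /\ ~~ apart h d x (f x).
    suff /choice[f fP] : forall x, exists y, x \in w2 -> h y <= a /\ ~~ apart h d x y.
      by exists f.
    move=> x.
    have [|xw] := boolP (x \in w2); last by exists x.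
    by rewrite mem_filter => /andP[/asboolP[y ya yx] _]; exists y.
  rewrite -(size_map f); apply: bad; split.
  - rewrite pairwise_map; apply: (@sub_in_pairwise _ (fun x => x \in w2) (apart h d)).
    + move=> x y xw yw /=; have [fxa fx] := fP x xw; have [fya fy] := fP y yw.
      have da z : h z <= a -> h z <= d by move=> /le_trans; apply; rewrite (le_trans ab)// (le_trans (ltW bc)).
      move=> xy; have := apart_trans (da _ fxa) xy; rewrite (negbTE fx)/= apart_sym.
      move=> /(apart_trans (da _ fya)); rewrite (negbTE fy)/= apart_sym.
      by rewrite apart_sym.
    + by apply/allP.
    + exact: pairwise_filter.
  - by rewrite all_map; apply/allP => x /fP[].
  - move=> w20; apply: nw; apply: contra w20; rewrite /w2 => /eqP ->//.
by rewrite -vE -wE -ww addnCA addnC leq_add.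
Qed.

Definition always_bounded h := forall s t, s < t -> exists N, bounded_rank h s t N.

Lemma comp_rank_spec h s t : always_bounded h -> s < t ->
  (exists2 u, independent h s t u & size u = comp_rank h s t) /\
    bounded_rank h s t (comp_rank h s t).
Proof. by move=> bd /bd[N /comp_rankP]. Qed.

Lemma comp_rank_rank_function h lo hi : always_bounded h ->
  (forall x, lo <= h x <= hi) -> rank_function lo hi (comp_rank h).
Proof.
move=> bd hb; split=> [a b c d|s t slo st|s t hit st]; first exact: comp_rank_submod.
- have [[u [_ su _] <-] _] := comp_rank_spec bd st.
  case: u su => //= x u /andP[hx _].
  by have := le_lt_trans hx slo; rewrite ltNge; have /andP[->] := hb x.
- have [[u [_ _ nu] <-] _] := comp_rank_spec bd st.
  case: (u =P [::]) => [->//|/eqP/nu[z tz]].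
  by have := lt_trans hit tz; rewrite ltNge; have /andP[_ ->] := hb z.
Qed.

Lemma comp_rank_le h h' delta s t : always_bounded h -> always_bounded h' ->
  0 <= delta -> (forall x, `|h x - h' x| <= delta) -> s + delta < t - delta ->
  (comp_rank h s t <= comp_rank h' (s + delta)%R (t - delta)%R)%N.
Proof.
move=> bd bd' d0 hh' st; have st' : s < t by lra.
have [[u [pu su nu] <-] _] := comp_rank_spec bd st'.
have [_ bu] := comp_rank_spec bd' st.
have lt z : t < h z -> t - delta < h' z by have := hh' z; rewrite ler_norml; lra.
apply: bu; split.
- apply: sub_pairwise pu => x y /asboolP[z b tz]; apply/asboolP; exists z => //.
  exact: lt.
- by apply: sub_all su => x; have := hh' x; rewrite ler_norml; lra.
- by move=> /nu[z tz]; exists z; exact: lt.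
Qed.

Lemma comp_rank_interleaved h h' delta : always_bounded h -> always_bounded h' ->
  0 <= delta -> (forall x, `|h x - h' x| <= delta) ->
  interleaved delta (comp_rank h) (comp_rank h').
Proof.
move=> bd bd' d0 hh' s t st; split; apply: comp_rank_le => // x.
by rewrite distrC.
Qed.

(** Sublevel sets of a function and of its composite with an increasing bijection
have the same components. *)
Lemma comp_rank_reparam h h' (tau sigma : time T -> time T) : cancel tau sigma -> cancel sigma tau ->
  (forall x y, \val x < \val y -> \val (tau x) < \val (tau y)) ->
  (forall x, h' x = h (tau x)) -> comp_rank h' = comp_rank h.
Proof.
move=> tK sK tmono hE.
have smono x y : \val x < \val y -> \val (sigma x) < \val (sigma y).
  move=> xy; case: (ltgtP (\val (sigma x)) (\val (sigma y))) => //.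
    by move=> /tmono; rewrite !sK ltNge (ltW xy).
  by move=> /val_inj /(congr1 tau); rewrite !sK => E; move: xy; rewrite E ltxx.
(* Stated for both directions of the time change. *)
have main (g g' : time T -> R) (f f' : time T -> time T) : cancel f f' ->
    (forall x y, \val x < \val y -> \val (f x) < \val (f y)) ->
    (forall x, g' x = g (f x)) ->
    forall s t u, independent g' s t u -> independent g s t (map f u).
  move=> fK fm gE s t u [pu su nu]; split.
  - rewrite pairwise_map; apply: sub_pairwise pu => x y /asboolP[z b tz].
    apply/asboolP; exists (f z); last by rewrite -gE.
    by move: b => /orP[]/andP[b1 b2]; apply/orP; [left|right]; rewrite !fm.
  - by rewrite all_map; apply: sub_all su => x /=; rewrite gE.
  - case: u nu pu su => // x u nu _ _ _; have [z tz] := nu isT.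
    by exists (f z); rewrite -gE.
have hE' x : h x = h' (sigma x) by rewrite hE sK.
have fwd := main h h' tau sigma tK tmono hE.
have bwd := main h' h sigma tau sK smono hE'.
apply/funext => s; apply/funext => t; rewrite /comp_rank; congr (xget _ _).
apply/seteqP; split=> n /= [[u iu un] bn]; split.
- by exists (map tau u); [exact: fwd|rewrite size_map].
- by move=> v /bwd/bn; rewrite size_map.
- by exists (map sigma u); [exact: bwd|rewrite size_map].
- by move=> v /fwd/bn; rewrite size_map.
Qed.

(** By uniform continuity, independent points are a minimal distance apart. *)
Lemma uniformly_bounded_rank (T0 : 0 < T) h e : continuous h -> 0 < e ->
  exists N, forall s t, s + e <= t -> bounded_rank h s t N.
Proof.
move=> ch e0; have [d d0 dP] := time_uniform_continuous T0 ch e0.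
exists (Num.truncn (T / d)).+1 => s t st; apply: (potential_bound (Psi := fun x => \val x / d)).
  move=> x; have /andP[x0 xT] := time_itv x.
  by rewrite divr_ge0 ?(ltW d0)//= ler_pdivrMr// divfK// gt_eqF.
move=> x y z xz zy hx hz.
rewrite ler_pdivlMr// mulrDl mul1r divfK ?gt_eqF//.
have : d <= `|\val z - \val x|.
  rewrite leNgt; apply/negP => /dP.
  by rewrite ltNge; apply/negP/negPn; apply: le_trans (ler_norm _); lra.
by rewrite gtr0_norm; lra.
Qed.

Lemma continuous_bounded_rank (T0 : 0 < T) h : continuous h -> always_bounded h.
Proof.
move=> ch s t st; have [|N NP] := uniformly_bounded_rank T0 ch (e := t - s); first by lra.
by exists N; apply: NP; lra.
Qed.
End component_rank.

(** * Homology in degree zero *)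

Section weights.
Context {F : fieldType} {X : choiceType}.
Implicit Types (D : {freeg X / F}) (chi : X -> F).

(** The linear extension of [chi] to chains. *)
Definition weight_of chi D : F := \sum_(x <- dom D) coeff x D * chi x.

Lemma weight_of_widen chi D s : uniq s -> {subset dom D <= s} ->
  weight_of chi D = \sum_(x <- s) coeff x D * chi x.
Proof.
move=> us ds; rewrite /weight_of.
rewrite [RHS](bigID (mem (dom D)))/= [X in _ + X]big1 ?addr0; last first.
  by move=> x xD; rewrite coeff_outdom ?mul0r.
rewrite -[RHS]big_filter; apply: perm_big; apply: uniq_perm.
- exact: uniq_dom.
- exact: filter_uniq.
- by move=> x; rewrite mem_filter; case: (boolP (x \in dom D)) => //= /ds ->.
Qed.

Lemma weight_ofD chi D D' : weight_of chi (D + D') = weight_of chi D + weight_of chi D'.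
Proof.
set s := undup (dom D ++ dom D').
have us : uniq s by exact: undup_uniq.
rewrite !(@weight_of_widen _ _ s)// ?big_split/=.
- by rewrite -big_split/=; apply: eq_bigr => x _; rewrite coeffD mulrDl.
- by move=> x xD; rewrite mem_undup mem_cat xD orbT.
- by move=> x xD; rewrite mem_undup mem_cat xD.
- by move=> x /domD_subset xD; rewrite mem_undup.
Qed.

Lemma weight_ofZ chi a D : weight_of chi (a *: D) = a * weight_of chi D.
Proof.
rewrite (@weight_of_widen _ _ (dom D)) ?uniq_dom//; last exact: domZ_subset.
by rewrite mulr_sumr; apply: eq_bigr => x _; rewrite coeffZ mulrA.
Qed.

Lemma weight_of0 chi : weight_of chi 0 = 0.
Proof. by rewrite /weight_of dom0 big_nil. Qed.

Lemma weight_of_sum chi n (a : 'I_n -> F) (u : 'I_n -> {freeg X / F}) :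
  weight_of chi (\sum_(i < n) a i *: u i) = \sum_(i < n) a i * weight_of chi (u i).
Proof.
elim/big_rec2: _ => [|i x y _ <-]; first exact: weight_of0.
by rewrite weight_ofD weight_ofZ.
Qed.

Lemma weight_ofU chi x : weight_of chi << x >> = chi x.
Proof. by rewrite /weight_of domU1 big_seq1 coeffU eqxx !mul1r. Qed.

Lemma weight_ofB chi D D' : weight_of chi (D - D') = weight_of chi D - weight_of chi D'.
Proof. by rewrite weight_ofD -scaleN1r weight_ofZ mulN1r. Qed.

Lemma chain_decomp D : D = \sum_(x <- dom D) coeff x D *: << x >>.
Proof.
rewrite -{1}[D]freeg_sumE; apply: eq_bigr => x _.
by apply/eqP/freeg_eqP => y; rewrite coeffZ !coeffU mul1r.
Qed.

End weights.

Section homology_rank.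
Context {R : realType} (F : fieldType) {T : R}.
Hypothesis T0 : 0 < T.
Implicit Types (x y z : time T) (h : time T -> R) (s t : R).

Lemma simplex1_not_apart h t (sigma : R -> time T) :
  simplex1 (R := R) (sublevel h t) sigma -> ~~ apart h t (sigma 0) (sigma 1).
Proof.
move=> [cs im]; apply/asboolPn => -[z b tz].
have [r r01 rz] := time_ivt cs b.
have : sublevel h t (sigma r) by apply: im; exists r => //=; rewrite in_itv.
by rewrite rz /sublevel/= leNgt tz.
Qed.

Lemma not_apart_simplex1 h t x y : h x <= t -> h y <= t -> ~~ apart h t x y ->
  exists2 sigma, simplex1 (R := R) (sublevel h t) sigma & boundary1 (R := R) F sigma = << y >> - << x >>.
Proof.
move=> hx hy /asboolPn nap; have [sigma [cs s0 s1 btw]] := time_path T0 x y.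
exists sigma; last by rewrite /boundary1 s0 s1.
split=> // _ [r /= r01 <-]; rewrite /sublevel/= leNgt; apply/negP => tz.
move: r01; rewrite in_itv/= => /btw b; apply: nap; exists (sigma r) => //.
have nx : \val (sigma r) <> \val x by move=> /val_inj E; move: tz; rewrite E ltNge hx.
have ny : \val (sigma r) <> \val y by move=> /val_inj E; move: tz; rewrite E ltNge hy.
move/eqP: nx => nx; move/eqP: ny => ny.
rewrite /between !lt_neqAle (eq_sym (\val x)) (eq_sym (\val y)) nx ny/=.
by case: b => ->; rewrite ?orbT.
Qed.

(** A function that is constant on the components annihilates the boundaries. *)
Lemma weight_of_boundary h t chi D :
  (forall x y, h x <= t -> h y <= t -> ~~ apart h t x y -> chi x = chi y) ->
  boundary0 (R := R) (F := F) (sublevel h t) D -> weight_of chi D = 0.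
Proof.
move=> inv [n [a [sigma [sx ->]]]]; rewrite weight_of_sum big1// => i _.
rewrite weight_ofB !weight_ofU (inv (sigma i 1) (sigma i 0)) ?subrr ?mulr0//.
- by apply: (sx i).2; exists 1 => //=; rewrite in_itv/= ler01 lexx.
- by apply: (sx i).2; exists 0 => //=; rewrite in_itv/= ler01 lexx.
- by rewrite apart_sym; exact: simplex1_not_apart.
Qed.

(** The indicator of the component of the point [i] extracts the coefficient [a i]. *)
Lemma independent_H0_free h s t u : s < t -> independent h s t u ->
  H0_free (R := R) (F := F) (sublevel h s) (sublevel h t) (fun i : 'I_(size u) => << tnth (in_tuple u) i >>).
Proof.
move=> st [pu su _]; have us i : h (tnth (in_tuple u) i) <= s.
  by apply: (allP su); exact: mem_tnth.
split=> [i|a bd i].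
  by move=> x /=; rewrite domU1 inE => /eqP ->; exact: us.
pose chi x : F := (~~ apart h t x (tnth (in_tuple u) i))%:R.
have inv x y : h x <= t -> h y <= t -> ~~ apart h t x y -> chi x = chi y.
  move=> hx hy nxy; congr (_ (~~ _))%:R; apply/idP/idP => [/(apart_trans hy)|].
    by rewrite (negbTE nxy).
  by move=> /(apart_trans hx); rewrite apart_sym (negbTE nxy).
have := weight_of_boundary inv bd; rewrite weight_of_sum (bigD1 i)//= weight_ofU.
rewrite {1}/chi apart_irr mulr1 big1 ?addr0// => j ji.
rewrite weight_ofU /chi; have [x0 _] : exists x0 : time T, True by exists (tnth (in_tuple u) i).
have -> : apart h t (tnth (in_tuple u) j) (tnth (in_tuple u) i).
  have /(pairwiseP x0) P := pu.
  rewrite !(tnth_nth x0)/=; move: ji; rewrite neq_ltn => /orP[ji|ij].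
    by apply: P => //; rewrite inE ltn_ord.
  by rewrite apart_sym; apply: P => //; rewrite inE ltn_ord.
by rewrite mulr0.
Qed.

(** More than [N] chains have a nontrivial combination of total weight 0 on each of the
[N] components that meet the sublevel set at [s]. Such a combination is a
boundary: each of its points is joined by a path with the chosen point of
its component, and the coefficients at the chosen points cancel. *)
Lemma H0_free_le h s t N n (v : 'I_n -> {freeg (time T) / F}) : s < t ->
  (exists z, t < h z) -> bounded_rank h s t N ->
  (exists2 u, independent h s t u & size u = N) ->
  H0_free (R := R) (sublevel h s) (sublevel h t) v -> (n <= N)%N.
Proof.
move=> st exz bN [u [pu su _] uN] [vA vfree].
have rep x : exists i, h x <= s -> (i < N)%N /\ ~~ apart h t x (nth (clip T0 0) u i).
  case: (boolP (h x <= s)) => hx; last by exists 0%N.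
  have [/hasP[y yu nxy]|/hasPn all_apart] := boolP (has (fun y => ~~ apart h t x y) u).
    by exists (index y u) => _; rewrite -uN index_mem nth_index.
  have : (size (x :: u) <= N)%N.
    apply: bN; split => //=; last by rewrite hx.
    by rewrite pu andbT; apply/allP => y /all_apart; rewrite negbK.
  by rewrite /= uN ltnn.
have {rep}[j jP] := choice rep.
pose w (i : nat) : time T := nth (clip T0 0) u i.
pose chi (k : 'I_N) x : F := (j x == k)%:R.
(* A vector in the kernel of [M] gives the combination of weight 0. *)
pose M := \matrix_(i < n, k < N) weight_of (chi k) (v i).
rewrite leqNgt; apply/negP => Nn.
have : kermx M != 0.
  rewrite -mxrank_eq0 mxrank_ker -lt0n subn_gt0.
  by apply: leq_ltn_trans Nn; exact: rank_leq_col.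
move=> /rowV0Pn[a /sub_kermxP aM a0].
suff : boundary0 (R := R) (F := F) (sublevel h t) (\sum_(i < n) a 0 i *: v i).
  move=> /vfree a00; move/negP: a0; apply; apply/eqP/rowP => i.
  by rewrite a00 mxE.
set D := \sum_(i < n) _.
have DA x : x \in dom D -> h x <= s.
  move=> /dom_sum_subset/flattenP[_ /mapP[i _ ->]] /domZ_subset; exact: vA.
have chi0 k : weight_of (chi k) D = 0.
  rewrite weight_of_sum; move/matrixP: aM => /(_ 0 k); rewrite !mxE => E0.
  by rewrite -[RHS]E0; apply: eq_bigr => i _; rewrite mxE.
have DE : D = \sum_(x <- dom D) coeff x D *: (<< x >> - << w (j x) >>).
  rewrite {1}[D]chain_decomp; under [RHS]eq_bigr do rewrite scalerBr.
  rewrite sumrB [X in _ = _ - X](_ : _ = 0) ?subr0//.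
  have -> : \sum_(x <- dom D) coeff x D *: << w (j x) >> =
     \sum_(x <- dom D) \sum_(k < N) (coeff x D * chi k x) *: (<< w k >> : {freeg (time T) / F}).
    apply: eq_big_seq => x xD; have [jN _] := jP x (DA x xD).
    rewrite (bigD1 (Ordinal jN))//= /chi eqxx mulr1 big1 ?addr0// => k kj.
    rewrite [_ == _](_ : _ = false) ?mulr0 ?scale0r//.
    by apply/negbTE; apply: contra kj => /eqP E; apply/eqP/val_inj.
  rewrite exchange_big/= big1// => k _; rewrite -scaler_suml.
  by rewrite [X in X *: _](_ : _ = weight_of (chi k) D)// chi0 scale0r.
have simp x : exists sigma, x \in dom D ->
    simplex1 (R := R) (sublevel h t) sigma /\ boundary1 (R := R) F sigma = (<< x >> - << w (j x) >>) :> {freeg (time T) / F}.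
  case: (boolP (x \in dom D)) => xD; last by exists (fun=> x).
  have [jN nap] := jP x (DA x xD).
  have ws : h (w (j x)) <= s by apply: (allP su); rewrite /w mem_nth// uN.
  have [|||sigma ? ?] := @not_apart_simplex1 h t (w (j x)) x.
  - exact: le_trans ws (ltW st).
  - exact: le_trans (DA x xD) (ltW st).
  - by rewrite apart_sym.
  by exists sigma.
have {simp}[sg sgP] := choice simp.
exists (size (dom D)), (fun i => coeff (tnth (in_tuple (dom D)) i) D),
  (fun i => sg (tnth (in_tuple (dom D)) i)); split.
  by move=> i; apply: (sgP _ _).1; exact: mem_tnth.
rewrite {1}DE (big_tnth _ _ (dom D)); apply: eq_bigr => i _.
by rewrite (sgP _ _).2// mem_tnth.
Qed.

Lemma H0_rankE h s t : s < t -> (exists z, t < h z) -> always_bounded h ->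
  H0_rank F (sublevel h s) (sublevel h t) = (comp_rank h s t)%:R :> R.
Proof.
move=> st exz bd; have [[u iu uN] bN] := comp_rank_spec bd st.
have ub : ubound [set n%:R | n in [set n | exists v : 'I_n -> {freeg (time T) / F},
    H0_free (R := R) (sublevel h s) (sublevel h t) v]] ((comp_rank h s t)%:R : R).
  move=> _ [n [v fv] <-]; rewrite ler_nat; apply: (H0_free_le st exz bN _ fv).
  by exists u.
have mem : [set n%:R | n in [set n | exists v : 'I_n -> {freeg (time T) / F},
    H0_free (R := R) (sublevel h s) (sublevel h t) v]] ((comp_rank h s t)%:R : R).
  exists (comp_rank h s t) => //=; rewrite -uN.
  by exists (fun i : 'I_(size u) => << tnth (in_tuple u) i >>); exact: independent_H0_free.
apply/eqP; rewrite eq_le; apply/andP; split.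
  by apply: ge_sup => //; exists (comp_rank h s t)%:R.
by apply: ub_le_sup => //; exists (comp_rank h s t)%:R.
Qed.

Lemma persistence_rankE h s t : s < t -> continuous h ->
  persistence_rank F h s t = (comp_rank h s t)%:R.
Proof.
move=> st ch; have bd := continuous_bounded_rank T0 ch.
have [a [b hab]] := time_extrema T0 ch.
have supb : sup (range h) = h b.
  apply/eqP; rewrite eq_le; apply/andP; split.
    by apply: ge_sup; [exists (h b); exists b|move=> _ [x _ <-]; have /andP[] := hab x].
  by apply: ub_le_sup; [exists (h b) => _ [x _ <-]; have /andP[] := hab x|exists b].
rewrite /persistence_rank supb; case: ifP => tb.
  by apply: H0_rankE => //; exists b.
have [[u [_ _ nu] <-] _] := comp_rank_spec bd st.
case: (u =P [::]) => [->//|/eqP/nu[z tz]].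
by move/negP: tb; case; apply: lt_le_trans tz _; have /andP[] := hab z.
Qed.

End homology_rank.

(** * The persistence diagram *)

Section diagrams.
Context {R : realType} (F : fieldType) {T : R}.
Hypothesis T0 : 0 < T.
Implicit Types (h : time T -> R) (E : seq (R * R)) (x y : R * R) (f : R * R -> R).

Lemma esum_support (m : R * R -> nat) (A : set (R * R)) E : uniq E ->
  (forall x, A x -> m x != 0%N -> x \in E) ->
  (\esum_(x in A) (m x)%:R%:E)%E = (\sum_(x <- E | x \in A) (m x)%:R : R)%:E.
Proof.
move=> uE mE; have m0 x : (0 <= (m x)%:R%:E :> \bar R)%E by rewrite lee_fin.
rewrite (@esumID R _ [set` E]); last by move=> x _.
rewrite [X in (_ + X)%E](_ : _ = 0%E) ?adde0; last first.
  apply: esum1 => x [Ax nE]; case: (eqVneq (m x) 0%N) => [->//|/(mE _ Ax) xE].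
  by exfalso; apply: nE.
have fin : finite_set (A `&` [set` E]) by apply: finite_setIr; exact: finite_seq.
rewrite esum_fset// (fsbigE [seq x <- E | x \in A]).
- rewrite big_filter_cond sumEFin; congr (_%:E).
  rewrite big_seq_cond [RHS]big_seq_cond; apply: eq_bigl => x.
  case: (boolP (x \in E)) => //= xE; case: (boolP (x \in A)) => //= xA.
  by apply/mem_set; split; [exact: set_mem|].
- exact: filter_uniq.
- by move=> x /=; rewrite mem_filter => /andP[/set_mem xA xE].
- by move=> x [xA xE]; rewrite mem_filter mem_set// => /negP.
Qed.

Lemma mem_rectangle (a b c d : R) x : (x \in rectangle a b c d) = in_box a b c d x.
Proof.
apply/idP/idP => [/set_mem[/=]|/andP[h1 h2]].
  by rewrite !in_itv/= => h1 h2; rewrite /in_box h1 h2.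
by apply/mem_set; split; rewrite /= in_itv.
Qed.

Lemma mult_offdiagonal_spec h : continuous h -> offdiagonal_spec F h (mult (comp_rank h)).
Proof.
move=> ch; have bd := continuous_bounded_rank T0 ch.
have [a0 [b0 hab]] := time_extrema T0 ch.
have rk := comp_rank_rank_function bd hab.
split=> [x|x x12|a b c d ab bc cd bd0].
- exact: mult_diag.
- set e := (x.2 - x.1) / 4; have e0 : 0 < e by rewrite /e; lra.
  have [E [uE cov]] := covers_exists rk e0.
  exists (ball x e); first exact: nbhsx_ballx.
  apply: (sub_finite_set (B := [set` E])); last exact: finite_seq.
  move=> y [[/= y1 y2] my]; apply: cov => //; move: y1 y2.
  by rewrite /ball/= !ltr_norml /e; lra.
- set e := (c - b) / 2; have e0 : 0 < e by rewrite /e; lra.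
  have [E covE] := covers_exists rk e0.
  rewrite (@esum_support _ _ E covE.1); last first.
    move=> x /mem_set; rewrite mem_rectangle => xin mx; apply: covE.2 => //.
    by move: xin; rewrite /in_box /e; lra.
  congr (_%:E); under eq_bigl do rewrite mem_rectangle.
  rewrite (sum_mult_closed_box rk covE e0)//.
  + by rewrite !(persistence_rankE F T0)//; lra.
  + by rewrite /e; lra.
  + move=> x xin nx; apply: bd0; split; first by apply: set_mem; rewrite mem_rectangle.
    by move=> [/=]; rewrite !in_itv => /= h1 h2; move: nx; rewrite h1 h2.
Qed.

(** By local finiteness, a small square around [x] contains no other point of the
multiset; its box count is then the multiplicity of [x]. *)
Lemma offdiagonal_spec_unique h m : continuous h -> offdiagonal_spec F h m ->
  m = mult (comp_rank h).
Proof.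
move=> ch [m_diag m_fin m_box]; have bd := continuous_bounded_rank T0 ch.
have [a0 [b0 hab]] := time_extrema T0 ch.
have rk := comp_rank_rank_function bd hab.
apply/funext => x; case: (boolP (x.1 < x.2)) => x12; last by rewrite m_diag// mult_diag.
have [U /nbhs_ballP[u /= u0 uU] /finite_seqP[S SE]] := m_fin x x12.
have [k1 k10 k1P] := separated_from (map fst S) x.1.
have [k2 k20 k2P] := separated_from (map snd S) x.2.
(* A square that is small for [m], for the grid of the ranks and inside [U]. *)
set e := (x.2 - x.1) / 4; have e0 : 0 < e by rewrite /e; lra.
have [G g] := grid_exists rk e0.
have [k3 iso] := isolates_exists G x; have k30 := iso.1.
set k := Num.min (Num.min u e) (Num.min k1 (Num.min k2 k3)) / 2.
have v0 : 0 < Num.min (Num.min u e) (Num.min k1 (Num.min k2 k3)).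
  by rewrite !lt_min u0 e0 k10 k20 k30.
have : 2 * k <= Num.min (Num.min u e) (Num.min k1 (Num.min k2 k3)) by rewrite /k; lra.
rewrite !le_min => /andP[/andP[ku ke] /andP[kk1 /andP[kk2 kk3]]].
have kp : 0 < k by rewrite divr_gt0.
have eE : 4 * e = x.2 - x.1 by rewrite /e; lra.
clearbody k e; clear v0.
have only y : in_box (x.1 - k) (x.1 + k) (x.2 - k) (x.2 + k) y -> m y != 0%N -> y = x.
  move=> /andP[y1 y2] my; have : (U `&` [set y | m y != 0%N]) y.
    split=> //; apply: uU; split; rewrite /ball/= ltr_norml; lra.
  rewrite SE /= => yS; rewrite [y]surjective_pairing [x]surjective_pairing.
  congr (_, _); apply/eqP.
    have := k1P y.1 (map_f _ yS); case: eqP => // /eqP ne /(_ isT).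
    by rewrite leNgt (le_lt_trans (y := k))// ?ler_norml; lra.
  have := k2P y.2 (map_f snd yS); case: eqP => // /eqP ne /(_ isT).
  by rewrite leNgt (le_lt_trans (y := k))// ?ler_norml; lra.
have := m_box (x.1 - k) (x.1 + k) (x.2 - k) (x.2 + k).
move=> /(_ ltac:(lra) ltac:(lra) ltac:(lra)).
rewrite (@esum_support m _ [:: x])//; last first.
  by move=> y /mem_set; rewrite mem_rectangle inE => /only yx /yx ->.
have bd0 y : rectangle_boundary (x.1 - k) (x.1 + k) (x.2 - k) (x.2 + k) y -> m y = 0%N.
  move=> [/mem_set + ny]; rewrite mem_rectangle => yin.
  apply/eqP; apply: contrapT => /negP my; apply: ny; rewrite (only y yin my).
  by split; rewrite /= in_itv/=; lra.
move=> /(_ bd0)[]; rewrite !(persistence_rankE F T0)//; [|lra|lra|lra|lra].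
rewrite big_mkcond big_seq1 mem_rectangle ifT; last by rewrite /in_box; lra.
move=> E1; have kk3' : k < k3 by lra.
have xk : x.1 + k + e <= x.2 - k by lra.
have := mult_spec rk g iso e0 kp kk3' xk.
rewrite /square_rank /box_rank -E1 => /eqP; rewrite eqr_nat => /eqP.
by move->.
Qed.

Lemma diagram_mult h x : continuous h ->
  diagram F h x = (if x.1 == x.2 then +oo else (mult (comp_rank h) x)%:R%:E)%E.
Proof.
move=> ch; rewrite /diagram; case: xgetP => [m _ /(offdiagonal_spec_unique ch)->//|].
by move=> /(_ (mult (comp_rank h))); case; exact: mult_offdiagonal_spec.
Qed.

Lemma diagram_sumE h e E f : continuous h -> 0 < e -> covers (comp_rank h) e E ->
  (forall x, x.2 <= x.1 + e -> f x = 0) ->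
  diagram_sum F h f = \sum_(x <- E) (mult (comp_rank h) x)%:R * f x.
Proof.
move=> ch e0 [uE cov] f0; have val x : fine (diagram F h x * (f x)%:E)%E =
    (mult (comp_rank h) x)%:R * f x.
  rewrite diagram_mult//; case: eqP => [x12|//].
  by rewrite (f0 x) ?x12 ?lerDl ?(ltW e0)// mule0 mulr0.
rewrite /diagram_sum (fsbigE E)//; last first.
  move=> x _ xE; rewrite val; have [le|lt] := leP x.2 (x.1 + e).
    by rewrite f0// mulr0.
  have [->|mx] := eqVneq (mult (comp_rank h) x) 0%N; first by rewrite mul0r.
  by move/negP: xE; case; exact: cov.
rewrite big_mkcond; apply: eq_bigr => x _; rewrite val.
by rewrite mem_set.
Qed.

End diagrams.

(** * Powers, and Lipschitz bounds from local ones *)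

Section power_inequalities.
Context {R : realType}.
Implicit Types (x u v p th : R).

(** The graph of the concave function [x `^ th] lies below its tangent at 1; this is
Young's inequality with the factor 1. *)
Lemma powR_tangent x th : 0 <= x -> 0 < th -> th <= 1 -> x `^ th <= 1 - th + th * x.
Proof.
move=> x0 th0; rewrite le_eqVlt => /orP[/eqP ->|th1].
  by rewrite powRr1// subrr add0r mul1r.
have := @conjugate_powR R (x `^ th) 1 th^-1 (1 - th)^-1 (powR_ge0 _ _) ler01.
rewrite !invr_gt0 !invrK subr_gt0 => /(_ th0 th1).
rewrite addrC subrK => /(_ erefl); rewrite mulr1 -powRrM divff ?gt_eqF//.
by rewrite powRr1// powR1 mul1r; lra.
Qed.

Lemma powR_scaled_tangent x lam th : 0 <= x -> 0 < lam -> 0 < th -> th <= 1 ->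
  x `^ th <= (1 - th) * lam `^ th + th * lam `^ (th - 1) * x.
Proof.
move=> x0 l0 th0 th1; have := powR_tangent (divr_ge0 x0 (ltW l0)) th0 th1.
have lp := powR_gt0 th l0.
rewrite -(ler_pM2r lp) -powRM ?divr_ge0 ?(ltW l0)// divfK ?gt_eqF//.
move=> /le_trans; apply; rewrite mulrDl lerD2l.
rewrite -(mulr_powRB1 (ltW l0) th0) !mulrA divfK ?gt_eqF//.
by rewrite -!mulrA (mulrC x).
Qed.

(** The tangent inequality for the exponent [p^-1], applied to [(u / v) `^ p]. *)
Lemma powR_lipschitz p u v : 1 <= p -> 0 <= u -> u <= v ->
  v `^ p - u `^ p <= p * v `^ (p - 1) * (v - u).
Proof.
move=> p1 u0 uv; have v0 := le_trans u0 uv.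
have p0 : 0 < p by lra.
move: v0; rewrite le_eqVlt => /orP[/eqP v0|v0].
  have -> : u = v by apply/le_anti; rewrite uv -v0.
  by rewrite !subrr mulr0.
have z0 : 0 <= u / v by rewrite divr_ge0// ltW.
have ip0 : 0 < p^-1 by rewrite invr_gt0.
have ip1 : p^-1 <= 1 by rewrite invf_le1.
have := powR_tangent (powR_ge0 (u / v) p) ip0 ip1.
rewrite -powRrM divff ?gt_eqF// powRr1//.
rewrite -(ler_pM2l p0).
have -> : p * (1 - p^-1 + p^-1 * (u / v) `^ p) = p - 1 + (u / v) `^ p.
  by field; rewrite gt_eqF.
move=> zp.
have vp : 0 < v `^ (p - 1) by exact: powR_gt0.
have vE : v `^ p = v * v `^ (p - 1) by rewrite mulr_powRB1// ltW.
have uE : u `^ p = (u / v) `^ p * v `^ p by rewrite -powRM ?divfK ?gt_eqF// ltW.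
rewrite uE vE; set a := v `^ (p - 1) in vp *.
have uvz : u = (u / v) * v by rewrite divfK// gt_eqF.
rewrite [in leRHS]uvz; set z := u / v in zp z0 *.
have va : 0 < v * a by rewrite mulr_gt0.
have -> : p * a * (v - z * v) = (p - p * z) * (v * a) by ring.
have -> : v * a - z `^ p * (v * a) = (1 - z `^ p) * (v * a) by ring.
by rewrite ler_pM2r//; lra.
Qed.

Lemma powR_lipschitz_norm p u v b : 1 <= p -> 0 <= u -> 0 <= v -> u <= b -> v <= b ->
  `|v `^ p - u `^ p| <= p * b `^ (p - 1) * `|v - u|.
Proof.
move=> p1; wlog uv : u v / u <= v.
  move=> H u0 v0 ub vb; case: (leP u v) => [uv|/ltW vu]; first exact: H.
  by rewrite distrC (distrC v); apply: H.
move=> u0 v0 ub vb; rewrite !ger0_norm ?subr_ge0//; last first.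
  by apply: ge0_ler_powR => //; rewrite ?nnegrE; lra.
apply: le_trans (powR_lipschitz p1 u0 uv) _.
rewrite ler_wpM2r ?subr_ge0// ler_wpM2l//; first lra.
by apply: ge0_ler_powR => //; rewrite ?nnegrE//; lra.
Qed.

End power_inequalities.

Section local_to_global.
Context {R : realType}.

(** Induction along the interval: the set of [s] such that the bound holds on [[0, s]]
contains its supremum, and the local bound pushes it beyond, up to 1. *)
Lemma local_lipschitz_segment (f : R -> R) (M : R) : 0 <= M ->
  (forall s, 0 <= s <= 1 -> exists2 d, 0 < d & forall s', 0 <= s' <= 1 ->
    `|s' - s| < d -> `|f s' - f s| <= M * `|s' - s|) ->
  `|f 1 - f 0| <= M.
Proof.
move=> M0 loc.
pose A := [set s | 0 <= s <= 1 /\ forall u, 0 <= u <= s -> `|f u - f 0| <= M * u].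
have A0 : A 0.
  split; first by rewrite lexx ler01.
  by move=> u; rewrite -eq_le => /eqP <-; rewrite subrr normr0 mulr0.
have ubA : ubound A 1 by move=> s [/andP[]].
have supA : has_sup A by split; [exists 0|exists 1].
set sg := sup A.
have sg0 : 0 <= sg by apply: ub_le_sup => //; exists 1.
have sg1 : sg <= 1 by apply: ge_sup => //; exists 0.
have [d d0 dP] := loc sg ltac:(lra).
have below u : 0 <= u -> u < sg -> `|f u - f 0| <= M * u.
  move=> u0 us; have [s [s01 sP] su] := sup_adherent (eps := sg - u) ltac:(lra) supA.
  by apply: sP; rewrite u0 /=; rewrite -/sg in su; lra.
have at_sg : `|f sg - f 0| <= M * sg.
  have [sgE|sgN] := eqVneq sg 0; first by rewrite sgE subrr normr0 mulr0.
  have sgp : 0 < sg by rewrite lt_neqAle eq_sym sgN.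
  set u := Num.max 0 (sg - d / 2).
  have [u1 u2] : 0 <= u /\ sg - d / 2 <= u by rewrite !le_max !lexx orbT.
  have us : u < sg by rewrite gt_max; lra.
  have b := below u u1 us.
  have := dP u ltac:(lra); rewrite ler0_norm ?subr_le0 ?(ltW us)// => /(_ ltac:(lra)).
  have := ler_distD (f u) (f sg) (f 0); rewrite (distrC (f sg) (f u)).
  by move=> ? ?; nra.
have above u : sg <= u -> u <= 1 -> u < sg + d -> `|f u - f 0| <= M * u.
  move=> su u1 ud; have := dP u ltac:(lra); rewrite ger0_norm ?subr_ge0// => /(_ ltac:(lra)).
  by have := ler_distD (f sg) (f u) (f 0) => ? ?; nra.
have all u : 0 <= u -> u <= 1 -> u < sg + d -> `|f u - f 0| <= M * u.
  by move=> u0 u1 ud; case: (ltP u sg) => us; [exact: below|exact: above].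
set v := Num.min 1 (sg + d / 2).
have [v1 v2] : v <= 1 /\ v <= sg + d / 2 by rewrite !ge_min !lexx orbT.
have v0 : 0 <= v by rewrite le_min; lra.
have vA : A v by split; [lra|move=> u uv; apply: all; lra].
have vs : v <= sg by apply: ub_le_sup => //; exists 1.
have sgE : sg = 1.
  apply/le_anti; rewrite sg1/=; move: vs; rewrite /v ge_min => /orP[//|]; lra.
by have := all 1 ler01 (lexx _) ltac:(lra); rewrite mulr1.
Qed.

End local_to_global.

(** * Weighted sums over the diagram *)

Section total_mass.
Context {R : realType}.

Lemma covers_widen (r : R -> R -> nat) e e' E : covers r e E -> e <= e' -> covers r e' E.
Proof.
by move=> [uE cov] ee'; split=> // x xe; apply: cov; apply: le_lt_trans xe; rewrite lerD2l.
Qed.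

(** Every bar of length more than [e] crosses one of finitely many windows
[[s, s + e / 3]], and the number of bars crossing a window is a rank. *)
Lemma total_mass_le lo hi (r : R -> R -> nat) e e' E (M : R) :
  rank_function lo hi r -> 0 < e' -> e' < e / 3 -> covers r e' E -> lo <= hi ->
  (forall s, (r s (s + e / 3))%:R <= M) ->
  \sum_(x <- E | x.1 + e < x.2) (mult r x)%:R <=
    (Num.truncn ((hi - lo) / (e / 3))).+1%:R * M.
Proof.
move=> rk e'0 e'e cov lohi rM; set n := (Num.truncn _).+1.
have e30 : 0 < e / 3 by lra.
pose s (i : nat) := lo + i.+1%:R * (e / 3).
pose B i (x : R * R) := (x.1 < s i) && (s i + e / 3 < x.2).
apply: (@le_trans _ _ (\sum_(i < n) \sum_(x <- E | B i x) (mult r x)%:R)); last first.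
  rewrite -[n in leRHS]card_ord -sumr_const mulr_suml; apply: ler_sum => i _.
  rewrite mul1r; apply: le_trans (rM (s i)).
  by apply: (quadrant_mass_le rk cov e'0); rewrite ltrD2l.
under [leRHS]eq_bigr do rewrite big_mkcond.
rewrite exchange_big/= big_mkcond/=; apply: ler_sum => x _.
have ge0 : 0 <= \sum_(i < n) (if B i x then (mult r x)%:R else 0) :> R.
  by apply: sumr_ge0 => i _; case: ifP.
case: ifP => // xe; have [->|mx] := eqVneq (mult r x) 0%N.
  by apply: sumr_ge0 => i _; case: ifP.
have [xlo xhi] := mult_range rk mx.
have q0 : 0 <= (x.1 - lo) / (e / 3) by rewrite divr_ge0 ?(ltW e30)// subr_ge0.
have /andP[i1 i2] := truncn_itv q0; set i := Num.truncn _ in i1 i2.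
have ltin : (i < n)%N.
  rewrite ltnS truncn_ge_nat; last by rewrite divr_ge0 ?(ltW e30)// subr_ge0.
  apply: le_trans i1 _; rewrite ler_pM2r ?invr_gt0// lerD2r; lra.
rewrite (bigD1 (Ordinal ltin))//= ifT; last first.
  move: i1 i2; rewrite ler_pdivlMr// ltr_pdivrMr// => i1 i2.
  have i3 : i.+1%:R * (e / 3) = i%:R * (e / 3) + e / 3 by rewrite -natr1 mulrDl mul1r.
  rewrite i3 in i2; rewrite /B /s i3.
  clear -i1 i2 xe e30; lra.
by rewrite lerDl; apply: sumr_ge0 => j _; case: ifP.
Qed.

End total_mass.

Section functionals.
Context {R : realType} (F : fieldType) {T : R}.
Hypothesis T0 : 0 < T.
Variables (eps p C Lk : R) (kk : R * R -> R).
Hypotheses (eps0 : 0 < eps) (p1 : 1 <= p) (C0 : 0 <= C) (Lk0 : 0 <= Lk)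
  (kk_lip : forall x y, `|kk x - kk y| <= Lk * `|x - y|)
  (kk_diag : forall b, `|kk (b, b)| <= C).
Implicit Types (h : time T -> R) (x y : R * R).

Definition weight_pow x := weight eps x `^ p.
Definition total_weight h := diagram_sum F h weight_pow.
Definition weighted_kernel h := diagram_sum F h (fun x => weight_pow x * kk x).

Lemma weight_pow_eq0 x : x.2 <= x.1 + eps -> weight_pow x = 0.
Proof.
move=> x12; rewrite /weight_pow /weight max_r ?powR0//; last by lra.
by rewrite gt_eqF// (lt_le_trans ltr01).
Qed.

Lemma weighted_kernel_eq0 x : x.2 <= x.1 + eps -> weight_pow x * kk x = 0.
Proof. by move=> /weight_pow_eq0 ->; rewrite mul0r. Qed.

Lemma pair_norm_le (x y : R * R) b : `|y.1 - x.1| <= b -> `|y.2 - x.2| <= b -> `|y - x| <= b.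
Proof. by move=> h1 h2; rewrite /Num.norm/= ge_max h1 h2. Qed.

Lemma kk_bound x : `|kk x| <= C + Lk * `|x.2 - x.1|.
Proof.
rewrite -(subrK (kk (x.1, x.1)) (kk x)) addrC; apply: le_trans (ler_normD _ _) _.
apply: lerD; first exact: kk_diag.
apply: le_trans (kk_lip _ _) _; rewrite ler_wpM2l// pair_norm_le//=.
by rewrite subrr normr0.
Qed.

(** Between points of persistence at most [V], displacements of both coordinates by at
most [2 * d] change the two summands by at most [lip_const V * d]. *)
Definition lip_const (V : R) :=
  4 * p * V `^ (p - 1) * (1 + C + Lk * V) + 2 * V `^ p * Lk.

Lemma lip_const_ge0 V : 0 <= V -> 0 <= lip_const V.
Proof.
move=> V0; have p0 : 0 <= p by exact: le_trans p1.
by rewrite addr_ge0 ?mulr_ge0 ?addr_ge0 ?mulr_ge0 ?powR_ge0.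
Qed.

Lemma weight_lipschitz x y d : `|y.1 - x.1| <= 2 * d -> `|y.2 - x.2| <= 2 * d ->
  `|weight eps y - weight eps x| <= 4 * d.
Proof.
rewrite !ler_norml /weight => h1 h2.
by case: (leP (x.2 - x.1 - eps) 0) => ?; case: (leP (y.2 - y.1 - eps) 0) => ?; lra.
Qed.

Lemma weight_pow_lipschitz x y d V : `|y.1 - x.1| <= 2 * d -> `|y.2 - x.2| <= 2 * d ->
  x.2 - x.1 <= V -> y.2 - y.1 <= V -> 0 <= V ->
  `|weight_pow y - weight_pow x| <= 4 * p * V `^ (p - 1) * d.
Proof.
move=> h1 h2 xV yV V0; have e0 := eps0; have p1' := p1.
apply: (@le_trans _ _ (p * V `^ (p - 1) * `|weight eps y - weight eps x|)).
  by apply: powR_lipschitz_norm; rewrite // /weight ?le_max ?lexx ?orbT// ge_max V0 andbT; lra.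
have := weight_lipschitz h1 h2 => le.
have -> : 4 * p * V `^ (p - 1) * d = p * V `^ (p - 1) * (4 * d) by ring.
by rewrite ler_wpM2l// mulr_ge0 ?powR_ge0//; lra.
Qed.

Lemma weight_pow_le x V : x.2 - x.1 <= V -> 0 <= V -> 0 <= weight_pow x <= V `^ p.
Proof.
move=> xV V0; have e0 := eps0; have p1' := p1; rewrite powR_ge0/=.
apply: ge0_ler_powR; rewrite ?nnegrE /weight ?le_max ?lexx ?orbT//; first by lra.
by rewrite ge_max V0 andbT; lra.
Qed.

Lemma kernel_pow_lipschitz x y d V : `|y.1 - x.1| <= 2 * d -> `|y.2 - x.2| <= 2 * d ->
  `|x.2 - x.1| <= V -> `|y.2 - y.1| <= V -> 0 <= d ->
  `|weight_pow y * kk y - weight_pow x * kk x| <= lip_const V * d.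
Proof.
move=> h1 h2 xV yV d0; have V0 : 0 <= V by apply: le_trans xV.
have xV' := le_trans (ler_norm _) xV; have yV' := le_trans (ler_norm _) yV.
have wl := weight_pow_lipschitz h1 h2 xV' yV' V0.
have /andP[w0 wV] := weight_pow_le xV' V0.
have ky : `|kk y| <= C + Lk * V.
  by apply: le_trans (kk_bound y) _; rewrite lerD2l ler_wpM2l.
have kyx : `|kk y - kk x| <= Lk * (2 * d).
  by apply: le_trans (kk_lip _ _) _; rewrite ler_wpM2l// pair_norm_le.
have -> : weight_pow y * kk y - weight_pow x * kk x =
  (weight_pow y - weight_pow x) * kk y + weight_pow x * (kk y - kk x) by ring.
apply: le_trans (ler_normD _ _) _; rewrite !normrM (ger0_norm w0).
have a0 : 0 <= 4 * p * V `^ (p - 1) * d.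
  by rewrite !mulr_ge0 ?powR_ge0// (le_trans ler01).
have t1 : `|weight_pow y - weight_pow x| * `|kk y| <= 4 * p * V `^ (p - 1) * d * (C + Lk * V).
  by apply: ler_pM.
have t2 : weight_pow x * `|kk y - kk x| <= V `^ p * (Lk * (2 * d)) by apply: ler_pM.
rewrite /lip_const.
have -> : (4 * p * V `^ (p - 1) * (1 + C + Lk * V) + 2 * V `^ p * Lk) * d =
  4 * p * V `^ (p - 1) * d * (C + Lk * V) + V `^ p * (Lk * (2 * d)) + 4 * p * V `^ (p - 1) * d by ring.
by rewrite -[leLHS]addr0 lerD// lerD.
Qed.

Lemma weight_pow_lipschitz' x y d V : `|y.1 - x.1| <= 2 * d -> `|y.2 - x.2| <= 2 * d ->
  `|x.2 - x.1| <= V -> `|y.2 - y.1| <= V -> 0 <= d ->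
  `|weight_pow y - weight_pow x| <= lip_const V * d.
Proof.
move=> h1 h2 xV yV d0; have V0 : 0 <= V by apply: le_trans xV.
have xV' := le_trans (ler_norm _) xV; have yV' := le_trans (ler_norm _) yV.
apply: le_trans (weight_pow_lipschitz h1 h2 xV' yV' V0) _.
rewrite ler_wpM2r//; have p0 : 0 <= p by exact: le_trans p1.
rewrite /lip_const -[leLHS]mulr1 -[leLHS]addr0 lerD ?mulr_ge0 ?powR_ge0//.
by rewrite ler_wpM2l ?mulr_ge0 ?powR_ge0// -addrA lerDl addr_ge0// mulr_ge0.
Qed.

Definition levels (lo hi : R) : R := (Num.truncn ((hi - lo) / (eps / 2 / 3))).+1%:R.

(** Each point of persistence more than [eps / 2] moves by at most [2 * d], and there
are at most [levels lo hi * M] of them. The constant depends on [h] only through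
its range and its ranks, but the radius [d0] depends on the gaps of [h]. *)
Lemma functionals_local_lipschitz h lo hi M : continuous h ->
  (forall z, lo <= h z <= hi) -> (forall s, (comp_rank h s (s + eps / 2 / 3))%:R <= M) ->
  exists2 d0 : R, 0 < d0 & forall h' (d : R), continuous h' -> 0 <= d -> d < d0 ->
    (forall z, `|h z - h' z| <= d) ->
    `|total_weight h' - total_weight h| <= lip_const (hi - lo + 1) * d * (levels lo hi * M) /\
    `|weighted_kernel h' - weighted_kernel h| <= lip_const (hi - lo + 1) * d * (levels lo hi * M).
Proof.
move=> ch hb hM; have e0 := eps0; set V := hi - lo + 1.
have bd := continuous_bounded_rank T0 ch; have rk := comp_rank_rank_function bd hb.
have lohi : lo <= hi by have /andP[/le_trans] := hb (clip T0 0); apply.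
have e12 : 0 < eps / 12 by lra.
have [E cov] := covers_exists rk e12.
have [d1 d10 stab] := local_stability rk eps0 (covers_widen (e' := eps / 2) cov ltac:(lra)).
have M0 : 0 <= M by apply: le_trans (hM 0).
have mass : \sum_(x <- E | x.1 + eps / 2 < x.2) (mult (comp_rank h) x)%:R <= levels lo hi * M.
  by apply: (total_mass_le rk e12) => //; lra.
have V0 : 0 <= V by rewrite /V; lra.
exists (Num.min d1 (Num.min 4^-1 (eps / 16))); first by rewrite !lt_min d10; lra.
move=> h' d ch' d0; rewrite !lt_min => /andP[dd1 /andP[d4 d16]] hh'.
have NM0 : 0 <= levels lo hi * M by rewrite mulr_ge0 // /levels.
have [d00|dn0] := eqVneq d 0.
  have -> : h' = h.
    apply/funext => z; apply/esym/eqP; rewrite -subr_eq0 -normr_le0 -d00; exact: hh'.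
  by rewrite !subrr !normr0 !mulr_ge0 ?lip_const_ge0.
have dp : 0 < d by rewrite lt_neqAle eq_sym dn0.
have bd' := continuous_bounded_rank T0 ch'.
have hb' z : lo - d <= h' z <= hi + d.
  by have := hb z; have := hh' z; rewrite ler_norml; lra.
have rk' := comp_rank_rank_function bd' hb'.
have [E' cov'] := covers_exists rk' e12.
have I := comp_rank_interleaved bd bd' d0 hh'.
have near x y : x \in E -> mult (comp_rank h) x != 0%N -> x.1 + eps / 2 < x.2 ->
    `|y.1 - x.1| <= 2 * d -> `|y.2 - x.2| <= 2 * d -> `|x.2 - x.1| <= V /\ `|y.2 - y.1| <= V.
  move=> xE mx xe; have [] := mult_range rk mx; rewrite !ler_norml /V.
  move=> l1 l2 /andP[l3 l4] /andP[l5 l6]; clear -F T0 e0 lohi d4 d0 xe l1 l2 l3 l4 l5 l6.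
  by split; apply/andP; split; lra.
have gen f : (forall x, x.2 <= x.1 + eps -> f x = 0) ->
   (forall x y, `|y.1 - x.1| <= 2 * d -> `|y.2 - x.2| <= 2 * d ->
      `|x.2 - x.1| <= V -> `|y.2 - y.1| <= V -> 0 <= d -> `|f y - f x| <= lip_const V * d) ->
   `|diagram_sum F h' f - diagram_sum F h f| <= lip_const V * d * (levels lo hi * M).
  move=> f0 flip.
  have f0' x : x.2 <= x.1 + eps / 12 -> f x = 0 by move=> ?; apply: f0; lra.
  rewrite (diagram_sumE F T0 ch' e12 cov' f0') (diagram_sumE F T0 ch e12 cov f0').
  apply: (@le_trans _ _ (lip_const V * d * \sum_(x <- E | x.1 + eps / 2 < x.2) (mult (comp_rank h) x)%:R)).
    apply: (stab _ _ _ d) => //.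
    - exact: rk'.
    - by apply: covers_widen cov' _; lra.
    - move=> x y xE mx xe h1 h2; have [xV yV] := near x y xE mx xe h1 h2.
      exact: flip.
  by rewrite ler_wpM2l// mulr_ge0// lip_const_ge0.
split; apply: gen.
- exact: weight_pow_eq0.
- by move=> *; apply: weight_pow_lipschitz'.
- exact: weighted_kernel_eq0.
- by move=> *; apply: kernel_pow_lipschitz.
Qed.

(** The kernel is bounded by [C] on the diagonal, and a diagram point is at distance
at most [hi - lo] from the diagonal. *)
Lemma weighted_kernel_le h lo hi : continuous h -> (forall z, lo <= h z <= hi) ->
  `|weighted_kernel h| <= (C + Lk * (hi - lo)) * total_weight h.
Proof.
move=> ch hb; have e0 := eps0.
have bd := continuous_bounded_rank T0 ch; have rk := comp_rank_rank_function bd hb.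
have [E cov] := covers_exists rk eps0.
rewrite /weighted_kernel (diagram_sumE F T0 ch eps0 cov weighted_kernel_eq0).
rewrite /total_weight (diagram_sumE F T0 ch eps0 cov weight_pow_eq0).
apply: le_trans (ler_norm_sum _ _ _) _; rewrite mulr_sumr; apply: ler_sum => x _.
have [->|mx] := eqVneq (mult (comp_rank h) x) 0%N.
  by rewrite !mul0r normr0 mulr0.
have [xlo xhi] := mult_range rk mx.
have x12 : x.1 < x.2 by apply/negPn; apply: contra mx => /mult_diag ->.
rewrite !normrM normr_nat (ger0_norm (powR_ge0 _ _)) mulrA [leRHS]mulrC.
rewrite ler_wpM2l ?mulr_ge0 ?powR_ge0//.
apply: le_trans (kk_bound x) _; rewrite lerD2l ler_wpM2l// ger0_norm; lra.
Qed.

Lemma total_weight_ge0 h : continuous h -> 0 <= total_weight h.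
Proof.
move=> ch; have [a [b hb]] := time_extrema T0 ch.
have bd := continuous_bounded_rank T0 ch; have rk := comp_rank_rank_function bd hb.
have [E cov] := covers_exists rk eps0.
rewrite /total_weight (diagram_sumE F T0 ch eps0 cov weight_pow_eq0).
by apply: sumr_ge0 => x _; rewrite mulr_ge0// powR_ge0.
Qed.

(** Up to the margin [eta], the rank counts bars that contain [[s, t]]. *)
Lemma total_weight_ge h s t eta : continuous h -> 0 < eta ->
  s + eta + eps < t - eta ->
  (t - s - 2 * eta - eps) `^ p * (comp_rank h s t)%:R <= total_weight h.
Proof.
move=> ch eta0 st; have [a [b hb]] := time_extrema T0 ch.
have bd := continuous_bounded_rank T0 ch; have rk := comp_rank_rank_function bd hb.
have [E cov] := covers_exists rk eps0.
rewrite /total_weight (diagram_sumE F T0 ch eps0 cov weight_pow_eq0).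
apply: le_trans (ler_wpM2l (powR_ge0 _ _) (quadrant_mass_ge rk cov eps0 eta0 st)) _.
rewrite mulr_sumr big_mkcond/=; apply: ler_sum => x _; case: ifP => [/andP[x1 x2]|_].
  rewrite mulrC ler_wpM2l//; apply: ge0_ler_powR; rewrite ?nnegrE.
  - by apply: le_trans p1.
  - by lra.
  - by rewrite /weight le_max lexx orbT.
  - by rewrite /weight le_max; apply/orP; left; lra.
by rewrite mulr_ge0// powR_ge0.
Qed.

End functionals.

Section functional_path.
Context {R : realType} (F : fieldType) {T : R}.
Hypothesis T0 : 0 < T.
Variables (eps p C Lk : R) (kk : R * R -> R).
Hypotheses (eps0 : 0 < eps) (p1 : 1 <= p) (C0 : 0 <= C) (Lk0 : 0 <= Lk)
  (kk_lip : forall x y, `|kk x - kk y| <= Lk * `|x - y|)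
  (kk_diag : forall b, `|kk (b, b)| <= C).
Implicit Types (h : time T -> R) (x y : R * R).

Local Notation total_weight := (total_weight F eps p).
Local Notation weighted_kernel := (weighted_kernel F eps p kk).

Definition segment_path h0 h1 (s : R) (z : time T) := (1 - s) * h0 z + s * h1 z.

Lemma segment_path_continuous h0 h1 s : continuous h0 -> continuous h1 ->
  continuous (segment_path h0 h1 s).
Proof.
move=> c0 c1 z.
apply: (@continuousD R R (time T) (fun z => (1 - s) * h0 z) (fun z => s * h1 z)).
  apply: (@continuousM R (time T) (fun=> 1 - s) h0); last exact: c0.
  exact: cst_continuous.
apply: (@continuousM R (time T) (fun=> s) h1); last exact: c1.
exact: cst_continuous.
Qed.

(** The local Lipschitz bounds hold at each point of the segment from [h0] to [h1], with
the same constant but with uncontrolled radii. Small perturbations of a diagram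
thus control the increment over the whole segment. *)
Lemma weighted_mean_path h0 h1 (lo hi M D0 Delta : R) :
  continuous h0 -> continuous h1 ->
  (forall z, lo <= h0 z <= hi) -> (forall z, lo <= h1 z <= hi) -> 0 < D0 ->
  (forall s : R, 0 <= s <= 1 -> D0 <= total_weight (segment_path h0 h1 s)) ->
  (forall s : R, 0 <= s <= 1 -> forall b,
     (comp_rank (segment_path h0 h1 s) b (b + eps / 2 / 3))%:R <= M) ->
  (forall z, `|h1 z - h0 z| <= Delta) ->
  `|weighted_kernel h1 / total_weight h1 - weighted_kernel h0 / total_weight h0| <=
    lip_const p C Lk (hi - lo + 1) * (levels eps lo hi * M) * (1 + C + Lk * (hi - lo)) / D0 * Delta.
Proof.
move=> c0 c1 b0 b1 D00 dens ranks Dl.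
set hs := segment_path h0 h1.
have cs s : continuous (hs s) by exact: segment_path_continuous.
have bs (s : R) : 0 <= s <= 1 -> forall z, lo <= hs s z <= hi.
  move=> /andP[s0 s1] z; rewrite /hs /segment_path.
  have /andP[? ?] := b0 z; have /andP[? ?] := b1 z; nra.
have lohi : lo <= hi by have /andP[/le_trans] := b0 (clip T0 0); apply.
set V := hi - lo + 1; have V0 : 0 <= V by rewrite /V; lra.
have Delta0 : 0 <= Delta by apply: le_trans (Dl (clip T0 0)).
have M0 : 0 <= M by apply: le_trans (ranks 0 _ 0) => //; rewrite lexx ler01.
set A := lip_const p C Lk V; have A0 : 0 <= A by exact: lip_const_ge0.
set N := levels eps lo hi * M; have N0 : 0 <= N by rewrite mulr_ge0// /levels.
set c := C + Lk * (hi - lo); have c_0 : 0 <= c by rewrite addr_ge0// mulr_ge0//; lra.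
pose f s := weighted_kernel (hs s) / total_weight (hs s).
have -> : h1 = hs 1 by apply/funext => z; rewrite /hs /segment_path subrr mul0r mul1r add0r.
have -> : h0 = hs 0 by apply/funext => z; rewrite /hs /segment_path subr0 mul1r mul0r addr0.
rewrite -/(f 1) -/(f 0).
apply: local_lipschitz_segment.
  by rewrite !mulr_ge0 ?invr_ge0 ?(ltW D00)// -addrA addr_ge0.
move=> s s01.
have [d0 d00 dP] := functionals_local_lipschitz F T0 eps0 p1 C0 Lk0 kk_lip kk_diag
  (cs s) (bs s s01) (ranks s s01).
have D1 : 0 < Delta + 1 by lra.
exists (d0 / (Delta + 1)); first by rewrite divr_gt0.
move=> s' s'01; rewrite ltr_pdivlMr// => ss'.
set d := `|s' - s| * Delta.
have d_0 : 0 <= d by rewrite mulr_ge0.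
have dd0 : d < d0.
  by apply: le_lt_trans ss'; rewrite ler_wpM2l// lerDl.
have close z : `|hs s z - hs s' z| <= d.
  have -> : hs s z - hs s' z = (s - s') * (h1 z - h0 z) by rewrite /hs /segment_path; ring.
  by rewrite normrM distrC ler_wpM2l.
have [den num] := dP (hs s') d (cs s') d_0 dd0 close.
have nb := weighted_kernel_le F T0 eps0 p1 Lk0 kk_lip kk_diag (cs s) (bs s s01).
have dn := dens s s01; have dn' := dens s' s'01.
have t0 : 0 < total_weight (hs s) by exact: lt_le_trans dn.
have t0' : 0 < total_weight (hs s') by exact: lt_le_trans dn'.
have fb : `|f s| <= c by rewrite /f normrM normfV (gtr0_norm t0) (ler_pdivrMr _ _ t0).
have quotB (a a' b b' : R) : b != 0 -> b' != 0 ->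
    a' / b' - a / b = (a' - a - a / b * (b' - b)) / b'.
  by move=> bn0 bn0'; field; rewrite bn0 bn0'.
have fE := quotB (weighted_kernel (hs s)) (weighted_kernel (hs s')) _ _
  (lt0r_neq0 t0) (lt0r_neq0 t0').
rewrite -/(f s) -/(f s') in fE; rewrite fE normrM normfV (gtr0_norm t0') (ler_pdivrMr _ _ t0').
have step : `|weighted_kernel (hs s') - weighted_kernel (hs s)
    - f s * (total_weight (hs s') - total_weight (hs s))| <= A * d * N * (1 + c).
  apply: le_trans (ler_normB _ _) _; 
  have -> : A * d * N * (1 + c) = A * d * N + A * d * N * c by ring.
  by rewrite lerD// normrM mulrC ler_pM.
apply: le_trans step _; rewrite /d.
have -> : A * (`|s' - s| * Delta) * N * (1 + c) =
  (A * N * (1 + c) * Delta * `|s' - s|) * 1 by ring.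
have -> : A * N * (1 + C + Lk * (hi - lo)) / D0 * Delta * `|s' - s| * total_weight (hs s') =
  (A * N * (1 + c) * Delta * `|s' - s|) * (total_weight (hs s') / D0).
  by rewrite /c; field; rewrite gt_eqF.
apply: ler_wpM2l; last by rewrite (ler_pdivlMr _ _ D00) mul1r; exact: dn'.
by rewrite !mulr_ge0// addr_ge0.
Qed.

End functional_path.

Section rho.
Context {R : realType} (F : fieldType) {T : R} (S : Type).
Hypothesis T0 : 0 < T.
Variables (eps p : R) (k : R * R -> S -> R).
Hypotheses (eps0 : 0 < eps) (p1 : 1 <= p).

Lemma rho_barE (h : time T -> R) t : continuous h ->
  rho_bar F eps p k h t =
  weighted_kernel F eps p (fun x => k x t) h / total_weight F eps p h.
Proof.
move=> ch; have := total_weight_ge0 F T0 eps0 p1 ch.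
rewrite /rho_bar -/(weighted_kernel F eps p (fun x => k x t) h) -/(total_weight F eps p h).
rewrite le_eqVlt => /orP[/eqP <-|->//].
by rewrite ltxx invr0 mulr0.
Qed.

(** The diagram is a function of the ranks. *)
Lemma rho_bar_reparam (h h' : time T -> R) (tau sigma : time T -> time T) t :
  continuous h -> continuous h' ->
  cancel tau sigma -> cancel sigma tau ->
  (forall x y, \val x < \val y -> \val (tau x) < \val (tau y)) ->
  (forall x, h' x = h (tau x)) -> rho_bar F eps p k h' t = rho_bar F eps p k h t.
Proof.
move=> ch ch' tK sK tm hE; have rE := comp_rank_reparam tK sK tm hE.
have dE : diagram F h' = diagram F h.
  by apply/funext => x; rewrite (diagram_mult F T0 x ch') (diagram_mult F T0 x ch) rE.
by rewrite /rho_bar /diagram_sum dE.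
Qed.

End rho.

(** * Periodic functions and reparametrisations *)

Section periodic_functions.
Context {R : realType} (phi : R -> R).
Hypotheses (cphi : continuous phi) (per : forall x, phi (x + 1) = phi x).

Lemma periodic_nat (m : nat) x : phi (x + m%:R) = phi x.
Proof. by elim: m x => [|m IH] x; rewrite ?addr0// -natr1 addrA per IH. Qed.

Lemma periodic_extrema : exists y z, [/\ 0 <= y < 1, 0 <= z < 1,
  forall x, phi y <= phi x <= phi z & amplitude phi = phi z - phi y].
Proof.
have cw : {within `[0, 1], continuous phi} by apply: continuous_subspaceT => x; exact: cphi.
have fr := full_range_periodic per (lexx 1).
have wrap y : 0 <= y <= 1 -> exists2 y', 0 <= y' < 1 & phi y' = phi y.
  move=> /andP[y0]; rewrite le_eqVlt => /orP[/eqP ->|y1]; last by exists y; rewrite ?y0.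
  by exists 0; rewrite ?lexx ?ltr01// -(per 0) add0r.
have [y + yP] := EVT_min ler01 cw; rewrite in_itv/= => /wrap[y' y'01 y'E].
have [z + zP] := EVT_max ler01 cw; rewrite in_itv/= => /wrap[z' z'01 z'E].
have b x : phi y' <= phi x <= phi z'.
  have [x' x'01 <-] := fr x; rewrite y'E z'E yP ?zP// in_itv/=.
exists y', z'; split=> //; rewrite /amplitude; congr (_ - _).
  apply/eqP; rewrite eq_le ge_sup//=; last 2 first.
  - by exists (phi z'); exists z'.
  - by move=> _ [x _ <-]; have /andP[] := b x.
  by apply: ub_le_sup; [exists (phi z') => _ [x _ <-]; have /andP[] := b x|exists z'].
apply/eqP; rewrite eq_le; apply/andP; split.
  by apply: ge_inf; [exists (phi y') => _ [x _ <-]; have /andP[] := b x|exists y'].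
apply: lb_le_inf; first by exists (phi z'); exists z'.
by move=> _ [x _ <-]; have /andP[] := b x.
Qed.

(** By periodicity, a maximum point can be found to the right of the minimum point, less
than a period away. *)
Lemma periodic_interlaced : 0 < amplitude phi -> exists y z,
  [/\ 0 <= y < 1, y < z < y + 1, forall x, phi y <= phi x <= phi z &
      amplitude phi = phi z - phi y].
Proof.
move=> A0; have [y [z [y01 z01 b A]]] := periodic_extrema.
have yz : y != z by apply/eqP => yz; move: A0; rewrite A yz subrr ltxx.
case: (ltP y z) => yz'; first by exists y, z; split => //; lra.
exists y, (z + 1); split; rewrite ?per//.
by move/eqP: yz => yz; have : z < y by [rewrite lt_neqAle yz' andbT; apply/eqP => E; apply: yz]; lra.
Qed.

Lemma periodic_uniform_continuous e : 0 < e ->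
  exists2 d, 0 < d & forall x y, `|x - y| < d -> `|phi x - phi y| < e.
Proof.
move=> e0.
(* Translates of two close points by an integer lie together in [[0, 3]]. *)
have T2 : 0 < 3 :> R by [].
have ch : continuous (fun z : time (3 : R) => phi (\val z)).
  move=> z; apply: (@continuous_comp (time (3 : R)) R R (fun z => \val z) phi).
    exact: initial_continuous.
  exact: cphi.
have [d d0 dP] := time_uniform_continuous T2 ch e0.
exists (Num.min d 1); first by rewrite lt_min d0 ltr01.
have perZ (m : int) y : phi (y + m%:~R) = phi y.
  case: m => m; first exact: periodic_nat.
  by rewrite NegzE -(periodic_nat m.+1) mulrNz subrK.
move=> x y; rewrite lt_min => /andP[xyd xy1].
set m := Num.floor x; have /andP[fx xf] := floor_itv x.
move: xy1; rewrite ltr_norml -/m in fx xf * => xy1.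
have mS : (m + 1)%:~R = m%:~R + 1 :> R by rewrite intrD.
rewrite mS in xf.
have ix : 0 <= x - m%:~R + 1 <= 3 by lra.
have iy : 0 <= y - m%:~R + 1 <= 3 by lra.
have sh u : phi (u - m%:~R + 1) = phi u by rewrite per -mulrNz perZ.
have := dP (clip T2 (y - m%:~R + 1)) (clip T2 (x - m%:~R + 1)).
rewrite !val_clip// !sh; apply.
by rewrite (_ : x - m%:~R + 1 - (y - m%:~R + 1) = x - y)//; ring.
Qed.

End periodic_functions.

Section reparametrisation.
Context {R : realType} {T : R}.
Hypothesis T0 : 0 < T.
Variables (L vmin : R).
Hypotheses (L0 : 0 < L) (v0 : 0 < vmin).
Implicit Types (g : time T -> R) (x y : time T).

Lemma Gamma_lt g x y : Gamma T L vmin g -> \val x < \val y -> g x < g y.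
Proof.
move=> [_ _ _ _ mono] xy; have := mono x y (ltW xy) => /andP[_ h].
by rewrite -subr_gt0; apply: lt_le_trans h; rewrite mulr_gt0// subr_gt0.
Qed.

Lemma Gamma_lt_inv g x y : Gamma T L vmin g -> g x < g y -> \val x < \val y.
Proof.
move=> Gg gxy; rewrite ltNge; apply/negP => yx.
have [_ _ _ _ mono] := Gg; have /andP[h0 h] := mono y x yx.
by have := le_trans h0 h; rewrite subr_ge0 leNgt gxy.
Qed.

Lemma Gamma_inj g x y : Gamma T L vmin g -> g x = g y -> x = y.
Proof.
move=> Gg gxy; apply/val_inj; case: (ltgtP (\val x) (\val y)) => // /(Gamma_lt Gg).
  by rewrite gxy ltxx.
by rewrite gxy ltxx.
Qed.

Lemma Gamma_slope g x y : Gamma T L vmin g ->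
  vmin * `|\val x - \val y| <= `|g x - g y|.
Proof.
move=> [_ _ _ _ mono]; case: (leP (\val x) (\val y)) => xy.
  have /andP[_] := mono x y xy; rewrite distrC ger0_norm ?subr_ge0// distrC => h.
  by apply: le_trans h (ler_norm _).
have /andP[_] := mono y x (ltW xy); rewrite ger0_norm ?subr_ge0 ?(ltW xy)// => h.
by apply: le_trans h (ler_norm _).
Qed.

Lemma Gamma_surj g (v : R) : Gamma T L vmin g -> 0 <= v <= L -> exists x, g x = v.
Proof.
move=> [cg _ g0 gT _] vL.
have cw : {within `[0, T], continuous (g \o clip T0)}.
  apply: continuous_subspaceT => r; apply: continuous_comp; last exact: cg.
  exact: continuous_clip.
have [|r _ rv] := IVT (v := v) (ltW T0) cw.
  rewrite /= (g0 (clip T0 0)) ?(gT (clip T0 T)) ?val_clip ?lexx ?(ltW T0)//.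
  by rewrite ge_min le_max; lra.
by exists (clip T0 r).
Qed.

(** The time change is [tau = g2^-1 \o g1]; it moves no time by more than
[dd / vmin], since [g2] has slope at least [vmin]. *)
Lemma Gamma_reparam g1 g2 dd : Gamma T L vmin g1 -> Gamma T L vmin g2 ->
  (forall x, `|g1 x - g2 x| <= dd) ->
  exists tau sigma : time T -> time T,
    [/\ cancel tau sigma /\ cancel sigma tau,
        forall x y, \val x < \val y -> \val (tau x) < \val (tau y),
        forall x, g2 (tau x) = g1 x,
        forall W : time T -> R, continuous W -> continuous (W \o tau) &
        forall x, `|\val (tau x) - \val x| <= dd / vmin].
Proof.
move=> G1 G2 g12.
have r1 x : 0 <= g1 x <= L by have [_ + _ _ _] := G1; apply.
have r2 x : 0 <= g2 x <= L by have [_ + _ _ _] := G2; apply.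
have [tau tauP] := choice (fun x => Gamma_surj G2 (r1 x)).
have [sigma sigmaP] := choice (fun x => Gamma_surj G1 (r2 x)).
have close x y : `|\val (tau x) - \val (tau y)| <= `|g1 x - g1 y| / vmin.
  by rewrite ler_pdivlMr// mulrC; apply: le_trans (Gamma_slope _ _ G2) _; rewrite !tauP.
exists tau, sigma; split.
- by split=> x; [apply: (Gamma_inj G1); rewrite sigmaP tauP|apply: (Gamma_inj G2); rewrite tauP sigmaP].
- by move=> x y /(Gamma_lt G1) xy; apply: (Gamma_lt_inv G2); rewrite !tauP.
- exact: tauP.
- move=> W /(time_continuousP T0) cW; apply/(time_continuousP T0) => x e e0.
  have [d d0 dP] := cW (tau x) e e0.
  have [cg1 _ _ _ _] := G1; have := proj1 (time_continuousP T0 g1) cg1 x (d * vmin) (mulr_gt0 d0 v0).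
  move=> [d' d'0 d'P]; exists d' => // y /d'P yx; apply: dP.
  by apply: le_lt_trans (close y x) _; rewrite ltr_pdivrMr.
- move=> x; rewrite ler_pdivlMr// mulrC.
  by apply: le_trans (Gamma_slope _ _ G2) _; rewrite tauP.
Qed.

End reparametrisation.

(** * Pathwise stability of the signal *)

Section signals.
Context {R : realType} (F : fieldType) {T : R}.
Hypothesis T0 : 0 < T.
Variables (phi : R -> R).
Hypotheses (cphi : continuous phi) (per : forall x, phi (x + 1) = phi x).
Variables (L vmin : R).
Hypotheses (L0 : 0 < L) (v0 : 0 < vmin).
Implicit Types (g W : time T -> R) (x y z : time T).

(** There is at least one: for [phi] of full range on [[0, L]] and [L < 1], the function
[phi \o g] still attains the minimum and the maximum of [phi]. *)
Definition periods : nat := maxn 1 (Num.truncn L).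

(** Each period of [phi] contributes a component of the sublevel set at [s] that is
still separated from the others at the level [t]. *)
Lemma signal_rank_ge g (h : time T -> R) (m s t y z : R) : Gamma T L vmin g ->
  0 <= y < 1 -> y < z < y + 1 ->
  full_range phi L -> (forall u, `|h u - phi (g u)| <= m) ->
  phi y + m <= s -> t + m < phi z -> s < t -> always_bounded h ->
  (periods <= comp_rank h s t)%N.
Proof.
move=> Gg y01 yz fr hphi ys tz st bd.
have [_ bound] := comp_rank_spec bd st.
have surj v : 0 <= v <= L -> exists x, g x = v by exact: (Gamma_surj T0 Gg).
have low u : phi (g u) = phi y -> h u <= s.
  by move=> E; have := hphi u; rewrite E ler_norml; lra.
have high u : phi (g u) = phi z -> t < h u.
  by move=> E; have := hphi u; rewrite E ler_norml; lra.
have exz : exists u, t < h u.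
  by have [v vL vE] := fr z; have [u ?] := surj v vL; exists u; apply: high; congruence.
rewrite /periods; have [L1|L1] := leqP (Num.truncn L) 1.
  have [v vL vE] := fr y; have [u gu] := surj v vL.
  by apply: (bound [:: u]); split => //=; rewrite low// gu.
have [u uP] : exists u : nat -> time T, forall i, (i < Num.truncn L)%N -> g (u i) = y + i%:R.
  suff /choice[u uP] : forall i, exists u, (i < Num.truncn L)%N -> g u = y + i%:R by exists u.
  move=> i; case: (ltnP i (Num.truncn L)) => iL; last by exists (clip T0 0).
  have [|w wE] := surj (y + i%:R); last by exists w.
  have : (i.+1)%:R <= L :> R.
    by apply: le_trans (_ : (Num.truncn L)%:R <= _); rewrite ?ler_nat// truncn_le ltW.
  by have := ler0n R i; rewrite -natr1; lra.
have : independent h s t [seq u i | i <- iota 0 (Num.truncn L)].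
  split; last by [].
  - rewrite pairwise_map; apply: (@sub_in_pairwise _ (fun i => i \in iota 0 (Num.truncn L)) ltn).
    + move=> i j; rewrite !mem_iota/= !add0n => iL jL ij; apply/asboolP.
      have j1 : (i.+1)%:R <= j%:R :> R by rewrite ler_nat.
      have jL' : (j.+1)%:R <= L :> R.
        by apply: le_trans (_ : (Num.truncn L)%:R <= _); rewrite ?ler_nat// truncn_le ltW.
      have i0 := ler0n R i.
      rewrite -natr1 in j1; rewrite -natr1 in jL'.
      have [|w wE] := surj (z + i%:R); first by lra.
      exists w; last by apply: high; rewrite wE periodic_nat.
      apply/orP; left; rewrite !(Gamma_lt_inv Gg)// uP// wE; lra.
    + by apply/allP.
    + by have := iota_ltn_sorted 0 (Num.truncn L); rewrite sorted_pairwise//; exact: ltn_trans.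
  - rewrite all_map; apply/allP => i; rewrite mem_iota/= add0n => iL.
    by apply: low; rewrite uP// periodic_nat.
by move=> /bound; rewrite size_map size_iota.
Qed.

(** Between two independent points the signal increases by [e], hence [phi \o g] or one
of the two noises increases by [e / 3]. This takes a minimal increment of [g], of
the time or of the changed time, and these three are monotone and bounded. *)
Lemma signal_rank_le g W tau (H beta dphi e s : R) b : Gamma T L vmin g ->
  (forall x y, \val x < \val y -> \val (tau x) < \val (tau y)) ->
  0 <= H -> 0 < beta -> 0 < e -> 0 < dphi -> 0 <= s <= 1 ->
  (forall x y : R, `|x - y| < dphi -> `|phi x - phi y| < e / 3) ->
  (forall x y, `|W x - W y| <= H * `|\val x - \val y| `^ beta) ->
  (comp_rank (fun x => phi (g x) + ((1 - s) * W x + s * W (tau x))) b (b + e))%:R <=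
    L / dphi + 2 * T * (3 * (H + 1) / e) `^ beta^-1 + 1 :> R.
Proof.
move=> Gg tm H0 b0 e0 d0 s01 dphiP HW; set h := fun x => _.
set c := (3 * (H + 1) / e) `^ beta^-1.
have H1 : 0 < 3 * (H + 1) / e by rewrite divr_gt0//; lra.
have c0 : 0 < c by exact: powR_gt0.
have noise x z : e / 3 <= W z - W x -> 1 <= c * `|\val z - \val x|.
  move=> ezx; have := le_trans ezx (le_trans (ler_norm _) (HW z x)); set d := `|_| => hd.
  have d_0 : 0 <= d by exact: normr_ge0.
  have : 1 <= 3 * (H + 1) / e * d `^ beta.
    have E3 : H * d `^ beta <= (H + 1) * d `^ beta by rewrite ler_wpM2r ?powR_ge0// lerDl.
    rewrite mulrAC ler_pdivlMr// mul1r; lra.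
  move=> /(ge0_ler_powR (r := beta^-1)); rewrite powR1 invr_ge0 (ltW b0) !nnegrE.
  move=> /(_ isT ler01); rewrite mulr_ge0 ?powR_ge0 ?(ltW H1)// => /(_ isT).
  by rewrite powRM ?powR_ge0 ?(ltW H1)// -powRrM divff ?gt_eqF// powRr1.
(* Each of the three causes of an increment raises the potential by 1. *)
pose Psi x := g x / dphi + (c * \val x + c * \val (tau x)).
have tau_le x : 0 <= \val (tau x) <= T by exact: time_itv.
have gL x : 0 <= g x <= L by have [_ + _ _ _] := Gg; apply.
set B := L / dphi + 2 * T * c.
have PB x : 0 <= Psi x <= B.
  have /andP[x1 x2] := time_itv x; have /andP[x3 x4] := tau_le x; have /andP[x5 x6] := gL x.
  have c_0 := ltW c0.
  rewrite /Psi /B addr_ge0 ?addr_ge0 ?mulr_ge0 ?invr_ge0 ?(ltW d0)//=.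
  rewrite lerD//; first by rewrite ler_wpM2r// invr_ge0 ltW.
  have -> : 2 * T * c = c * T + c * T by ring.
  by rewrite lerD// ler_wpM2l.
have B0 : 0 <= B by have /andP[/le_trans] := PB (clip T0 0); apply.
have incr x y z : \val x < \val z -> \val z < \val y -> h x <= b -> b + e < h z ->
    Psi x + 1 <= Psi y.
  move=> xz zy hx hz.
  have gxz := Gamma_lt v0 Gg xz; have gzy := Gamma_lt v0 Gg zy.
  have txz := tm _ _ xz; have tzy := tm _ _ zy.
  have xy := lt_trans xz zy; have txy := lt_trans txz tzy; have gxy := lt_trans gxz gzy.
  have alt : e / 3 <= phi (g z) - phi (g x) \/ e / 3 <= W z - W x \/ e / 3 <= W (tau z) - W (tau x).
    case: (leP (e / 3) (phi (g z) - phi (g x))) => p1; first by left.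
    case: (leP (e / 3) (W z - W x)) => p2; first by right; left.
    case: (leP (e / 3) (W (tau z) - W (tau x))) => p3; first by right; right.
    exfalso; move: hx hz; rewrite /h => hx hz; move/andP: s01 => [s0 s1].
    have q1 : (1 - s) * (W z - W x) <= (1 - s) * (e / 3) by rewrite ler_wpM2l ?subr_ge0// ltW.
    have q2 : s * (W (tau z) - W (tau x)) <= s * (e / 3) by rewrite ler_wpM2l// ltW.
    clear -q1 q2 p1 hx hz e0; nra.
  have d1 : 0 <= (g y - g x) / dphi by rewrite divr_ge0 ?ltW// subr_gt0.
  have d2 : 0 <= c * (\val y - \val x) by rewrite mulr_ge0 ?ltW// subr_gt0.
  have d3 : 0 <= c * (\val (tau y) - \val (tau x)) by rewrite mulr_ge0 ?ltW// subr_gt0.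
  have PE : Psi y - Psi x = (g y - g x) / dphi + (c * (\val y - \val x) + c * (\val (tau y) - \val (tau x))).
    by rewrite /Psi; ring.
  suff : 1 <= Psi y - Psi x by rewrite lerBrDl.
  rewrite PE; case: alt => [p|[p|p]].
  - have : dphi <= g z - g x.
      rewrite leNgt; apply/negP => lt; have := dphiP (g z) (g x).
      rewrite gtr0_norm ?subr_gt0// => /(_ lt); rewrite ltNge => /negP; apply.
      by apply: le_trans (ler_norm _).
    move=> dg; have : 1 <= (g y - g x) / dphi.
      by rewrite ler_pdivlMr// mul1r; apply: le_trans dg _; rewrite lerB// ltW.
    clear -d2 d3; lra.
  - have := noise x z p; rewrite gtr0_norm ?subr_gt0// => n1.
    have : 1 <= c * (\val y - \val x).
      by apply: le_trans n1 _; rewrite ler_wpM2l ?(ltW c0)// lerB// ltW.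
    clear -d1 d3; lra.
  - have := noise (tau x) (tau z) p; rewrite gtr0_norm ?subr_gt0// => n1.
    have : 1 <= c * (\val (tau y) - \val (tau x)).
      by apply: le_trans n1 _; rewrite ler_wpM2l ?(ltW c0)// lerB// ltW.
    clear -d1 d2; lra.
have bn := potential_bound PB incr.
have [[u iu <-] _] := comp_rankP bn.
apply: (@le_trans _ _ (Num.truncn B).+1%:R); first by rewrite ler_nat; exact: bn.
by rewrite -natr1 lerD2r truncn_le.
Qed.

End signals.

Section signal_stability.
Context {R : realType} (F : fieldType) {T : R} (S : Type).
Hypothesis T0 : 0 < T.

Lemma leq_succ_double_max n : (n.+1 <= 2 * maxn 1 n)%N.
Proof. by case: n => // n; rewrite (maxn_idPr _)// mul2n -addnn addnS ltnS leq_addr. Qed.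

Lemma powR_affine_le (a H th : R) : 0 < a -> 0 <= H -> 0 < th ->
  (a * (H + 1)) `^ th <= (2 * a) `^ th * (1 + H `^ th).
Proof.
move=> a0 H0 th0; set m := Num.max 1 H.
have m0 : 0 <= m by rewrite le_max ler01.
apply: (@le_trans _ _ ((2 * a * m) `^ th)).
  apply: ge0_ler_powR; rewrite ?nnegrE ?(ltW th0) ?mulr_ge0 ?(ltW a0)//; first by lra.
  have : H + 1 <= 2 * m.
    have : 1 <= m /\ H <= m by rewrite !le_max !lexx orbT.
    by move=> [? ?]; lra.
  by move=> h; have -> : 2 * a * m = a * (2 * m) by [ring]; rewrite ler_wpM2l// ltW.
rewrite powRM ?mulr_ge0 ?(ltW a0)// ler_wpM2l ?powR_ge0//.
rewrite /m; case: (leP 1 H) => _; first by rewrite lerDr ler01.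
by rewrite powR1 lerDl powR_ge0.
Qed.

(** The total weight is at least, and the number of bars caused by [phi] is at most, a
multiple of the number of periods in [[0, L]], so their quotient is bounded
independently of [L]. The noise adds at most a multiple of [1 + H `^ beta^-1] bars. *)
Lemma signal_stability (phi : R -> R) (eps p q C Lk beta : R) :
  continuous phi -> (forall x, phi (x + 1) = phi x) ->
  0 < eps -> 1 <= p -> 0 < q -> 0 <= C -> 0 <= Lk -> 0 < beta ->
  exists2 K0 : R, 0 <= K0 & forall (k : R * R -> S -> R) (t : S) (L vmin : R)
    (g1 g2 W : time T -> R) (H dd Delta : R),
    (forall x y, `|k x t - k y t| <= Lk * `|x - y|) -> (forall b, `|k (b, b) t| <= C) ->
    0 < L -> 0 < vmin -> full_range phi L ->
    Gamma T L vmin g1 -> Gamma T L vmin g2 -> (forall x, `|g1 x - g2 x| <= dd) ->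
    continuous W -> (forall x, `|W x| <= (amplitude phi - eps - q) / 2) ->
    0 <= H -> (forall x y, `|W x - W y| <= H * `|\val x - \val y| `^ beta) ->
    (forall x y, `|\val x - \val y| <= dd / vmin -> `|W x - W y| <= Delta) ->
    `|rho_bar F eps p k (fun x => phi (g1 x) + W x) t -
      rho_bar F eps p k (fun x => phi (g2 x) + W x) t| <=
    K0 * (1 + H `^ beta^-1) * Delta.
Proof.
move=> cphi per e0 p1 q0 C0 Lk0 b0; set m := (amplitude phi - eps - q) / 2.
have [m0|mneg] := leP 0 m; last first.
  exists 0 => // k t L vmin g1 g2 W H dd Delta _ _ _ _ _ _ _ _ _ Wm.
  by have := le_trans (normr_ge0 _) (Wm (clip T0 0)); rewrite leNgt mneg.
have Apos : 0 < amplitude phi by move: m0; rewrite /m; lra.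
have [y [z [y01 yz yzb AE]]] := periodic_interlaced cphi per Apos.
set lo := phi y - m; set hi := phi z + m; set e := eps / 2 / 3.
have ep : 0 < e by rewrite /e; lra.
have [dphi d0 dphiP] := periodic_uniform_continuous cphi per (e := e / 3) ltac:(lra).
set D := hi - lo; have D_0 : 0 <= D by rewrite /D /hi /lo; have /andP[] := yzb z; lra.
set c' := (2 * (3 / e)) `^ beta^-1.
have c'0 : 0 <= c' by exact: powR_ge0.
have q2 : 0 < (q / 2) `^ p by rewrite powR_gt0// divr_gt0.
set K1 := 2 / dphi + 2 * T * c' + 1.
have K10 : 0 <= K1 by rewrite !addr_ge0// ?mulr_ge0 ?(ltW T0) ?invr_ge0 ?(ltW d0).
set K2 := lip_const p C Lk (D + 1) * levels eps lo hi * (1 + C + Lk * D) / (q / 2) `^ p.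
have K20 : 0 <= K2.
  have D1 : 0 <= D + 1 by rewrite addr_ge0.
  have l0 : 0 <= lip_const p C Lk (D + 1) by exact: lip_const_ge0.
  have l1 : 0 <= levels eps lo hi by rewrite /levels.
  have l2 : 0 <= 1 + C + Lk * D by rewrite !addr_ge0// mulr_ge0.
  by rewrite /K2 divr_ge0 ?(ltW q2)// !mulr_ge0.
exists (K2 * K1); first by rewrite mulr_ge0.
move=> k t L vmin g1 g2 W H dd Delta kl kd L0 v0 fr G1 G2 g12 cW Wm H0 HW Wd.
have [tau [sigma [[tK sK] tm tE tc td]]] := Gamma_reparam T0 v0 G1 G2 g12.
have cg g : Gamma T L vmin g -> continuous g by case.
have cpg g : Gamma T L vmin g -> continuous (fun x => phi (g x)).
  by move=> /cg cgg x; apply: (@continuous_comp (time T) R R g phi); [exact: cgg|exact: cphi].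
have cadd (f f' : time T -> R) : continuous f -> continuous f' -> continuous (fun x => f x + f' x).
  by move=> cf cf' x; apply: (@continuousD R R (time T) f f'); [exact: cf|exact: cf'].
set h0 := fun x => phi (g1 x) + W x.
(* [h1] has the diagram of [h2], being [h2 \o tau], and is close to [h0]. *)
set h1 := fun x => phi (g1 x) + W (tau x).
set h2 := fun x => phi (g2 x) + W x.
have ch0 : continuous h0 by apply: cadd; [exact: cpg|].
have ch1 : continuous h1 by apply: cadd; [exact: cpg|exact: tc].
have ch2 : continuous h2 by apply: cadd; [exact: cpg|].
have -> : rho_bar F eps p k h2 t = rho_bar F eps p k h1 t.
  apply/esym; apply: (rho_bar_reparam F T0 _ _ _ _ ch2 ch1 tK sK tm) => x.
  by rewrite /h1 /h2 tE.
have bnd (g W' : time T -> R) : (forall x, `|W' x| <= m) -> forall x, lo <= phi (g x) + W' x <= hi.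
  move=> W'm x; have /andP[p1' p2'] := yzb (g x); have := W'm x.
  by rewrite ler_norml /lo /hi => /andP[w1 w2]; apply/andP; split; clear -F S T0 p1' p2' w1 w2; lra.
have nP : 1 <= (periods L)%:R :> R by rewrite ler1n /periods leq_max.
have n0 : 0 < (periods L)%:R :> R by exact: lt_le_trans nP.
have Ln : L <= 2 * (periods L)%:R.
  have h3 : L <= (Num.truncn L).+1%:R by apply/ltW/truncnS_gt.
  apply: le_trans h3 _; rewrite -natrM ler_nat /periods.
  exact: leq_succ_double_max.
have segE s x : segment_path h0 h1 s x = phi (g1 x) + ((1 - s) * W x + s * W (tau x)).
  by rewrite /segment_path /h0 /h1; ring.
set M := L / dphi + 2 * T * (3 * (H + 1) / e) `^ beta^-1 + 1.
have M_0 : 0 <= M.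
  by rewrite !addr_ge0// ?mulr_ge0 ?powR_ge0 ?(ltW T0) ?invr_ge0 ?(ltW d0) ?(ltW L0).
have ranks (s : R) : 0 <= s <= 1 -> forall b,
     (comp_rank (segment_path h0 h1 s) b (b + eps / 2 / 3))%:R <= M.
  move=> s01 b; rewrite (_ : segment_path h0 h1 s = fun x => phi (g1 x) + ((1 - s) * W x + s * W (tau x))).
    exact: (signal_rank_le T0 v0 b G1 tm H0 b0 ep d0 s01 dphiP HW).
  by apply/funext => x.
have dens (s : R) : 0 <= s <= 1 ->
    (q / 2) `^ p * (periods L)%:R <= total_weight F eps p (segment_path h0 h1 s).
  move=> s01; have cs := segment_path_continuous (s := s) ch0 ch1.
  (* Between these levels there is room for [eps], for the weight [q / 2] and for two margins
     [q / 8], since [phi z - phi y = 2 * m + eps + q]. *)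
  have tw := @total_weight_ge R F T T0 eps p e0 p1 _ (phi y + m) (phi z - m - q / 4) (q / 8) cs.
  have mE : 2 * m = phi z - phi y - eps - q by rewrite /m AE; clear -F S T0; lra.
  have tw1 : 0 < q / 8 by clear -F S T0 q0; lra.
  have tw2 : phi y + m + q / 8 + eps < phi z - m - q / 4 - q / 8 by clear -F S T0 q0 mE; lra.
  have := tw tw1 tw2.
  have -> : phi z - m - q / 4 - (phi y + m) - 2 * (q / 8) - eps = q / 2.
    by clear -F S T0 mE; lra.
  apply: le_trans; rewrite ler_wpM2l ?powR_ge0// ler_nat.
  apply: (signal_rank_ge T0 per L0 (m := m) G1 y01 yz fr); last exact: continuous_bounded_rank.
  - move=> u; rewrite segE addrAC subrr add0r.
    have := Wm u; have := Wm (tau u); rewrite !ler_norml; move/andP: s01 => [s0 s1].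
    move=> /andP[a1 a2] /andP[a3 a4]; clear -F S T0 a1 a2 a3 a4 s0 s1.
    by apply/andP; split; nra.
  - by [].
  - by clear -F S T0 q0; lra.
  - by clear -F S T0 q0 mE e0; lra.
have D00 : 0 < (q / 2) `^ p * (periods L)%:R by rewrite mulr_gt0.
have close x : `|h1 x - h0 x| <= Delta.
  by rewrite /h1 /h0 opprD addrACA subrr add0r; apply: Wd; exact: td.
have Delta0 : 0 <= Delta by apply: le_trans (close (clip T0 0)).
have := weighted_mean_path T0 e0 p1 C0 Lk0 kl kd ch0 ch1
  (bnd g1 W Wm) (bnd g1 (W \o tau) (fun x => Wm (tau x))) D00 dens ranks close.
rewrite (@rho_barE R F T S T0 eps p k e0 p1 h0 t ch0) (@rho_barE R F T S T0 eps p k e0 p1 h1 t ch1) distrC.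
move=> /le_trans; apply; rewrite ler_wpM2r//.
(* The number of periods cancels in the quotient of bars by total weight. *)
have ME : M / (periods L)%:R <= K1 * (1 + H `^ beta^-1).
  rewrite ler_pdivrMr//; have a0 : 0 < 3 / e by rewrite divr_gt0.
  have := powR_affine_le a0 H0 (th := beta^-1); rewrite invr_gt0 => /(_ b0).
  rewrite (_ : 3 / e * (H + 1) = 3 * (H + 1) / e) -/c'; last by ring.
  move=> cH; set G := 1 + H `^ beta^-1 in cH *.
  have G1' : 1 <= G by rewrite /G lerDl powR_ge0.
  have nG : 1 <= G * (periods L)%:R by rewrite -[leLHS]mulr1 ler_pM.
  have t1 : L / dphi <= 2 / dphi * (G * (periods L)%:R).
    rewrite mulrAC ler_pM2r ?invr_gt0//; apply: le_trans Ln _.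
    by rewrite ler_wpM2l// ler_peMl// ltW.
  have t2 : 2 * T * (3 * (H + 1) / e) `^ beta^-1 <= 2 * T * c' * (G * (periods L)%:R).
    have TT : 0 <= 2 * T by rewrite mulr_ge0// ltW.
    rewrite -[leRHS]mulrA ler_wpM2l//; apply: le_trans cH _; rewrite mulrA ler_peMr//.
    by rewrite mulr_ge0// (le_trans ler01).
  have -> : K1 * G * (periods L)%:R = 2 / dphi * (G * (periods L)%:R) +
     2 * T * c' * (G * (periods L)%:R) + G * (periods L)%:R by rewrite /K1; ring.
  by rewrite /M lerD// lerD.
have -> : lip_const p C Lk (hi - lo + 1) * (levels eps lo hi * M) *
    (1 + C + Lk * (hi - lo)) / ((q / 2) `^ p * (periods L)%:R) = K2 * (M / (periods L)%:R).
  by rewrite /K2 /D; field; rewrite !gt_eqF.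
by rewrite -[leRHS]mulrA ler_wpM2l.
Qed.

End signal_stability.

(** * Hoelder continuity from dyadic increments *)

Section dyadic_chaining.
Context {R : realType} {T : R}.
Hypothesis T0 : 0 < T.
Implicit Types (W : time T -> R) (x y : time T).

Definition dyadic (n i : nat) : time T := clip T0 (T * (i%:R * 2^-1 ^+ n)).

Lemma half_pow_gt0 n : 0 < 2^-1 ^+ n :> R.
Proof. by rewrite exprn_gt0// invr_gt0. Qed.

Lemma half_pow_small (d : R) : 0 < d -> exists k, forall n, (k <= n)%N -> 2^-1 ^+ n * T < d.
Proof.
move=> d0; exists (Num.truncn (T / d)).+1 => n kn.
rewrite exprVn mulrC ltr_pdivrMr ?exprn_gt0// mulrC -ltr_pdivrMr//.
apply: lt_le_trans (truncnS_gt _) _; rewrite -natrX ler_nat.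
by apply: leq_trans kn _; apply/ltnW/ltn_expl.
Qed.

Lemma dyadic_double n i : dyadic n.+1 (2 * i) = dyadic n i.
Proof.
rewrite /dyadic exprS natrM; congr (clip _ (_ * _)).
by rewrite mulrCA !mulrA mulVf ?mul1r ?pnatr_eq0.
Qed.

Lemma val_dyadic n i : (i <= 2 ^ n)%N -> \val (dyadic n i) = T * (i%:R * 2^-1 ^+ n).
Proof.
move=> i2; rewrite val_clip// mulr_ge0 ?(ltW T0) ?mulr_ge0 ?(ltW (half_pow_gt0 _))//=.
rewrite -[leRHS]mulr1 ler_wpM2l ?(ltW T0)// exprVn ler_pdivrMr ?exprn_gt0// mul1r.
by rewrite -natrX ler_nat.
Qed.

Definition dyadic_floor n x : nat := Num.truncn (\val x / T * 2 ^+ n).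

Lemma dyadic_floor_itv n x :
  (dyadic_floor n x)%:R * 2^-1 ^+ n * T <= \val x < (dyadic_floor n x).+1%:R * 2^-1 ^+ n * T.
Proof.
have x0 : 0 <= \val x / T * 2 ^+ n.
  by rewrite mulr_ge0 ?divr_ge0 ?(ltW T0)//; have /andP[] := time_itv x.
have p2 : 0 < 2 ^+ n :> R by rewrite exprn_gt0.
have := truncn_itv x0; rewrite -/(dyadic_floor n x).
have E : \val x = (\val x / T * 2 ^+ n) * 2^-1 ^+ n * T.
  by rewrite exprVn; field; rewrite !gt_eqF.
rewrite [in X in _ -> X]E; set a := _ * 2 ^+ n.
have u0 := half_pow_gt0 n.
by rewrite ler_pM2r// ltr_pM2r// (ler_pM2r u0) (ltr_pM2r u0).
Qed.

Lemma dyadic_floor_le n x : (dyadic_floor n x <= 2 ^ n)%N.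
Proof.
have /andP[h _] := dyadic_floor_itv n x; have /andP[_ xT] := time_itv x.
have := le_trans h xT; rewrite -[leRHS]mul1r ler_pM2r// exprVn.
by rewrite ler_pdivrMr ?exprn_gt0// mul1r -natrX ler_nat.
Qed.

Lemma dyadic_floorS n x : exists b : bool, dyadic_floor n.+1 x = (2 * dyadic_floor n x + b)%N.
Proof.
have /andP[h1 h2] := dyadic_floor_itv n x; have /andP[h3 h4] := dyadic_floor_itv n.+1 x.
set i := dyadic_floor n x in h1 h2 *; set j := dyadic_floor n.+1 x in h3 h4 *.
have red (a : R) : a * 2^-1 ^+ n * T = (2 * a) * (2^-1 ^+ n.+1 * T).
  by rewrite exprS; field.
have uT : 0 < 2^-1 ^+ n.+1 * T by rewrite mulr_gt0// half_pow_gt0.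
have := le_lt_trans h3 h2; rewrite red -[X in X < _]mulrA ltr_pM2r// -natrM ltr_nat => j1.
have := le_lt_trans h1 h4; rewrite red -[X in _ < X]mulrA ltr_pM2r// -natrM ltr_nat => j2.
exists (2 * i < j)%N; lia.
Qed.

Definition dyadic_approx n x := dyadic n (dyadic_floor n x).

Lemma dyadic_approx_close n x : `|\val (dyadic_approx n x) - \val x| <= 2^-1 ^+ n * T.
Proof.
rewrite /dyadic_approx val_dyadic ?dyadic_floor_le// mulrC.
have /andP[h1 h2] := dyadic_floor_itv n x.
rewrite ler0_norm ?subr_le0// opprB lerBlDr (le_trans (ltW h2))//.
by rewrite -natr1 !mulrDl mul1r addrC.
Qed.

Variables (W : time T -> R) (b lam : R).
Hypotheses (cW : continuous W) (b0 : 0 <= b) (l0 : 0 < lam) (l1 : lam < 1)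
  (incr : forall n i, (i < 2 ^ n)%N -> `|W (dyadic n i.+1) - W (dyadic n i)| <= b * lam ^+ n).

Lemma dyadic_approx_step n x :
  `|W (dyadic_approx n.+1 x) - W (dyadic_approx n x)| <= b * lam ^+ n.+1.
Proof.
have [c cE] := dyadic_floorS n x; have le := dyadic_floor_le n.+1 x.
rewrite /dyadic_approx -[dyadic n _]dyadic_double cE in le *; case: c cE le => cE le.
  by rewrite addn1 in le *; exact: incr.
by rewrite addn0 subrr normr0 mulr_ge0// exprn_ge0// ltW.
Qed.

Lemma dyadic_approx_diff n k x :
  `|W (dyadic_approx (n + k) x) - W (dyadic_approx n x)| <= b * (lam ^+ n - lam ^+ (n + k)) / (1 - lam).
Proof.
have l0' := l0; have l1' := l1.
elim: k => [|k IH]; first by rewrite addn0 !subrr normr0 mulr0 mul0r.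
rewrite addnS; have h := dyadic_approx_step (n + k) x.
rewrite -(subrK (W (dyadic_approx (n + k) x)) (W (dyadic_approx (n + k).+1 x))) -addrA.
apply: le_trans (ler_normD _ _) _.
apply: le_trans (lerD h IH) _.
have -> : b * lam ^+ (n + k).+1 + b * (lam ^+ n - lam ^+ (n + k)) / (1 - lam) =
  b * (lam ^+ n - lam ^+ (n + k) * (1 - lam + lam ^+ 2)) / (1 - lam).
  by rewrite exprS; field; rewrite subr_eq0 gt_eqF.
rewrite ler_pM2r ?invr_gt0 ?subr_gt0// ler_wpM2l// lerB// exprS mulrC ler_wpM2l ?exprn_ge0 ?(ltW l0)//.
by rewrite expr2; nra.
Qed.

Lemma dyadic_approx_limit n x :
  `|W x - W (dyadic_approx n x)| <= b * lam ^+ n / (1 - lam).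
Proof.
have l0' := l0; have l1' := l1; have l1p : 0 < 1 - lam by rewrite subr_gt0.
apply/ler_addgt0Pr => e e0.
have [d d0 dP] := proj1 (time_continuousP T0 W) cW x e e0.
have [k kP] := half_pow_small d0; have kd := kP (n + k)%N (leq_addl n k).
have := dP (dyadic_approx (n + k) x) (le_lt_trans (dyadic_approx_close _ _) kd).
rewrite distrC => near; have diff := dyadic_approx_diff n k x.
rewrite -(subrK (W (dyadic_approx (n + k) x)) (W x)) -addrA.
apply: le_trans (ler_normD _ _) _; apply: le_trans (lerD (ltW near) diff) _.
rewrite addrC lerD2r ler_pM2r ?invr_gt0// ler_wpM2l// gerBl.
by rewrite exprn_ge0// ltW.
Qed.

(** The approximations of [x] and [y] at level [n] are equal or adjacent. *)
Lemma dyadic_near n x y : `|\val x - \val y| <= 2^-1 ^+ n * T ->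
  `|W x - W y| <= b * lam ^+ n * (1 + 2 / (1 - lam)).
Proof.
move=> xy; have l1p : 0 < 1 - lam by rewrite subr_gt0.
have bl : 0 <= b * lam ^+ n by rewrite mulr_ge0// exprn_ge0// ltW.
have main : `|W (dyadic_approx n x) - W (dyadic_approx n y)| <= b * lam ^+ n.
  wlog le : x y xy / (dyadic_floor n x <= dyadic_floor n y)%N.
    move=> H; case: (leqP (dyadic_floor n x) (dyadic_floor n y)) => [|/ltnW]; first exact: H.
    by rewrite distrC; apply: H; rewrite distrC.
  have /andP[h1 h2] := dyadic_floor_itv n x; have /andP[h3 h4] := dyadic_floor_itv n y.
  have le2 : (dyadic_floor n y <= (dyadic_floor n x).+1)%N.
    have : \val y <= \val x + 2^-1 ^+ n * T.
      by rewrite -lerBlDl; apply: le_trans (ler_norm _) _; rewrite distrC.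
    move=> /(le_trans h3)/le_lt_trans; move: h2; rewrite -(ltrD2r (2^-1 ^+ n * T)) => h2 /(_ _ h2).
    have -> : (dyadic_floor n x).+1%:R * 2^-1 ^+ n * T + 2^-1 ^+ n * T =
       (dyadic_floor n x).+2%:R * (2^-1 ^+ n * T) by rewrite -!natr1; ring.
    by rewrite -mulrA ltr_pM2r ?mulr_gt0 ?half_pow_gt0// ltr_nat ltnS.
  move: le; rewrite leq_eqVlt => /orP[/eqP E|lt]; first by rewrite /dyadic_approx E subrr normr0.
  have E : dyadic_floor n y = (dyadic_floor n x).+1 by apply/eqP; rewrite eqn_leq le2 lt.
  rewrite distrC /dyadic_approx E; apply: incr.
  by apply: leq_trans lt _; exact: dyadic_floor_le.
have hx := dyadic_approx_limit n x; have hy := dyadic_approx_limit n y.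
have -> : W x - W y = (W x - W (dyadic_approx n x)) +
  (W (dyadic_approx n x) - W (dyadic_approx n y)) - (W y - W (dyadic_approx n y)) by ring.
apply: le_trans (ler_normB _ _) _.
apply: le_trans (lerD (ler_normD _ _) (lexx _)) _.
have -> : b * lam ^+ n * (1 + 2 / (1 - lam)) =
  b * lam ^+ n / (1 - lam) + b * lam ^+ n + b * lam ^+ n / (1 - lam) by ring.
by rewrite !lerD.
Qed.

End dyadic_chaining.

Section hoelder_from_increments.
Context {R : realType} {T : R}.
Hypothesis T0 : 0 < T.

(** Kolmogorov's chaining argument: the path from a dyadic approximation of [x] to [x]
is a geometric series of dyadic increments. *)
Lemma hoelder_of_dyadic (beta : R) : 0 < beta ->
  exists2 cH : R, 0 <= cH & forall (W : time T -> R) (b : R), continuous W -> 0 <= b ->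
    (forall n i, (i < 2 ^ n)%N ->
       `|W (dyadic T0 n i.+1) - W (dyadic T0 n i)| <= b * (2^-1 `^ beta) ^+ n) ->
    forall x y, `|W x - W y| <= cH * b * `|\val x - \val y| `^ beta.
Proof.
move=> be0; set lam := 2^-1 `^ beta.
have l0 : 0 < lam by rewrite powR_gt0// invr_gt0.
have l1 : lam < 1.
  by rewrite -[ltRHS](congr1 (fun f => f beta) (@powR1 R)) gt0_ltr_powR// ?nnegrE ?invr_ge0// invf_lt1 ?ltr1n.
have l1p : 0 < 1 - lam by rewrite subr_gt0.
have T2 : 0 < (2 / T) `^ beta by rewrite powR_gt0// divr_gt0.
exists ((1 + 2 / (1 - lam)) * (2 / T) `^ beta).
  by rewrite mulr_ge0 ?(ltW T2)// addr_ge0// divr_ge0// ltW.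
move=> W b cW b0 incr x y; set d := `|\val x - \val y|.
have [d0|dn0] := eqVneq d 0.
  have -> : x = y by apply/val_inj/eqP; rewrite -subr_eq0 -normr_eq0; apply/eqP.
  have l2 : 0 <= 2 / (1 - lam) by rewrite divr_ge0 ?(ltW l1p).
  rewrite subrr normr0 mulr_ge0 ?powR_ge0// mulr_ge0// mulr_ge0 ?powR_ge0//.
  by rewrite addr_ge0.
have dp : 0 < d by rewrite lt_neqAle eq_sym dn0 normr_ge0.
have dT : d <= T.
  by have := time_itv x; have := time_itv y; rewrite /d ler_norml; lra.
have exn : exists n, 2^-1 ^+ n.+1 * T < d.
  by have [k kP] := half_pow_small (T := T) dp; exists k; apply: kP; exact: leqnSn.
have [n nd nmin] := ex_minnP exn.
have nT : d <= 2^-1 ^+ n * T.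
  case: n nd nmin => [|n] nd nmin; first by rewrite expr0 mul1r.
  by rewrite leNgt; apply/negP => /nmin; rewrite ltnn.
apply: le_trans (dyadic_near cW b0 l0 l1 incr nT) _.
have -> : (1 + 2 / (1 - lam)) * (2 / T) `^ beta * b * d `^ beta =
  b * ((2 / T) `^ beta * d `^ beta) * (1 + 2 / (1 - lam)) by ring.
have l2 : 0 <= 1 + 2 / (1 - lam) by rewrite addr_ge0// divr_ge0// ltW.
rewrite ler_wpM2r// ler_wpM2l//.
rewrite /lam -powR_mulrn ?powR_ge0// -powRrM mulrC powRrM powR_mulrn ?invr_ge0//.
rewrite -powRM ?divr_ge0 ?(ltW T0) ?(ltW dp)//.
apply: ge0_ler_powR; rewrite ?nnegrE ?(ltW be0) ?exprn_ge0 ?mulr_ge0 ?invr_ge0 ?(ltW T0) ?(ltW dp)//.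
move: nd; rewrite exprS => nd; rewrite mulrAC ler_pdivlMr//.
have -> : 2^-1 ^+ n * T = 2 * (2^-1 * 2^-1 ^+ n * T) by rewrite !mulrA divff ?mul1r.
by rewrite ler_wpM2l// ltW.
Qed.

End hoelder_from_increments.

(** * Measurability and integration *)

Section powers_of_random_variables.
Context {R : realType} d (Omega : measurableType d) (P : probability Omega R).

(** Jensen's inequality for concave powers, by integrating the tangent at the
bound of the mean. *)
Lemma expectation_powR_le (X : Omega -> R) (th m : R) : measurable_fun setT X ->
  (forall w, 0 <= X w) -> 0 < th -> th <= 1 -> 0 <= m ->
  (\int[P]_w (X w)%:E <= m%:E)%E -> (\int[P]_w (X w `^ th)%:E <= (m `^ th)%:E)%E.
Proof.
move=> mX X0 th0 th1 m0 Xm.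
have step lam : 0 < lam -> (\int[P]_w (X w `^ th)%:E <=
    ((1 - th) * lam `^ th + th * lam `^ (th - 1) * m)%:E)%E.
  move=> l0; set a := (1 - th) * lam `^ th; set c := th * lam `^ (th - 1).
  have a0 : 0 <= a by rewrite mulr_ge0 ?powR_ge0// subr_ge0.
  have c0 : 0 <= c by rewrite mulr_ge0 ?powR_ge0// ltW.
  have mcX : measurable_fun setT (fun w => c%:E * (X w)%:E)%E.
    by apply/measurable_EFinP; apply: measurable_funM => //; exact: measurable_cst.
  have mL : measurable_fun setT (fun w => a%:E + c%:E * (X w)%:E)%E.
    apply/measurable_EFinP; apply: measurable_funD; first exact: measurable_cst.
    by apply: measurable_funM => //; exact: measurable_cst.
  apply: (@le_trans _ _ (\int[P]_w (a%:E + c%:E * (X w)%:E))%E).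
    apply: ge0_le_integral => //.
    - by move=> w _; rewrite lee_fin powR_ge0.
    - by apply/measurable_EFinP; apply: (measurableT_comp (measurable_powR _)).
    - by move=> w _; rewrite -EFinM -EFinD lee_fin powR_scaled_tangent.
  rewrite ge0_integralD//; last by move=> w _; rewrite mule_ge0 ?lee_fin.
  rewrite integral_cst//= probability_setT mule1 ge0_integralZl//; [|by apply/measurable_EFinP|by move=> w _; rewrite lee_fin].
  by rewrite EFinD leeD2l// [(c * m)%:E]EFinM lee_wpmul2l// lee_fin.
move: m0; rewrite le_eqVlt => /orP[/eqP m0|m0]; last first.
  apply: le_trans (step m m0) _; rewrite lee_fin -mulrA.
  by rewrite (mulrC (m `^ _)) mulr_powRB1 ?(ltW m0)// -mulrDl subrK mul1r.
rewrite -m0 powR0 ?gt_eqF//.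
apply/lee_addgt0Pr => e e0; rewrite add0e.
have e1 : 0 < e `^ th^-1 by exact: powR_gt0.
apply: le_trans (step _ e1) _; rewrite -m0 mulr0 addr0 lee_fin.
rewrite -powRrM mulVf ?gt_eqF// powRr1 ?(ltW e0)// ler_piMl ?(ltW e0)//.
by rewrite gerBl ltW.
Qed.

End powers_of_random_variables.

Section measurable_functionals.
Context {R : realType} {T : R}.
Hypothesis T0 : 0 < T.

(** Continuous functionals are measurable functions of the coordinates of a continuous
process: the space of paths is separable, with countably many cells given by
a modulus of continuity and by rounded values on a dyadic grid. *)
Lemma measurable_functional d (Omega : measurableType d) (Z : Omega -> time T -> R)
    (Psi : (time T -> R) -> R) :
  (forall u, measurable_fun setT (fun w => Z w u)) -> (forall w, continuous (Z w)) ->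
  (forall h e, continuous h -> 0 < e -> exists2 dl, 0 < dl & forall h', continuous h' ->
     (forall z, `|h z - h' z| <= dl) -> `|Psi h' - Psi h| < e) ->
  measurable_fun setT (fun w => Psi (Z w)).
Proof.
move=> mZ cZ cPsi.
(* A cell consists of the paths that vary by at most [1 / N] over times [T / 2 ^ m] and that
   have given values, rounded to multiples of [1 / N], on the grid of level [m]. *)
pose code (N m : nat) (h : time T -> R) : seq int :=
  [seq Num.floor (h (dyadic T0 m i) * N%:R) | i <- iota 0 (2 ^ m).+1].
pose cell (k : nat * nat * seq int) (h : time T -> R) := [/\ continuous h,
  forall x y, `|\val x - \val y| <= 2^-1 ^+ k.1.2 * T -> `|h x - h y| <= k.1.1%:R^-1 &
  code k.1.1 k.1.2 h = k.2].
have [rep repP] : exists rep : nat * nat * seq int -> time T -> R,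
    forall k, (exists h, cell k h) -> cell k (rep k).
  suff /choice[f fP] : forall k, exists h, (exists h, cell k h) -> cell k h by exists f.
  by move=> k; have [[h ch]|nh] := pselect (exists h, cell k h); [exists h|exists (fun=> 0)].
have cell_close k h h' : (0 < k.1.1)%N -> cell k h -> cell k h' ->
    forall x, `|h x - h' x| <= 3 / k.1.1%:R.
  case: k => [[N m] s]; rewrite /cell /= => N0 [ch hm hc] [ch' hm' hc'] x.
  have N0' : 0 < N%:R :> R by rewrite ltr0n.
  set u := dyadic_approx T0 m x.
  have ux : `|\val x - \val u| <= 2^-1 ^+ m * T by rewrite distrC; exact: dyadic_approx_close.
  have : Num.floor (h u * N%:R) = Num.floor (h' u * N%:R).
    have := hc; rewrite -hc' => /(congr1 (fun s => nth 0 s (dyadic_floor m x))).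
    have iL : (dyadic_floor m x < (2 ^ m).+1)%N by rewrite ltnS (dyadic_floor_le T0).
    by rewrite !(nth_map 0%N) ?size_iota// nth_iota// add0n.
  have /andP[a1 a2] := floor_itv (h u * N%:R); have /andP[a3 a4] := floor_itv (h' u * N%:R).
  rewrite !intrD in a2 a4; move=> fE; rewrite -fE in a3 a4.
  have hu : `|h u - h' u| <= N%:R^-1.
    rewrite -(ler_pM2r N0') mulVf ?gt_eqF// -{1}(gtr0_norm N0') -normrM mulrBl ler_norml.
    by apply/andP; split; clear -T0 a1 a2 a3 a4; lra.
  have h1 := hm x u ux; have h2 := hm' x u ux.
  have -> : h x - h' x = (h x - h u) + (h u - h' u) - (h' x - h' u) by ring.
  apply: le_trans (ler_normB _ _) _; apply: le_trans (lerD (ler_normD _ _) (lexx _)) _.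
  have -> : 3 / N%:R = N%:R^-1 + N%:R^-1 + N%:R^-1 :> R by ring.
  by rewrite !lerD.
apply: (measurability _ (RGenOInfty.measurableE R)) => //.
move=> _ [_ [a ->] <-]; rewrite setTI.
pose good k := [/\ (0 < k.1.1)%N, exists h, cell k h &
  forall h', continuous h' -> (forall z, `|rep k z - h' z| <= 3 / k.1.1%:R) -> a < Psi h'].
(* Closeness to the representative on the dyadic points is a measurable condition, and
   extends to all times by continuity. *)
pose B k : set Omega := if `[< good k >] then
  \bigcap_m \bigcap_i [set w | `|rep k (dyadic T0 m i) - Z w (dyadic T0 m i)| <= 3 / k.1.1%:R]
  else set0.
have -> : (fun w => Psi (Z w)) @^-1` `]a, +oo[%classic = \bigcup_k B k.
  apply/seteqP; split=> w /=.
    rewrite in_itv/= andbT => aw.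
    have [dl dl0 dlP] := cPsi (Z w) (Psi (Z w) - a) (cZ w) ltac:(by rewrite subr_gt0).
    set N := (Num.truncn (6 / dl)).+1.
    have N0 : 0 < N%:R :> R by rewrite ltr0n.
    have Ndl : 6 / N%:R <= dl.
      rewrite ler_pdivrMr// mulrC -ler_pdivrMr//; apply/ltW; exact: truncnS_gt.
    have iN : 0 < N%:R^-1 :> R by rewrite invr_gt0.
    have [d' d'0 d'P] := time_uniform_continuous T0 (cZ w) iN.
    have [m mP] := half_pow_small (T := T) d'0; have md := mP m (leqnn m).
    pose k := (N, m, code N m (Z w)).
    have ck : cell k (Z w).
      split=> [|x y xy|//]; first exact: cZ.
      by rewrite distrC; apply/ltW/d'P; apply: le_lt_trans md; rewrite distrC.
    have cr : cell k (rep k) by apply: repP; exists (Z w).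
    exists k => //; rewrite /B ifT; last first.
      apply/asboolP; split=> //; first by exists (Z w).
      move=> h' ch' h'rep; have : `|Psi h' - Psi (Z w)| < Psi (Z w) - a.
        apply: dlP => // z; apply: le_trans Ndl.
        have -> : Z w z - h' z = (Z w z - rep k z) + (rep k z - h' z) by ring.
        apply: le_trans (ler_normD _ _) _.
        have -> : 6 / N%:R = 3 / N%:R + 3 / N%:R :> R by ring.
        by rewrite lerD//; exact: (@cell_close k).
      by rewrite ltr_norml => /andP[? _]; rewrite -subr_gt0 -(ltrD2l (- (Psi (Z w)))); lra.
    by move=> m' _ i _ /=; apply: (@cell_close k).
  move=> [k _]; rewrite /B; case: asboolP => // -[k0 ek kP] wB.
  rewrite in_itv/= andbT; apply: kP => // z; apply/ler_addgt0Pr => e e0.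
  have [crep _ _] := repP k ek.
  have e20 : 0 < e / 2 by rewrite divr_gt0.
  have [d1 d10 d1P] := proj1 (time_continuousP T0 _) crep z _ e20.
  have [d2 d20 d2P] := proj1 (time_continuousP T0 _) (cZ w) z _ e20.
  have d120 : 0 < Num.min d1 d2 by rewrite lt_min d10.
  have [m mP] := half_pow_small (T := T) d120; have md := mP m (leqnn m).
  move: md; rewrite lt_min => /andP[md1 md2].
  have uz := dyadic_approx_close T0 m z; set u := dyadic_approx T0 m z in uz.
  have r1 := d1P u (le_lt_trans uz md1); have r2 := d2P u (le_lt_trans uz md2).
  have r3 : `|rep k u - Z w u| <= 3 / k.1.1%:R by exact: (wB m I (dyadic_floor m z) I).
  have -> : rep k z - Z w z = (rep k u - Z w u) + ((Z w u - Z w z) - (rep k u - rep k z)) by ring.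
  apply: le_trans (ler_normD _ _) _; rewrite lerD//.
  apply: le_trans (ler_normB _ _) _; rewrite [leRHS]splitr lerD// ltW//.
apply: countable_bigcupT_measurable; first exact: countableP.
move=> k; rewrite /B; case: ifP => _ //.
apply: bigcapT_measurable => m; apply: bigcapT_measurable => i.
rewrite (_ : mkset _ = (fun w => `|rep k (dyadic T0 m i) - Z w (dyadic T0 m i)|) @^-1` `]-oo, 3 / k.1.1%:R]); last first.
  by apply/seteqP; split=> w /=; rewrite in_itv.
rewrite -[_ @^-1` _]setTI; have mf : measurable_fun setT (fun w => `|rep k (dyadic T0 m i) - Z w (dyadic T0 m i)|).
  apply: measurableT_comp => //; apply: measurable_funB; first exact: measurable_cst.
  exact: mZ.
by apply: mf => //; exact: measurable_itv.
Qed.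

End measurable_functionals.

Section image_measures.
Context {R : realType}.

Lemma bounded_integrable d (X : measurableType d) (m : {measure set X -> \bar R})
    (f : X -> R) (b : R) : (m setT < +oo)%E -> measurable_fun setT f ->
  (forall x, `|f x| <= b) -> m.-integrable setT (EFin \o f).
Proof.
move=> m1 mf fb; apply: measurable_bounded_integrable => //.
exists b; split; first exact: num_real.
by move=> c bc x _ /=; apply: le_trans (fb x) (ltW bc).
Qed.

Lemma integral_image d1 d2 (X : measurableType d1) (Y : measurableType d2)
    (m1 : probability X R) (m2 : {measure set Y -> \bar R}) (s : X -> Y) (f : Y -> R) (b : R) :
  measurable_fun setT s -> (forall A, measurable A -> m1 (s @^-1` A) = m2 A) ->
  measurable_fun setT f -> (forall y, `|f y| <= b) ->
  (\int[m2]_y (f y)%:E = \int[m1]_x (f (s x))%:E)%E.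
Proof.
move=> ms m12 mf fb; pose S : {RV m1 >-> Y} := mfun_Sub (mem_set ms).
rewrite -(@eq_measure_integral _ _ _ _ m2 (distribution m1 S)); last first.
  by move=> A mA _; rewrite /distribution /pushforward; exact: m12.
rewrite integral_distribution//; first exact/measurable_EFinP.
apply: (bounded_integrable (b := b)).
- by rewrite -ge0_fin_numE// fin_num_measure.
- exact: measurableT_comp.
- by move=> x; exact: fb.
Qed.

(** The joint law of independent variables is the product of their laws, as it is so on
rectangles; the rest is Fubini's theorem. *)
Lemma independent_integral d d1 d2 (Omega : measurableType d) (P : probability Omega R)
    (G : measurableType d1) (H : measurableType d2) (X : Omega -> G) (Y : Omega -> H)
    (mu : probability G R) (f : G * H -> R) (b : R) :
  measurable_fun setT X -> measurable_fun setT Y ->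
  (forall A, measurable A -> P (X @^-1` A) = mu A) ->
  (forall A B, measurable A -> measurable B ->
     P (X @^-1` A `&` Y @^-1` B) = (P (X @^-1` A) * P (Y @^-1` B))%E) ->
  measurable_fun setT f -> (forall z, `|f z| <= b) ->
  (\int[P]_w (f (X w, Y w))%:E = \int[mu]_x (\int[P]_w (f (x, Y w))%:E))%E /\
  measurable_fun setT (fun x => \int[P]_w (f (x, Y w))%:E)%E.
Proof.
move=> mX mY muX ind mf fb.
pose Yv : {RV P >-> H} := mfun_Sub (mem_set mY).
pose nu := distribution P Yv.
have mXY : measurable_fun setT (fun w => (X w, Y w)) by exact/measurable_fun_pairP.
pose XY : {RV P >-> (G * H)%type} := mfun_Sub (mem_set mXY).
have prodE A : measurable A -> (mu \x nu)%E A = distribution P XY A.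
  apply: product_measure_unique => B C mB mC.
  transitivity (P (X @^-1` B) * P (Y @^-1` C))%E; first exact: ind.
  by rewrite (muX B mB).
have -> : (\int[P]_w (f (X w, Y w))%:E = \int[mu \x nu]_z (f z)%:E)%E.
  rewrite (integral_image (m1 := P) (s := fun w => (X w, Y w)) (b := b))//.
  by move=> A mA; apply/esym; exact: prodE.
have intf : (mu \x nu)%E.-integrable setT (EFin \o f).
  apply: (bounded_integrable (b := b)) => //.
  have := prodE setT measurableT; rewrite /= => ->.
  by rewrite -ge0_fin_numE// fin_num_measure.
have FE : fubini_F nu (EFin \o f) = (fun x => \int[P]_w (f (x, Y w))%:E)%E.
  apply/funext => x; rewrite /fubini_F/=.
  rewrite (integral_image (m1 := P) (s := Y) (f := fun y => f (x, y)) (b := b))//.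
  by apply: measurableT_comp => //; exact: pair1_measurable.
split; first by rewrite -(integral12_prod_meas1 intf) FE.
by rewrite -FE; exact: (measurable_fubini_F intf).
Qed.

End image_measures.

(** * The moment condition on the noise *)

Section noise.
Context {R : realType} {T : R}.
Hypothesis T0 : 0 < T.

Lemma half_powR_expr (c : R) n : (2^-1 ^+ n) `^ c = (2^-1 `^ c) ^+ n :> R.
Proof.
by rewrite -(powR_mulrn n (powR_ge0 _ c)) -powRrM mulrC powRrM powR_mulrn ?invr_ge0.
Qed.

(** Kolmogorov's moment condition. The random variable [X] sums the [r2]-th powers of
all dyadic increments, with weights that leave its mean finite because
[rho < r1]. *)
Lemma dyadic_variation (r1 r2 rho : R) : 0 < r2 -> 0 < rho -> rho < r1 ->
  exists2 c : R, 0 <= c & forall d (Omega : measurableType d) (P : probability Omega R)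
    (W : time T -> Omega -> R) (K : R), 0 <= K -> (forall t, measurable_fun setT (W t)) ->
    (forall s t, (\int[P]_w (`|W t w - W s w| `^ r2)%:E <=
       (K * `|\val t - \val s| `^ (1 + r1))%:E)%E) ->
    exists X : Omega -> R, [/\ measurable_fun setT X, forall w, 0 <= X w,
      (\int[P]_w (X w)%:E <= (c * K)%:E)%E &
      {ae P, forall w, forall n i, (i < 2 ^ n)%N ->
        `|W (dyadic T0 n i.+1) w - W (dyadic T0 n i) w| <=
          X w `^ r2^-1 * (2^-1 `^ (rho / r2)) ^+ n}].
Proof.
move=> r20 rho0 rho1; set kap := 2^-1 `^ (r1 - rho).
have i2 : 0 < 2^-1 :> R by rewrite invr_gt0.
have k0 : 0 < kap by exact: powR_gt0.
have k1 : kap < 1.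
  rewrite /kap -[ltRHS](congr1 (fun f => f (r1 - rho)) (@powR1 R)).
  by rewrite gt0_ltr_powR ?subr_gt0// ?nnegrE ?invr_ge0// invf_lt1 ?ltr1n.
have k1p : 0 < 1 - kap by rewrite subr_gt0.
exists (T `^ (1 + r1) / (1 - kap)); first by rewrite divr_ge0 ?powR_ge0 ?ltW.
move=> d Omega P W K K0 mW moment.
pose incr n i w := `|W (dyadic T0 n i.+1) w - W (dyadic T0 n i) w| `^ r2.
(* The weight [lam ^- n] makes the single increments of level [n] of order
   [lam ^+ n]; the means of the [B n] still decrease geometrically, like [kap ^+ n]. *)
pose lam := 2^-1 `^ rho; have l0 : 0 < lam by exact: powR_gt0.
pose B n w := lam ^- n * \sum_(i < 2 ^ n) incr n i w.
have m_incr n i : measurable_fun setT (incr n i).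
  apply: (measurableT_comp (measurable_powR _)); apply: measurableT_comp => //.
  exact: measurable_funB.
have incr0 n i w : 0 <= incr n i w by exact: powR_ge0.
have B0 n w : 0 <= B n w by rewrite mulr_ge0 ?invr_ge0 ?exprn_ge0 ?(ltW l0)// sumr_ge0.
have mB n : measurable_fun setT (B n).
  by apply: measurable_funM; [exact: measurable_cst|apply: measurable_sum => i; exact: m_incr].
have eB0 n w : (0 <= (B n w)%:E)%E by rewrite lee_fin.
have emB n : measurable_fun setT (fun w => (B n w)%:E) by apply/measurable_EFinP.
have intB n : (\int[P]_w (B n w)%:E <= (K * T `^ (1 + r1) * kap ^+ n)%:E)%E.
  rewrite (_ : (fun w => (B n w)%:E) = (fun w => (lam ^- n)%:E * \sum_(i < 2 ^ n) (incr n i w)%:E)%E); last first.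
    by apply/funext => w; rewrite sumEFin -EFinM.
  have mi i : measurable_fun setT (fun w => (incr n i w)%:E) by apply/measurable_EFinP.
  rewrite ge0_integralZl//; last 3 first.
  - by apply: emeasurable_sum => i; exact: mi.
  - by move=> w _; apply: sume_ge0 => i _; rewrite lee_fin.
  - by rewrite lee_fin invr_ge0 exprn_ge0// ltW.
  rewrite ge0_integral_sum//; last by move=> i w _; rewrite lee_fin.
  apply: (@le_trans _ _ ((lam ^- n)%:E * \sum_(i < 2 ^ n) (K * (T * 2^-1 ^+ n) `^ (1 + r1))%:E)%E).
    rewrite lee_wpmul2l//; first by rewrite lee_fin invr_ge0 exprn_ge0// ltW.
    apply: lee_sum => i _; apply: le_trans (moment _ _) _.
    rewrite !val_dyadic ?ltn_ord ?(ltnW (ltn_ord _))// -mulrBr -mulrBl -natr1 addrAC subrr add0r mul1r.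
    by rewrite ger0_norm// mulr_ge0 ?(ltW T0)// exprn_ge0// ltW.
  rewrite sumEFin -EFinM lee_fin sumr_const card_ord -[_ *+ _]mulr_natr.
  rewrite powRM ?(ltW T0) ?exprn_ge0 ?(ltW i2)//.
  rewrite half_powR_expr natrX.
  have -> : 2^-1 `^ (1 + r1) = 2^-1 * (lam * kap) :> R.
    have nz : 2^-1 != 0 :> R by rewrite gt_eqF.
    rewrite (@powRD _ 2^-1 1 r1) ?nz ?implybT// powRr1 ?(ltW i2)//; congr (_ * _).
    by rewrite /lam /kap -powRD ?nz ?implybT// addrC subrK.
  rewrite !exprMn exprVn; set a := T `^ _; set l := lam ^+ n; set q := kap ^+ n.
  have ln : l != 0 by rewrite gt_eqF// exprn_gt0.
  have p2 : 2 ^+ n != 0 :> R by rewrite expf_neq0// pnatr_eq0.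
  set t2 := 2 ^+ n in p2 *.
  by rewrite le_eqVlt; apply/orP; left; apply/eqP; field; rewrite ln p2.
pose Tot w := (\sum_(0 <= n <oo) (B n w)%:E)%E.
have Tot0 w : (0 <= Tot w)%E by apply: nneseries_ge0 => n _ _.
have mTot : measurable_fun setT Tot by apply: (ge0_emeasurable_sum (P := xpredT)).
have intTot : (\int[P]_w Tot w <= (T `^ (1 + r1) / (1 - kap) * K)%:E)%E.
  rewrite /Tot integral_nneseries//.
  have intB0 n : (0 <= \int[P]_w (B n w)%:E)%E by apply: integral_ge0.
  apply: lime_le; first by apply: is_cvg_nneseries => n _ _.
  apply: nearW => n; apply: le_trans (lee_sum _ (fun i _ => intB i)) _.
  rewrite sumEFin lee_fin -mulr_sumr.
  have -> : T `^ (1 + r1) / (1 - kap) * K = K * T `^ (1 + r1) * (1 - kap)^-1 by ring.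
  rewrite ler_wpM2l ?mulr_ge0 ?powR_ge0//.
  have : (1 - kap) * \sum_(0 <= i < n) kap ^+ i <= 1.
    have -> : (1 - kap) * \sum_(0 <= i < n) kap ^+ i = 1 - kap ^+ n.
      by rewrite big_mkord -[RHS]opprB subrX1; ring.
    by rewrite gerBl exprn_ge0// ltW.
  by rewrite mulrC -ler_pdivlMr// mul1r.
exists (fun w => fine (Tot w)); split.
- exact: (measurableT_comp (fine_measurable _)).
- by move=> w; rewrite fine_ge0.
- apply: le_trans intTot; apply: ge0_le_integral => //.
  + by move=> w _; rewrite lee_fin fine_ge0.
  + by apply/measurable_EFinP; apply: (measurableT_comp (fine_measurable _)).
  + move=> w _; have := Tot0 w; case: (Tot w) => [r _|_|] /=; [exact: lexx|exact: leey|by rewrite leeNy_eq].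
have intgTot : P.-integrable setT Tot.
  apply/integrableP; split=> //; under eq_integral do rewrite gee0_abs//.
  by apply: le_lt_trans intTot _; rewrite ltry.
have := integrable_ae measurableT intgTot.
apply: filterS => w /(_ I) fin n i i2n.
have Bn : B n w <= fine (Tot w).
  rewrite -lee_fin fineK//; apply: le_trans (nneseries_lim_ge n.+1 _); last by move=> ? _ _.
  by rewrite big_nat_recr//= leeDr// sume_ge0.
have inB : incr n i w <= lam ^+ n * fine (Tot w).
  rewrite mulrC -ler_pdivrMr ?exprn_gt0// mulrC; apply: le_trans Bn.
  rewrite ler_wpM2l ?invr_ge0 ?exprn_ge0 ?(ltW l0)//.
  by rewrite (bigD1 (Ordinal i2n))//= lerDl sumr_ge0.
have := ge0_ler_powR (r := r2^-1) _ _ _ inB.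
rewrite invr_ge0 (ltW r20) !nnegrE incr0 mulr_ge0 ?exprn_ge0 ?(ltW l0) ?fine_ge0// => /(_ isT isT isT).
rewrite /incr -powRrM divff ?gt_eqF// powRr1// => /le_trans; apply.
rewrite powRM ?exprn_ge0 ?(ltW l0) ?fine_ge0// mulrC -half_powR_expr /lam -half_powR_expr -powRrM.
exact: lexx.
Qed.

End noise.

(** * Measurability of the weighted mean *)

Section measurability_of_rho.
Context {R : realType} (F : fieldType) {T : R} (S : Type).
Hypothesis T0 : 0 < T.
Variables (eps p C Lk : R) (k : R * R -> S -> R) (t : S).
Hypotheses (eps0 : 0 < eps) (p1 : 1 <= p) (C0 : 0 <= C) (Lk0 : 0 <= Lk)
  (k_lip : forall x y, `|k x t - k y t| <= Lk * `|x - y|)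
  (k_diag : forall b, `|k (b, b) t| <= C).
Implicit Types h : time T -> R.

Local Notation kk := (fun x => k x t).

Lemma functionals_continuous h e : continuous h -> 0 < e ->
  exists2 dl : R, 0 < dl & forall h', continuous h' -> (forall z, `|h z - h' z| <= dl) ->
    `|total_weight F eps p h' - total_weight F eps p h| < e /\
    `|weighted_kernel F eps p kk h' - weighted_kernel F eps p kk h| < e.
Proof.
move=> ch e0; have [a [b hab]] := time_extrema T0 ch.
have e60 : 0 < eps / 2 / 3 by rewrite !divr_gt0.
have [N NP] := uniformly_bounded_rank T0 ch e60.
have NM s : (comp_rank h s (s + eps / 2 / 3))%:R <= N%:R :> R.
  have bN := NP s _ (lexx _); have [[u iu <-] _] := comp_rankP bN.
  by rewrite ler_nat bN.
have [d0 d00 dP] := functionals_local_lipschitz F T0 eps0 p1 C0 Lk0 k_lip k_diag ch hab NM.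
set B := lip_const p C Lk (h b - h a + 1) * (levels eps (h a) (h b) * N%:R) in dP.
have hh : h a <= h b by have /andP[] := hab a.
have B0 : 0 <= B.
  have l0 : 0 <= lip_const p C Lk (h b - h a + 1).
    by apply: lip_const_ge0 => //; rewrite addr_ge0// subr_ge0.
  by rewrite /B mulr_ge0// mulr_ge0// /levels.
set dl := Num.min (d0 / 2) (e / 2 / (B + 1)).
have B1 : 0 < B + 1 by rewrite ltr_wpDl.
have dl0 : 0 < dl by rewrite lt_min !divr_gt0.
exists dl => // h' ch' hh'.
have dld0 : dl < d0 by rewrite gt_min; apply/orP; left; rewrite ltr_pdivrMr// mulr_natr mulr2n ltrDl.
have [h1 h2] := dP h' dl ch' (ltW dl0) dld0 hh'.
have lt : lip_const p C Lk (h b - h a + 1) * dl * (levels eps (h a) (h b) * N%:R) < e.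
  have -> : lip_const p C Lk (h b - h a + 1) * dl * (levels eps (h a) (h b) * N%:R) = dl * B.
    by rewrite /B; ring.
  apply: (@le_lt_trans _ _ (e / 2)); last by rewrite ltr_pdivrMr// mulr_natr mulr2n ltrDl.
  have : dl <= e / 2 / (B + 1) by rewrite ge_min lexx orbT.
  rewrite ler_pdivlMr//; apply: le_trans; rewrite ler_wpM2l ?(ltW dl0)//.
  by rewrite lerDl.
by split; apply: le_lt_trans lt.
Qed.

Lemma rho_bar_bound h lo hi : continuous h -> (forall z, lo <= h z <= hi) ->
  `|rho_bar F eps p k h t| <= C + Lk * (hi - lo).
Proof.
move=> ch hb; rewrite (@rho_barE R F T S T0 eps p k eps0 p1 h t ch).
have le := weighted_kernel_le F T0 eps0 p1 Lk0 k_lip k_diag ch hb.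
have t0 := total_weight_ge0 F T0 eps0 p1 ch.
have lohi : lo <= hi by have /andP[/le_trans] := hb (clip T0 0); apply.
have c0 : 0 <= C + Lk * (hi - lo) by rewrite addr_ge0// mulr_ge0// subr_ge0.
move: t0; rewrite le_eqVlt => /orP[/eqP <-|t0]; first by rewrite invr0 mulr0 normr0.
by rewrite normrM normfV (gtr0_norm t0) ler_pdivrMr.
Qed.

Lemma measurable_rho_bar d (Omega : measurableType d) (Z : Omega -> time T -> R) :
  (forall u, measurable_fun setT (fun w => Z w u)) -> (forall w, continuous (Z w)) ->
  measurable_fun setT (fun w => rho_bar F eps p k (Z w) t).
Proof.
move=> mZ cZ.
have -> : (fun w => rho_bar F eps p k (Z w) t) =
    (fun w => weighted_kernel F eps p kk (Z w)) \* (fun w => total_weight F eps p (Z w) `^ (-1)).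
  apply/funext => w; rewrite (@rho_barE R F T S T0 eps p k eps0 p1 (Z w) t (cZ w))/=.
  by rewrite powR_inv1// (total_weight_ge0 F T0 eps0 p1 (cZ w)).
apply: measurable_funM.
  apply: (measurable_functional T0 mZ cZ) => h e ch e0.
  have [dl dl0 dP] := functionals_continuous ch e0.
  by exists dl => // h' ch' hh'; have [] := dP h' ch' hh'.
apply: (measurableT_comp (measurable_powR _)).
apply: (measurable_functional T0 mZ cZ) => h e ch e0.
have [dl dl0 dP] := functionals_continuous ch e0.
by exists dl => // h' ch' hh'; have [] := dP h' ch' hh'.
Qed.

End measurability_of_rho.

(** * Mean stability for fixed reparametrisations *)

Section exponents.
Context {R : realType}.
Variables (r1 r2 : R).
Hypotheses (r10 : 0 < r1) (r12 : r1 < r2) (al0 : 0 < holder_exponent r1 r2).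

Local Notation alpha := (holder_exponent r1 r2).
(** Any [rho] in [(0, r1)] gives Hoelder paths of order [beta = rho / r2], with a constant
[H] such that [H `^ r2] has mean of order [K]. Then [H `^ ((1 + alpha) / beta)] has mean of
order [K `^ ((1 + alpha) / rho)], as long as this exponent is at most 1. The present [rho]
keeps the exponent between [1 / r2] and [1 / r2 + 1 / (r1 - 1)]. *)
Definition variation_order := Num.max (r1 - 1) (1 + alpha).
Definition moment_power := (1 + alpha) / variation_order.

Lemma r1_gt1 : 1 < r1.
Proof.
have r20 : 0 < r2 by exact: lt_trans r12.
move: al0; rewrite /holder_exponent pmulr_lgt0 ?invr_gt0// lt_min => /andP[_].
by rewrite subr_gt0.
Qed.

Lemma exponent_le : alpha * r2 <= r1 - 1 /\ alpha * r2 <= 1.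
Proof.
have r20 : 0 < r2 by exact: lt_trans r12.
by rewrite /holder_exponent divfK ?gt_eqF// !ge_min !lexx orbT.
Qed.

Lemma variation_order_ge : r1 - 1 <= variation_order /\ 1 + alpha <= variation_order.
Proof. by rewrite /variation_order !le_max !lexx orbT. Qed.

Lemma variation_order_gt1 : 1 < variation_order.
Proof. by have [_] := variation_order_ge; apply: lt_le_trans; rewrite ltrDl. Qed.

Lemma variation_order_lt : variation_order < r1.
Proof.
have r11 := r1_gt1; have [a1 _] := exponent_le; have r12' := r12; have a0 := al0.
rewrite /variation_order gt_max; apply/andP; split; first by lra.
rewrite -ltrBrDl; have : alpha * 1 < alpha * r2 by rewrite ltr_pM2l//; lra.
by rewrite mulr1 => /lt_le_trans; apply.
Qed.

Lemma alpha_lt_beta : alpha < variation_order / r2.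
Proof.
have r20 : 0 < r2 by exact: lt_trans r12.
have [_ a2] := exponent_le; have [_ h] := variation_order_ge.
rewrite ltr_pdivlMr//; apply: le_lt_trans a2 _; exact: variation_order_gt1.
Qed.

Lemma moment_power_gt0 : 0 < moment_power.
Proof.
rewrite divr_gt0//; first by rewrite addr_gt0.
by apply: lt_trans variation_order_gt1.
Qed.

Lemma moment_power_le1 : moment_power <= 1.
Proof.
have [_ h] := variation_order_ge; rewrite ler_pdivrMr ?mul1r//.
by apply: lt_trans variation_order_gt1.
Qed.

Lemma moment_power_ge : 1 / r2 <= moment_power.
Proof.
have r20 : 0 < r2 by exact: lt_trans r12.
have rp : 0 < variation_order by apply: lt_trans variation_order_gt1.
apply: (@le_trans _ _ (1 / variation_order)).
  by rewrite !div1r lef_pV2 ?posrE// ltW// (lt_trans variation_order_lt).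
by rewrite ler_pM2r ?invr_gt0// lerDl ltW.
Qed.

Lemma moment_power_le : moment_power <= 1 / r2 + 1 / (r1 - 1).
Proof.
have r20 : 0 < r2 by exact: lt_trans r12.
have r11 : 0 < r1 - 1 by rewrite subr_gt0; exact: r1_gt1.
have rp : 0 < variation_order by apply: lt_trans variation_order_gt1.
case: (leP r1 2) => h.
  apply: le_trans moment_power_le1 _; rewrite ler_wpDl ?divr_ge0 ?(ltW r20)//.
  by rewrite ler_pdivlMr// mul1r; lra.
have aE : alpha = 1 / r2 by rewrite /holder_exponent min_l//; lra.
rewrite /moment_power mulrDl addrC; apply: lerD.
  rewrite aE -[leRHS]mulr1 ler_wpM2l ?divr_ge0 ?(ltW r20)// invf_le1//.
  by apply/ltW/variation_order_gt1.
by rewrite !div1r lef_pV2 ?posrE//; have [] := variation_order_ge.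
Qed.

Lemma powR_moment_power_le K : 0 <= K -> K `^ moment_power <= K `^ (1 / r2) * (1 + K `^ (1 / (r1 - 1))).
Proof.
rewrite le_eqVlt => /orP[/eqP <-|K0].
  rewrite powR0 ?gt_eqF ?moment_power_gt0// mulr_ge0 ?powR_ge0// addr_ge0// powR_ge0.
rewrite mulrDr mulr1; case: (leP K 1) => K1.
  rewrite ler_wpDr ?mulr_ge0 ?powR_ge0// ger_powR ?K0//; exact: moment_power_ge.
rewrite ler_wpDl ?powR_ge0// -powRD; last by rewrite (gt_eqF K0) implybT.
by apply: ler_powR; [exact: ltW|exact: moment_power_le].
Qed.

End exponents.

Section noise_interpolation.
Context {R : realType} {T : R}.

Lemma hoelder_weaken (W : time T -> R) (H beta al dl : R) (x y : time T) : 0 <= H -> al < beta -> 0 < al ->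
  (forall x y, `|W x - W y| <= H * `|\val x - \val y| `^ beta) -> `|\val x - \val y| <= dl ->
  `|W x - W y| <= H * T `^ (beta - al) * dl `^ al.
Proof.
move=> H0 ab a0 HW xy; apply: le_trans (HW x y) _; rewrite -mulrA ler_wpM2l//.
set d := `|_| in xy *; have d0 : 0 <= d by exact: normr_ge0.
have dT : d <= T.
  by have := time_itv x; have := time_itv y; rewrite /d ler_norml; lra.
have [->|dn0] := eqVneq d 0.
  by rewrite powR0 ?mulr_ge0 ?powR_ge0// gt_eqF// (lt_trans a0).
rewrite -[beta in leLHS](subrK al) (@powRD _ d); last by rewrite dn0 implybT.
have T_0 : 0 <= T by exact: le_trans dT.
have dl0 : 0 <= dl by exact: le_trans xy.
apply: ler_pM; rewrite ?powR_ge0//; apply: ge0_ler_powR; rewrite ?nnegrE ?subr_ge0// ltW//.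
Qed.

(** Interpolation between the Hoelder bound and the bound of the noise: the constant
[H] enters with the power [al / beta < 1] only. *)
Lemma hoelder_interpolate (W : time T -> R) (H beta al dl m : R) (x y : time T) : 0 <= H -> al < beta -> 0 < al ->
  (forall x y, `|W x - W y| <= H * `|\val x - \val y| `^ beta) -> `|\val x - \val y| <= dl ->
  (forall x, `|W x| <= m) ->
  `|W x - W y| <= (2 * m) `^ (1 - al / beta) * H `^ (al / beta) * dl `^ al.
Proof.
move=> H0 ab a0 HW xy Wm; set v : R := `|W x - W y|.
have b0 : 0 < beta by exact: lt_trans ab.
have v0 : 0 <= v by exact: normr_ge0.
have vm : v <= 2 * m.
  apply: le_trans (ler_normB _ _) _; rewrite mulr_natl mulr2n; exact: lerD.
have m0 : 0 <= 2 * m by exact: le_trans vm.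
have [->|vn0] := eqVneq v 0; first by rewrite !mulr_ge0 ?powR_ge0.
have q1 : al / beta <= 1 by rewrite ler_pdivrMr// mul1r ltW.
have q0 : 0 <= al / beta by rewrite divr_ge0 ?ltW.
have dl0 : 0 <= dl by exact: le_trans xy.
rewrite -[v in leLHS]powRr1// -{1}(subrK (al / beta) 1) (@powRD _ v); last by rewrite vn0 implybT.
rewrite -mulrA; apply: ler_pM; rewrite ?powR_ge0//.
  by apply: ge0_ler_powR; rewrite ?nnegrE ?subr_ge0.
have := HW x y; rewrite -/v => vH.
apply: (@le_trans _ _ ((H * dl `^ beta) `^ (al / beta))).
  apply: ge0_ler_powR; [exact: q0|exact: v0|by rewrite nnegrE mulr_ge0 ?powR_ge0|].
  apply: le_trans vH _; rewrite ler_wpM2l//.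
  by apply: ge0_ler_powR; rewrite ?nnegrE ?(ltW b0).
by rewrite powRM ?powR_ge0// -powRrM mulrC mulrCA divff ?gt_eqF// mulr1 mulrC.
Qed.

End noise_interpolation.

Section mean_stability.
Context {R : realType} (F : fieldType) {T : R} (S : Type).
Hypothesis T0 : 0 < T.

(** The pathwise bound is [(1 + H `^ beta^-1) * Delta]. The modulus [Delta] is bounded by
[hoelder_weaken] in the first term and by [hoelder_interpolate] in the second
one, which already contains a power of [H]. Their means are of order
[K `^ (1 / r2)] and [K `^ moment_power]. *)
Lemma mean_stability (phi : R -> R) (eps p q C Lk r1 r2 : R) :
  continuous phi -> (forall x, phi (x + 1) = phi x) ->
  0 < eps -> 1 <= p -> 0 < q -> 0 <= C -> 0 <= Lk ->
  0 < r1 -> r1 < r2 -> 0 < holder_exponent r1 r2 ->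
  exists2 c0 : R, 0 <= c0 & forall (k : R * R -> S -> R) (t : S) (L vmin : R)
    (g1 g2 : time T -> R) (dd : R) d (Omega : measurableType d) (P : probability Omega R)
    (W : time T -> Omega -> R) (K : R) (D : Omega -> R),
    (forall x y, `|k x t - k y t| <= Lk * `|x - y|) -> (forall b, `|k (b, b) t| <= C) ->
    0 < L -> 0 < vmin -> full_range phi L ->
    Gamma T L vmin g1 -> Gamma T L vmin g2 -> (forall x, `|g1 x - g2 x| <= dd) ->
    0 <= K -> (forall u, measurable_fun setT (W u)) -> (forall w, continuous (W ^~ w)) ->
    {ae P, forall w, forall x, `|W x w| <= (amplitude phi - eps - q) / 2} ->
    (forall s t, (\int[P]_w (`|W t w - W s w| `^ r2)%:E <=
       (K * `|\val t - \val s| `^ (1 + r1))%:E)%E) ->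
    measurable_fun setT D ->
    (forall w, 0 <= D w <= `|rho_bar F eps p k (fun x => phi (g1 x) + W x w) t -
      rho_bar F eps p k (fun x => phi (g2 x) + W x w) t|) ->
    (\int[P]_w (D w)%:E <= (c0 * (K `^ (1 / r2) * (1 + K `^ (1 / (r1 - 1)))) *
       (dd / vmin) `^ holder_exponent r1 r2)%:E)%E.
Proof.
move=> cphi per e0 p1 q0 C0 Lk0 r10 r12 al0; set al := holder_exponent r1 r2.
have r20 : 0 < r2 by exact: lt_trans r12.
set rh := variation_order r1 r2; set th := moment_power r1 r2; set be := rh / r2.
have rh1 : 1 < rh by exact: variation_order_gt1.
have rh0 : 0 < rh by exact: lt_trans rh1.
have be0 : 0 < be by rewrite divr_gt0.
have albe : al < be by exact: alpha_lt_beta.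
have th0 : 0 < th by exact: moment_power_gt0.
have th1 : th <= 1 by exact: moment_power_le1.
have ir2 : 0 < r2^-1 by rewrite invr_gt0.
have ir21 : r2^-1 <= 1 by rewrite invf_le1// ltW// (lt_trans _ r12)// (r1_gt1 r10 r12 al0).
have [cH cH0 holderP] := hoelder_of_dyadic T0 be0.
have [cV cV0 varP] := dyadic_variation T0 r20 rh0 (variation_order_lt r10 r12 al0).
have [K0 K00 stab] := signal_stability F S T0 cphi per e0 p1 q0 C0 Lk0 be0.
set m := (amplitude phi - eps - q) / 2 in stab *.
set A1 := cH * T `^ (be - al).
set A2 := (2 * m) `^ (1 - al / be) * cH `^ ((1 + al) / be).
have A10 : 0 <= A1 by rewrite mulr_ge0 ?powR_ge0.
have A20 : 0 <= A2 by rewrite mulr_ge0 ?powR_ge0.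
exists (K0 * (A1 * cV `^ r2^-1 + A2 * cV `^ th)).
  by rewrite mulr_ge0// addr_ge0// mulr_ge0// powR_ge0.
move=> k t L vmin g1 g2 dd d Omega P W K D klip kdiag L0 v0 full G1 G2 g12 Kp mW cW Wm mom mD Dle.
have [X [mX X0 XK incr]] := varP _ Omega P W K Kp mW mom.
set dl := dd / vmin; set a := K0 * dl `^ al.
have a0 : 0 <= a by rewrite mulr_ge0 ?powR_ge0.
set B := fun w => a * A1 * X w `^ r2^-1 + a * A2 * X w `^ th.
have mXp s : measurable_fun setT (fun w => X w `^ s).
  exact: (measurableT_comp (measurable_powR _)).
have B0 w : 0 <= B w by rewrite addr_ge0// !mulr_ge0// powR_ge0.
have mB : measurable_fun setT B.
  by apply: measurable_funD; apply: measurable_funM => //; exact: measurable_cst.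
have path w : (forall x, `|W x w| <= m) ->
    (forall n i, (i < 2 ^ n)%N -> `|W (dyadic T0 n i.+1) w - W (dyadic T0 n i) w| <=
          X w `^ r2^-1 * (2^-1 `^ (rh / r2)) ^+ n) -> D w <= B w.
  move=> wm wi; have /andP[_ Dw] := Dle w; apply: le_trans Dw _.
  set H := cH * X w `^ r2^-1.
  have H0 : 0 <= H by rewrite mulr_ge0 ?powR_ge0.
  have HW : forall x y, `|W x w - W y w| <= H * `|\val x - \val y| `^ be.
    exact: (holderP (W ^~ w) (X w `^ r2^-1) (cW w) (powR_ge0 _ _) wi).
  set D1 := H * T `^ (be - al) * dl `^ al.
  set D2 := (2 * m) `^ (1 - al / be) * H `^ (al / be) * dl `^ al.
  have D10 : 0 <= D1 by rewrite !mulr_ge0 ?powR_ge0.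
  have D20 : 0 <= D2 by rewrite !mulr_ge0 ?powR_ge0.
  have := stab k t L vmin g1 g2 (W ^~ w) H dd (Num.min D1 D2) klip kdiag L0 v0 full G1 G2 g12
    (cW w) wm H0 HW.
  move=> /(_ _)/le_trans; apply.
    move=> x y xy; rewrite le_min; apply/andP; split.
      exact: (hoelder_weaken H0 albe al0 HW xy).
    exact: (hoelder_interpolate H0 albe al0 HW xy wm).
  have Hp : 0 <= H `^ be^-1 by exact: powR_ge0.
  have -> : B w = K0 * (D1 + H `^ be^-1 * D2).
    have -> : H `^ be^-1 * D2 = A2 * X w `^ th * dl `^ al.
      rewrite /D2 /A2 /H; set c1 := _ `^ (1 - _).
      have -> : (cH * X w `^ r2^-1) `^ be^-1 * (c1 * (cH * X w `^ r2^-1) `^ (al / be) * dl `^ al) =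
        c1 * ((cH * X w `^ r2^-1) `^ be^-1 * (cH * X w `^ r2^-1) `^ (al / be)) * dl `^ al by ring.
      rewrite -powRD; last first.
        have -> : (be^-1 + al / be == 0) = false.
          by apply: gt_eqF; apply: addr_gt0; [rewrite invr_gt0|exact: divr_gt0].
        by [].
      have -> : be^-1 + al / be = (1 + al) / be by ring.
      rewrite powRM ?powR_ge0// -powRrM.
      have -> : r2^-1 * ((1 + al) / be) = th.
        by rewrite /be /th /moment_power -/rh -/al; field; rewrite !gt_eqF.
      by rewrite !mulrA.
    by rewrite /B /D1 /A1 /H /a; ring.
  rewrite -mulrA ler_wpM2l// mulrDl mul1r; apply: lerD; first by rewrite ge_min lexx.
  by rewrite ler_wpM2l// ge_min lexx orbT.
have mDE : measurable_fun setT (fun w => (D w)%:E) by exact/measurable_EFinP.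
apply: (@le_trans _ _ (\int[P]_w (B w)%:E)%E).
  apply: ae_ge0_le_integral => //.
  - by move=> w _; rewrite lee_fin; have /andP[] := Dle w.
  - by move=> w _; rewrite lee_fin.
  - exact/measurable_EFinP.
  - move: Wm incr; apply: filterS2 => w wm wi _; rewrite lee_fin; exact: path.
have cK : 0 <= cV * K by rewrite mulr_ge0.
rewrite /B; under eq_integral do rewrite EFinD.
rewrite ge0_integralD//; last first.
- by apply/measurable_EFinP; apply: measurable_funM => //; exact: measurable_cst.
- by move=> w _; rewrite lee_fin !mulr_ge0// powR_ge0.
- by apply/measurable_EFinP; apply: measurable_funM => //; exact: measurable_cst.
- by move=> w _; rewrite lee_fin !mulr_ge0// powR_ge0.
under eq_integral do rewrite EFinM.
under [X in (_ + X)%E]eq_integral do rewrite EFinM.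
rewrite !ge0_integralZl//; last first.
- by rewrite lee_fin mulr_ge0.
- by move=> w _; rewrite lee_fin powR_ge0.
- by apply/measurable_EFinP.
- by rewrite lee_fin mulr_ge0.
- by move=> w _; rewrite lee_fin powR_ge0.
- by apply/measurable_EFinP.
have I1 := expectation_powR_le mX X0 ir2 ir21 cK XK.
have I2 := expectation_powR_le mX X0 th0 th1 cK XK.
apply: (@le_trans _ _ ((a * A1 * (cV * K) `^ r2^-1 + a * A2 * (cV * K) `^ th)%:E)).
  rewrite EFinD (EFinM (a * A1)) (EFinM (a * A2)); apply: leeD.
    by apply: lee_wpmul2l; [rewrite lee_fin mulr_ge0|exact: I1].
  by apply: lee_wpmul2l; [rewrite lee_fin mulr_ge0|exact: I2].
rewrite lee_fin.
have -> : K0 * (A1 * cV `^ r2^-1 + A2 * cV `^ th) * (K `^ (1 / r2) * (1 + K `^ (1 / (r1 - 1)))) * dl `^ al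
  = a * A1 * (cV `^ r2^-1 * (K `^ (1 / r2) * (1 + K `^ (1 / (r1 - 1))))) +
    a * A2 * (cV `^ th * (K `^ (1 / r2) * (1 + K `^ (1 / (r1 - 1))))) by rewrite /a; ring.
rewrite !powRM//; apply: lerD.
  apply: ler_wpM2l; first exact: mulr_ge0.
  apply: ler_wpM2l; first exact: powR_ge0.
  by rewrite div1r ler_peMr ?powR_ge0// lerDl powR_ge0.
apply: ler_wpM2l; first exact: mulr_ge0.
apply: ler_wpM2l; [exact: powR_ge0|exact: powR_moment_power_le].
Qed.

End mean_stability.

(** * The Wasserstein distance *)

Section sup_norms.
Context {R : realType} {X : Type}.
Implicit Types f h : X -> R.

Lemma sup_norm_le f (c : R) : (forall x, `|f x| <= c) -> (sup_norm f <= c%:E)%E.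
Proof. by move=> fc; apply: ge_ereal_sup => _ [x _ <-]; rewrite lee_fin. Qed.

Lemma sup_norm_ge f (c : R) x : (sup_norm f <= c%:E)%E -> `|f x| <= c.
Proof.
by move=> fc; rewrite -lee_fin; apply: le_trans fc; apply: ereal_sup_ubound; exists x.
Qed.

Lemma sup_norm_fin f (c : R) (x0 : X) : (forall x, `|f x| <= c) ->
  (fine (sup_norm f))%:E = sup_norm f /\ 0 <= fine (sup_norm f) <= c.
Proof.
move=> fc; have h0 : (0 <= sup_norm f)%E.
  apply: (@le_trans _ _ (`|f x0|%:E)); first by rewrite lee_fin.
  by apply: ereal_sup_ubound; exists x0.
have h1 := sup_norm_le fc.
have E : (fine (sup_norm f))%:E = sup_norm f.
  by rewrite fineK// ge0_fin_numE//; apply: le_lt_trans h1 _; rewrite ltry.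
by rewrite E -!lee_fin E h0 h1.
Qed.

End sup_norms.

Section wasserstein.
Context {R : realType} d (G : measurableType d).

Lemma coupling_joint_law d' (Omega : measurableType d') (P : probability Omega R)
    (mu nu : probability G R) (g1 g2 : {RV P >-> G}) :
  (forall A, measurable A -> distribution P g1 A = mu A) ->
  (forall A, measurable A -> distribution P g2 A = nu A) ->
  coupling mu nu !=set0.
Proof.
move=> l1 l2.
have mg : measurable_fun setT (fun w => (g1 w, g2 w)) by exact/measurable_fun_pairP.
pose g : {RV P >-> (G * G)%type} := mfun_Sub (mem_set mg).
exists (distribution P g) => A mA; rewrite -l1// -l2// /distribution /pushforward/=; split.
  by congr (P _); apply/seteqP; split=> w /=; [case|split].
by congr (P _); apply/seteqP; split=> w /=; [case|split].
Qed.

(** Jensen's inequality under an arbitrary coupling; the infimum over the couplings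
passes through the increasing function [m |-> m `^ al]. *)
Lemma wasserstein1_hoelder (mu nu : probability G R) (dist : G -> G -> \bar R)
    (D : G -> G -> R) (psi : G -> R) (l b c al : R) :
  (forall x y, dist x y = (D x y)%:E) -> (forall x y, 0 <= D x y <= l) ->
  measurable_fun setT (fun z : G * G => D z.1 z.2) ->
  coupling mu nu !=set0 -> measurable_fun setT psi -> (forall x, `|psi x| <= b) ->
  0 <= c -> 0 < al -> al <= 1 -> (forall x y, `|psi x - psi y| <= c * D x y `^ al) ->
  `|(\int[mu]_x psi x)%R - (\int[nu]_x psi x)%R| <= c * fine (wasserstein1 dist mu nu) `^ al.
Proof.
move=> distE Dl mD [pi0 cpi0] mpsi psib c0 al0 al1 lip.
set a := `|_ - _|; have a0 : 0 <= a by exact: normr_ge0.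
have mD1 : measurable_fun setT (fun z : G * G => (D z.1 z.2)%:E) by exact/measurable_EFinP.
have D_int (pi : probability (G * G)%type R) : pi.-integrable setT (EFin \o (fun z => D z.1 z.2)).
  apply: (bounded_integrable (b := l)).
  - by rewrite -ge0_fin_numE// fin_num_measure.
  - exact: mD.
  - by move=> z; have /andP[z0 zl] := Dl z.1 z.2; rewrite ger0_norm.
have step pi : coupling mu nu pi -> a <= c * (\int[pi]_z D z.1 z.2)%R `^ al.
  move=> cpi; have psiE s (m : probability G R) : measurable_fun setT s ->
      (forall A, measurable A -> pi (s @^-1` A) = m A) ->
      (\int[m]_x psi x)%R = (\int[pi]_z psi (s z))%R.
    by move=> ms sm; rewrite /Rintegral (integral_image ms sm mpsi psib).
  have i_psi s : measurable_fun setT s -> pi.-integrable setT (EFin \o (fun z => psi (s z))).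
    move=> ms; apply: (bounded_integrable (b := b)).
    - by rewrite -ge0_fin_numE// fin_num_measure.
    - exact: measurableT_comp.
    - by move=> z; exact: psib.
  have pi1 A : measurable A -> pi (fst @^-1` A) = mu A.
    move=> mA; rewrite -(proj1 (cpi A mA)); congr (pi _).
    by apply/seteqP; split=> z /=; [split|case].
  have pi2 A : measurable A -> pi (snd @^-1` A) = nu A.
    move=> mA; rewrite -(proj2 (cpi A mA)); congr (pi _).
    by apply/seteqP; split=> z /=; [split|case].
  rewrite /a (psiE _ _ measurable_fst pi1) (psiE _ _ measurable_snd pi2).
  rewrite -RintegralB//; [|exact: i_psi|exact: i_psi].
  have i_d : pi.-integrable setT (EFin \o (fun z => psi z.1 - psi z.2)).
    apply: (bounded_integrable (b := b + b)); first by rewrite -ge0_fin_numE// fin_num_measure.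
      by apply: measurable_funB; apply: measurableT_comp.
    by move=> z; apply: le_trans (ler_normB _ _) _; rewrite lerD.
  have i_a : pi.-integrable setT (EFin \o (fun z => c * D z.1 z.2 `^ al)).
    apply: (bounded_integrable (b := c * l `^ al)); first by rewrite -ge0_fin_numE// fin_num_measure.
      apply: measurable_funM; first exact: measurable_cst.
      exact: (measurableT_comp (measurable_powR _)).
    move=> z; have /andP[z0 zl] := Dl z.1 z.2.
    rewrite ger0_norm ?mulr_ge0 ?powR_ge0// ler_wpM2l//.
    by apply: ge0_ler_powR; rewrite ?nnegrE ?(ltW al0)// (le_trans z0).
  apply: le_trans (le_normr_Rintegral _ i_d) _ => //.
  apply: (@le_trans _ _ (\int[pi]_z (c * D z.1 z.2 `^ al))%R).
    apply: le_Rintegral => //.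
    exact: (@integrable_norm _ _ _ pi setT _ i_d).
  set m := (\int[pi]_z D z.1 z.2)%R.
  have m0 : 0 <= m by apply: fine_ge0; apply: integral_ge0 => z _; rewrite lee_fin; have /andP[] := Dl z.1 z.2.
  have mE : (\int[pi]_z (D z.1 z.2)%:E)%E = m%:E.
  by rewrite /Rintegral fineK//; exact: (integrable_fin_num measurableT (D_int pi)).
  have pos z : 0 <= D z.1 z.2 by have /andP[] := Dl z.1 z.2.
  have i_p : pi.-integrable setT (EFin \o (fun z => D z.1 z.2 `^ al)).
    apply: (bounded_integrable (b := l `^ al)); first by rewrite -ge0_fin_numE// fin_num_measure.
      exact: (measurableT_comp (measurable_powR _)).
    move=> z; have /andP[z0 zl] := Dl z.1 z.2.
    rewrite ger0_norm ?powR_ge0//.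
    by apply: ge0_ler_powR; rewrite ?nnegrE ?(ltW al0)// (le_trans z0).
  rewrite RintegralZl//; apply: ler_wpM2l => //.
  rewrite -lee_fin /Rintegral fineK; last exact: integrable_fin_num.
  by apply: expectation_powR_le => //; rewrite mE.
have W0 pi : coupling mu nu pi -> ((\int[pi]_z D z.1 z.2)%R%:E = \int[pi]_z dist z.1 z.2)%E.
  move=> _; under [RHS]eq_integral do rewrite distE.
  by rewrite /Rintegral fineK//; exact: (integrable_fin_num measurableT (D_int pi)).
set w := wasserstein1 dist mu nu.
have w_fin : (fine w)%:E = w.
  rewrite fineK// ge0_fin_numE; last first.
    apply: le_ereal_inf_tmp => _ [pi cpi <-]; apply: integral_ge0 => z _.
    by rewrite distE lee_fin; have /andP[] := Dl z.1 z.2.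
  apply: (@le_lt_trans _ _ (\int[pi0]_z dist z.1 z.2)%E).
    by apply: ereal_inf_lbound; exists pi0.
  by rewrite -W0// ltry.
have w0 : 0 <= fine w.
  rewrite -lee_fin w_fin; apply: le_ereal_inf_tmp => _ [pi cpi <-]; apply: integral_ge0 => z _.
  by rewrite distE lee_fin; have /andP[] := Dl z.1 z.2.
move: c0; rewrite le_eqVlt => /orP[/eqP c0|c0].
  by have := step pi0 cpi0; rewrite -c0 !mul0r.
rewrite mulrC -ler_pdivrMr//.
have ac0 : 0 <= a / c by rewrite divr_ge0 ?(ltW c0).
have E x : 0 <= x -> x = (x `^ al^-1) `^ al.
  by move=> x0; rewrite -powRrM mulVf ?gt_eqF// powRr1.
(* In this form the bound is a lower bound of all the terms of the infimum. *)
rewrite (E (a / c))//; apply: ge0_ler_powR; rewrite ?nnegrE ?powR_ge0 ?(ltW al0)//.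
rewrite -lee_fin w_fin; apply: le_ereal_inf_tmp => _ [pi cpi <-].
rewrite -W0// lee_fin; set m := (\int[pi]_z D z.1 z.2)%R.
have m0 : 0 <= m by apply: fine_ge0; apply: integral_ge0 => z _; rewrite lee_fin; have /andP[] := Dl z.1 z.2.
have -> : m = (m `^ al) `^ al^-1 by rewrite -powRrM divff ?gt_eqF// powRr1.
apply: ge0_ler_powR; rewrite ?nnegrE ?powR_ge0 ?invr_ge0 ?(ltW al0)//.
by rewrite ler_pdivrMr// mulrC; exact: step.
Qed.

End wasserstein.

(** * The space of reparametrisations *)

Section reparametrisation_space.
Context {R : realType} {T L vmin : R}.
Hypothesis T0 : 0 < T.
Variable ne : Gamma T L vmin !=set0.
Implicit Types x y : Gamma_borel ne.

Lemma Gamma_set_val x : Gamma T L vmin (set_val x).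
Proof. exact: set_valP. Qed.

Lemma Gamma_diff_le x y u : `|set_val x u - set_val y u| <= L.
Proof.
have [_ /(_ u) hx _ _ _] := Gamma_set_val x; have [_ /(_ u) hy _ _ _] := Gamma_set_val y.
by move: hx hy; rewrite ler_norml; lra.
Qed.

Lemma Gamma_distE x y : (fine (Gamma_dist ne x y))%:E = Gamma_dist ne x y /\
  0 <= fine (Gamma_dist ne x y) <= L.
Proof. exact: (sup_norm_fin (clip T0 0) (Gamma_diff_le x y)). Qed.

Lemma Gamma_dist_ge x y u : `|set_val x u - set_val y u| <= fine (Gamma_dist ne x y).
Proof.
by apply: (sup_norm_ge (f := set_val x \- set_val y)); have [-> _] := Gamma_distE x y.
Qed.

(** A half-space of the form [g u > a] is open for the sup distance. *)
Lemma measurable_eval u : measurable_fun setT (fun x => set_val x u : R).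
Proof.
apply: (measurability _ (RGenOInfty.measurableE R)) => //.
move=> _ [_ [a ->] <-]; rewrite setTI; apply: sub_sigma_algebra => x /=.
rewrite in_itv/= andbT => ax; exists (set_val x u - a); first by rewrite subr_gt0.
move=> y; have [<- _] := Gamma_distE x y; rewrite lte_fin in_itv/= andbT => xy.
have := le_lt_trans (Gamma_dist_ge x y u) xy; rewrite ltr_norml => /andP[_].
by move=> h; lra.
Qed.

Lemma measurable_Gamma_dist :
  measurable_fun setT (fun z : Gamma_borel ne * Gamma_borel ne => fine (Gamma_dist ne z.1 z.2)).
Proof.
pose Z (z : Gamma_borel ne * Gamma_borel ne) : time T -> R := set_val z.1 \- set_val z.2.
apply: (measurable_functional T0 (Z := Z) (Psi := fun h => fine (sup_norm h))).
- move=> u; apply: measurable_funB; apply: (measurableT_comp (measurable_eval u)) => //.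
- move=> z x; have [c1 _ _ _ _] := Gamma_set_val z.1; have [c2 _ _ _ _] := Gamma_set_val z.2.
  exact: (@continuousB R R (time T) _ _ x (c1 x) (c2 x)).
move=> h e ch e0; exists (e / 2); first by rewrite divr_gt0.
move=> h' ch' hh'; have [a [b hab]] := time_extrema T0 ch.
have hc z : `|h z| <= `|h a| + `|h b|.
  have /andP[h1 h2] := hab z; have n1 := ler_norm (h b); have n2 := ler_norm (- h a).
  have n3 := normr_ge0 (h b); have n4 := normr_ge0 (h a); rewrite normrN in n2.
  by clear -T0 h1 h2 n1 n2 n3 n4; rewrite ler_norml; lra.
have hc' z : `|h' z| <= `|h a| + `|h b| + e / 2.
  rewrite -[h' z](subrK (h z)) addrC; apply: le_trans (ler_normD _ _) _.
  by rewrite lerD// distrC.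
have [E1 _] := sup_norm_fin (clip T0 0) hc; have [E2 _] := sup_norm_fin (clip T0 0) hc'.
have close (f g : time T -> R) : (fine (sup_norm f))%:E = sup_norm f ->
   (fine (sup_norm g))%:E = sup_norm g -> (forall z, `|f z - g z| <= e / 2) ->
   fine (sup_norm f) <= fine (sup_norm g) + e / 2.
  move=> fE gE fg; rewrite -lee_fin fE; apply: sup_norm_le => z.
  have gz : `|g z| <= fine (sup_norm g) by apply: sup_norm_ge; rewrite gE.
  by have -> : f z = g z + (f z - g z); [ring|apply: le_trans (ler_normD _ _) _; exact: lerD].
have l1 := close _ _ E1 E2 hh'.
have l2 := close h' h E2 E1 (fun z => ltac:(rewrite distrC; exact: hh')).
by rewrite ltr_norml; lra.
Qed.

End reparametrisation_space.

(** * Disintegration over the reparametrisation *)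

Section truncation.
Context {R : realType}.
Implicit Types a b u v : R.

(** Makes the weighted mean bounded for all values of the noise, with no change on the
almost sure event where the noise is bounded. *)
Definition truncate b v := Num.max (- b) (Num.min b v).

Lemma truncate_id b v : `|v| <= b -> truncate b v = v.
Proof. by rewrite ler_norml => /andP[bv vb]; rewrite /truncate min_r// max_r. Qed.

Lemma truncate_bound b v : 0 <= b -> `|truncate b v| <= b.
Proof.
move=> b0; rewrite /truncate ler_norml le_max lexx/= ge_max ge_min lexx andbT.
by rewrite (le_trans _ b0)// oppr_le0.
Qed.

Lemma truncate_lip b u v : 0 <= b -> `|truncate b u - truncate b v| <= `|u - v|.
Proof.
move=> b0; wlog uv : u v / u <= v => [th|].
  by have [/th//|/ltW/th] := leP u v; rewrite distrC [leRHS]distrC.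
rewrite distrC [leRHS]distrC (ger0_norm (x := v - u)) ?subr_ge0//.
rewrite /truncate ler_norml; have [h1|h1] := leP b u; have [h2|h2] := leP b v;
  have [h3|h3] := leP (- b) u; have [h4|h4] := leP (- b) v; have [h5|h5] := leP (- b) b; lra.
Qed.

End truncation.

Section disintegration.
Context {R : realType} (F : fieldType) {T : R} {S : Type}.
Hypothesis T0 : 0 < T.
Variables (phi : R -> R) (eps p C Lk : R) (k : R * R -> S -> R) (t : S).
Hypotheses (cphi : continuous phi) (eps0 : 0 < eps) (p1 : 1 <= p) (C0 : 0 <= C) (Lk0 : 0 <= Lk)
  (k_lip : forall x y, `|k x t - k y t| <= Lk * `|x - y|)
  (k_diag : forall b, `|k (b, b) t| <= C).
Context {L vmin : R} (ne : Gamma T L vmin !=set0).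
Context d (Omega : measurableType d) (P : probability Omega R) (W : time T -> {RV P >-> R}).
Hypothesis cW : forall w, continuous (fun u => W u w).

Local Notation sigmaW :=
  (\bigcup_(u in [set: time T]) preimage_set_system setT (W u) measurable).
Local Notation OmegaW := (g_sigma_algebraType sigmaW).

Definition signal_path (g : time T -> R) (w : Omega) (u : time T) : R := phi (g u) + W u w.

Definition truncated_rho b (g : time T -> R) (w : Omega) : R :=
  truncate b (rho_bar F eps p k (signal_path g w) t).

Lemma continuous_signal (g : time T -> R) w : continuous g -> continuous (signal_path g w).
Proof.
move=> cg u; apply: (@continuousD R R (time T)); last exact: cW.
by apply: (@continuous_comp (time T) R R); [exact: cg|exact: cphi].
Qed.

Lemma measurable_noise_coordinate u : measurable_fun setT (fun w : OmegaW => W u w).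
Proof.
move=> _ B mB; rewrite setTI; apply: sub_sigma_algebra; exists u => //.
by exists B => //; rewrite setTI.
Qed.

(** The noise enters as the identity map to the sample space with the sigma-algebra
of [W]: independence of the process is independence of this map. *)
Lemma measurable_to_sigmaW : measurable_fun setT (fun w : Omega => w : OmegaW).
Proof.
apply: (@measurability _ _ Omega OmegaW setT (fun w => w) sigmaW erefl).
move=> _ [_ [u _ [B mB <-]] <-]; rewrite !setTI.
by rewrite -[X in measurable X]setTI; exact: (measurable_funPT (W u)).
Qed.

Lemma measurable_signal_rho d' (Z : measurableType d') (X : Z -> Gamma_borel ne) (Y : Z -> OmegaW) :
  measurable_fun setT X -> measurable_fun setT Y ->
  measurable_fun setT (fun z => rho_bar F eps p k (signal_path (set_val (X z)) (Y z)) t).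
Proof.
move=> mX mY; apply: (measurable_rho_bar F T0 eps0 p1 C0 Lk0 k_lip k_diag).
  move=> u; apply: measurable_funD.
    apply: (@measurableT_comp _ _ _ _ _ _ phi); first exact: continuous_measurable_fun.
    exact: (measurableT_comp (measurable_eval T0 (ne := ne) u) mX).
  exact: (measurableT_comp (measurable_noise_coordinate u) mY).
move=> z; apply: continuous_signal; by have [] := Gamma_set_val (X z).
Qed.

Lemma measurable_truncate b d' (Z : measurableType d') (f : Z -> R) :
  measurable_fun setT f -> measurable_fun setT (fun z => truncate b (f z)).
Proof.
by move=> mf; apply: measurable_maxr; [|apply: measurable_minr]; rewrite //; exact: measurable_cst.
Qed.

Lemma continuous_paths (g : Gamma_borel ne) : continuous (set_val g).
Proof. by have [] := Gamma_set_val g. Qed.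

Lemma measurable_truncated_rho b (g : Gamma_borel ne) :
  measurable_fun setT (truncated_rho b (set_val g)).
Proof.
apply: measurable_truncate.
exact: (measurable_signal_rho (X := fun=> g) (measurable_cst _) measurable_to_sigmaW).
Qed.

(** Independence of the reparametrisation and the noise: the signature is the mean, over
the law of the reparametrisation, of the expectation over the noise. *)
Lemma signature_disintegration b lo hi m (mu : probability (Gamma_borel ne) R)
    (g : {RV P >-> Gamma_borel ne}) : 0 <= b ->
  (forall x, lo <= phi x <= hi) -> C + Lk * ((hi + m) - (lo - m)) <= b ->
  {ae P, forall w, forall u, `|W u w| <= m} ->
  (forall A, measurable A -> distribution P g A = mu A) -> independent_process g W ->
  measurable_fun setT (fun x : Gamma_borel ne => (\int[P]_w truncated_rho b (set_val x) w)%R) /\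
  signature F eps p k P (fun w => signal_path (set_val (g w)) w) t =
    (\int[mu]_x (\int[P]_w truncated_rho b (set_val x) w))%R.
Proof.
move=> b0 phib bb Wm gmu ind.
pose f (z : Gamma_borel ne * OmegaW) : R := truncated_rho b (set_val z.1) z.2.
have mf : measurable_fun setT f.
  by apply: measurable_truncate; exact: (measurable_signal_rho measurable_fst measurable_snd).
have fb z : `|f z| <= b by exact: truncate_bound.
have gE A : measurable A -> P (g @^-1` A) = mu A by exact: gmu.
have indE A B : measurable A -> (measurable : set (set OmegaW)) B ->
    P (g @^-1` A `&` (fun w => w) @^-1` B) = (P (g @^-1` A) * P ((fun w => w) @^-1` B))%E.
  by move=> mA mB; apply: ind.
have mg : measurable_fun setT g by exact: measurable_funPT.
have [E mE] := independent_integral mg measurable_to_sigmaW gE indE mf fb.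
have int_x x : P.-integrable setT (EFin \o truncated_rho b (set_val (x : Gamma_borel ne))).
  apply: (bounded_integrable (b := b)); first by rewrite -ge0_fin_numE// fin_num_measure.
    exact: measurable_truncated_rho.
  by move=> w; exact: truncate_bound.
split; first exact: (measurableT_comp (fine_measurable measurableT) mE).
rewrite /signature expectation.unlock /Rintegral; congr fine.
under [RHS]eq_integral => x _ do rewrite (fineK (integrable_fin_num measurableT (int_x x))).
transitivity (\int[P]_w (f (g w, w))%:E)%E; last exact: E.
apply: ae_eq_integral => //.
- apply/measurable_EFinP.
  exact: (measurable_signal_rho mg measurable_to_sigmaW).
- apply/measurable_EFinP; apply: measurable_truncate.
  exact: (measurable_signal_rho mg measurable_to_sigmaW).
apply: filterS Wm => w Wm _; congr EFin; rewrite /f/= /truncated_rho truncate_id//.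
apply: le_trans bb.
apply: (rho_bar_bound F T0 eps0 p1 C0 Lk0 k_lip k_diag (continuous_signal (@continuous_paths (g w)))). 
move=> u; have := Wm u; have := phib (set_val (g w) u); rewrite /signal_path ler_norml; lra.
Qed.

End disintegration.

(** * Stability of the signature *)

Theorem theorem2p5 (R : realType) (F : fieldType) (n : nat)
    (phi : R -> R) (k : R * R -> 'rV[R]_n -> R) (T eps p q r1 r2 : R) :
  continuous phi -> (forall x, phi (x + 1) = phi x) ->
  kernel_assumptions k ->
  0 < T -> 0 < eps -> 0 < q ->
  0 < r1 -> r1 < r2 -> 0 < holder_exponent r1 r2 ->
  1 + Num.max r2 (r2 / (r1 - 1)) <= p ->
  exists C : R -> R,
    (exists c : R, forall x, 0 <= x ->
       `|C x| <= c * (x `^ (1 / r2) * (1 + x `^ (1 / (r1 - 1))))) /\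
    forall (L vmin : R), 0 < L -> 0 < vmin ->
    full_range phi L ->
    forall (ne : Gamma T L vmin !=set0)
      (d : measure_display) (Omega : measurableType d) (P : probability Omega R)
      (W : time T -> {RV P >-> R}) (K : R)
      (mu1 mu2 : probability (Gamma_borel ne) R)
      (g1 g2 : {RV P >-> Gamma_borel ne}),
    (forall w, continuous (fun t => W t w)) ->
    {ae P, forall w,
      (sup_norm (fun t => W t w) <= ((amplitude phi - eps - q) / 2)%:E)%E} ->
    (forall s t : time T,
      ('E_P[(fun w => `|W t w - W s w| `^ r2)%R] <=
       (K * `|\val t - \val s| `^ (1 + r1))%:E)%E) ->
    (forall A, measurable A -> distribution P g1 A = mu1 A) ->
    (forall A, measurable A -> distribution P g2 A = mu2 A) ->
    independent_process g1 W -> independent_process g2 W ->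
    let signal (g : {RV P >-> Gamma_borel ne}) (w : Omega) (t : time T) : R :=
      phi (set_val (g w) t) + W t w in
    (sup_norm (signature F eps p k P (signal g1)
               \- signature F eps p k P (signal g2))%R <=
     (C K / vmin `^ holder_exponent r1 r2 *
      fine (wasserstein1 (G := Gamma_borel ne) (Gamma_dist ne) mu1 mu2)
        `^ holder_exponent r1 r2)%:E)%E.
Proof.
move=> cphi per kern T0 eps0 q0 r10 r12 al0 pge.
have r20 : 0 < r2 by exact: lt_trans r12.
have p1 : 1 <= p by apply: le_trans pge; rewrite lerDl le_max (ltW r20).
have [Lk Lk0 klip] := kernel_lipschitz_point kern.
have [C C0 kdiag] := kernel_diagonal kern.
have Lk0' := ltW Lk0.
have klipt t x y : `|k x t - k y t| <= Lk * `|x - y| by exact: sup_norm_ge (klip x y).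
have kdiagt t r : `|k (r, r) t| <= C by exact: sup_norm_ge (kdiag r).
have [c0 c00 mean] := mean_stability F 'rV[R]_n T0 cphi per eps0 p1 q0 C0 Lk0' r10 r12 al0.
pose Ct (x : R) := c0 * (x `^ (1 / r2) * (1 + x `^ (1 / (r1 - 1)))).
have Ct0 x : 0 <= Ct x by rewrite !mulr_ge0 ?powR_ge0// addr_ge0// powR_ge0.
set al := holder_exponent r1 r2 in al0 mean *.
exists Ct; split; first by exists c0 => x _; rewrite ger0_norm.
move=> L vmin L0 v0 full ne d Omega P W K mu1 mu2 g1 g2 cW Wm mom l1 l2 ind1 ind2 /=.
rewrite expectation.unlock in mom.
have al1 : al <= 1.
  rewrite /al /holder_exponent ler_pdivrMr// mul1r ge_min; apply/orP; left.
  by apply/ltW/(lt_trans _ r12)/(r1_gt1 r10 r12 al0).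
(* The moment condition between the end points of the interval. *)
have Kp : 0 <= K.
  have z0 : \val (clip T0 0) = 0 by apply: val_clip; rewrite lexx ltW.
  have zT : \val (clip T0 T) = T by apply: val_clip; rewrite lexx ltW.
  have := mom (clip T0 0) (clip T0 T); rewrite z0 zT subr0 => h.
  have : (0 <= (K * `|T| `^ (1 + r1))%:E)%E.
    by apply: le_trans h; apply: integral_ge0 => w _; rewrite lee_fin powR_ge0.
  by rewrite lee_fin pmulr_lge0// powR_gt0// normr_gt0 gt_eqF.
have [y [z [_ _ phib _]]] := periodic_extrema cphi per.
set m := (amplitude phi - eps - q) / 2 in Wm mean.
have Wm' : {ae P, forall w, forall u, `|W u w| <= m}.
  by apply: filterS Wm => w h u; exact: (sup_norm_ge (f := fun u => W u w) u h).
(* When the noise is bounded by [m], the signal has values in [[phi y - m, phi z + m]]. *)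
set b := `|C + Lk * ((phi z + m) - (phi y - m))|.
have bb : C + Lk * ((phi z + m) - (phi y - m)) <= b by exact: ler_norm.
have b0 : 0 <= b by exact: normr_ge0.
apply: ge_ereal_sup => _ [t _ <-]; rewrite lee_fin /=.
have [mpsi E1] := signature_disintegration F T0 cphi eps0 p1 C0 Lk0' (klipt t) (kdiagt t) cW
  b0 phib bb Wm' l1 ind1.
have [_ E2] := signature_disintegration F T0 cphi eps0 p1 C0 Lk0' (klipt t) (kdiagt t) cW
  b0 phib bb Wm' l2 ind2.
rewrite {}E1 {}E2.
have int_x (x : Gamma_borel ne) :
    P.-integrable setT (EFin \o truncated_rho F phi eps p k t W b (set_val x)).
  apply: (bounded_integrable (b := b)); first by rewrite -ge0_fin_numE// fin_num_measure.
    exact: (measurable_truncated_rho F T0 cphi eps0 p1 C0 Lk0' (klipt t) (kdiagt t) cW).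
  by move=> w; exact: truncate_bound.
pose psi (x : Gamma_borel ne) := (\int[P]_w truncated_rho F phi eps p k t W b (set_val x) w)%R.
apply: (@wasserstein1_hoelder R _ (Gamma_borel ne) mu1 mu2 (Gamma_dist ne)
  (fun x x' => fine (Gamma_dist ne x x')) psi L b (Ct K / vmin `^ al) al).
- by move=> x x'; have [-> _] := Gamma_distE T0 x x'.
- by move=> x x'; have [_] := Gamma_distE T0 x x'.
- exact: measurable_Gamma_dist.
- exact: coupling_joint_law l1 l2.
- exact: mpsi.
- move=> x; apply: le_trans (le_normr_Rintegral _ (int_x x)) _ => //.
  have bE : (\int[P]_w b)%R = b by rewrite Rintegral_cst//= probability_setT mulr1.
  rewrite -[leRHS]bE.
  apply: le_Rintegral => //.
  - exact: (@integrable_norm _ _ _ P setT _ (int_x x)).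
  - apply: (bounded_integrable (b := b)) => //; first by rewrite -ge0_fin_numE// fin_num_measure.
    by move=> w; rewrite ger0_norm.
  - by move=> w _; exact: truncate_bound.
- by rewrite divr_ge0 ?powR_ge0.
- exact: al0.
- exact: al1.
move=> x x'; set dd := fine _.
have dd0 : 0 <= dd by have [_ /andP[]] := Gamma_distE T0 x x'.
set D := fun w => truncated_rho F phi eps p k t W b (set_val x) w -
  truncated_rho F phi eps p k t W b (set_val x') w.
have mD : measurable_fun setT D.
  apply: measurable_funB;
    exact: (measurable_truncated_rho F T0 cphi eps0 p1 C0 Lk0' (klipt t) (kdiagt t) cW).
have int_D : P.-integrable setT (EFin \o D).
  apply: (bounded_integrable (b := b + b)); first by rewrite -ge0_fin_numE// fin_num_measure.
    exact: mD.
  by move=> w; apply: le_trans (ler_normB _ _) _; apply: lerD; exact: truncate_bound.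
rewrite /psi -RintegralB//; apply: le_trans (le_normr_Rintegral _ int_D) _ => //.
have int_aD := @integrable_norm _ _ _ P setT _ int_D.
rewrite -lee_fin /Rintegral fineK; last exact: (integrable_fin_num measurableT int_aD).
apply: le_trans (mean k t L vmin (set_val x) (set_val x') dd _ Omega P (fun u w => W u w) K
  (fun w => `|D w|) (klipt t) (kdiagt t) L0 v0 full (Gamma_set_val x) (Gamma_set_val x')
  (Gamma_dist_ge T0 x x') Kp _ cW Wm' mom _ _) _.
- by move=> u; exact: measurable_funPT.
- exact: measurableT_comp.
- by move=> w; rewrite normr_ge0 truncate_lip.
rewrite lee_fin powRM ?invr_ge0 ?(ltW v0)// -/(Ct K).
have -> : vmin^-1 `^ al = (vmin `^ al)^-1.
  by rewrite -[vmin^-1]powR_inv1 ?(ltW v0)// -powRrM mulN1r powRN.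
by rewrite mulrA mulrAC.
Qed.
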